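(* Let $I$ and $J$ be disjoint index sets. For any two distributions $\mu$ and $\nu$ in $\mathcal{D}_{\mathrm{alg}}(I\sqcup J)$, $$\mathrm{b}\mathbb{B}(\mu\,\widetilde{\boxtimes\boxtimes}\,\nu)=\mathrm{b}\mathbb{B}(\mu)\,\widetilde{\boxtimes\boxtimes}\,\mathrm{b}\mathbb{B}(\nu).$$
   Context: For $\chi:\{1,\dots,n\}\to\{\ell,r\}$ with $\chi^{-1}(\{\ell\})=\{i_1<\cdots<i_p\}$ and $\chi^{-1}(\{r\})=\{i_{p+1}>\cdots>i_n\}$, let $\prec_\chi$ be the total order $i_1\prec_\chi\cdots\prec_\chi i_n$. $\mathrm{BNC}(\chi)$ is the set of partitions of $\{1,\dots,n\}$ non-crossing with respect to $\prec_\chi$; $\mathrm{BI}(\chi)$ is the set of partitions all of whose blocks are intervals for $\prec_\chi$. For $V=\{v_1<\cdots<v_s\}$, $(x_1,\dots,x_n)|_V=(x_{v_1},\dots,x_{v_s})$ and $\chi|_V$ is regarded as a map on $\{1,\dots,s\}$. For $\alpha:\{1,\dots,n\}\to I\sqcup J$, $\chi_\alpha(k)=\ell$ if $\alpha(k)\in I$ and $\chi_\alpha(k)=r$ if $\alpha(k)\in J$. A non-commutative probability space $(\mathcal{A},\varphi)$ is a unital complex algebra with unital linear functional. Its $(\ell,r)$-cumulants $\kappa_\chi$ and B-$(\ell,r)$-cumulants $B_\chi$ are the unique multilinear functionals $\mathcal{A}^n\to\mathbb{C}$ with $\varphi(x_1\cdots x_n)=\sum_{\pi\in\mathrm{BNC}(\chi)}\prod_{V\in\pi}\kappa_{\chi|_V}((x_1,\dots,x_n)|_V)=\sum_{\pi\in\mathrm{BI}(\chi)}\prod_{V\in\pi}B_{\chi|_V}((x_1,\dots,x_n)|_V)$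 for all $n\geq 1,\chi,x_j$. $\mathcal{D}_{\mathrm{alg}}(I\sqcup J)$ is the set of unital linear functionals $\mu:\mathbb{C}\langle Z_k:k\in I\sqcup J\rangle\to\mathbb{C}$. The joint distribution of a two-faced family $\widehat a=((a_i)_{i\in I},(a_j)_{j\in J})$ in $(\mathcal{A},\varphi)$ is $\mu_{\widehat a}=\varphi\circ\tau$, where $\tau$ is the unital homomorphism with $\tau(Z_k)=a_k$. For $\mu\in\mathcal{D}_{\mathrm{alg}}(I\sqcup J)$ (cumulants taken with respect to $\mu$), $\mathcal{R}_\mu$ and $\eta_\mu$ are the formal power series without constant term in non-commuting indeterminates $\{z_k\}_{k\in I\sqcup J}$ whose coefficients of $z_{\alpha(1)}\cdots z_{\alpha(n)}$ are $\kappa_{\chi_\alpha}(Z_{\alpha(1)},\dots,Z_{\alpha(n)})$ and $B_{\chi_\alpha}(Z_{\alpha(1)},\dots,Z_{\alpha(n)})$ respectively. The maps $\mathcal{R}$ and $\eta$ are bijections from $\mathcal{D}_{\mathrm{alg}}(I\sqcup J)$ onto the set of such series, and $\mathrm{b}\mathbb{B}=\mathcal{R}^{-1}\circ\eta:\mathcal{D}_{\mathrm{alg}}(I\sqcup J)\to\mathcal{D}_{\mathrm{alg}}(I\sqcup J)$. Two two-faced families $\widehat a,\widehat b$ in $(\mathcal{A},\varphi)$ are bi-free if and only if all mixed $(\ell,r)$-cumulants vanish: with $A_{1,\ell},A_{1,r}$ the unital algebras generated by $(a_i)_{i\in I}$ and $(a_j)_{j\in J}$ and $A_{2,\ell},A_{2,r}$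 those generated by $(b_i)_{i\in I}$ and $(b_j)_{j\in J}$, $\kappa_\chi(x_1,\dots,x_n)=0$ for $n\ge2$, $x_m\in A_{\omega(m),\chi(m)}$ and $\omega:\{1,\dots,n\}\to\{1,2\}$ non-constant (this known characterization may be taken as the definition). The twisted multiplicative bi-free convolution $\mu\,\widetilde{\boxtimes\boxtimes}\,\nu$ is the joint distribution of $((a_ib_i)_{i\in I},(b_ja_j)_{j\in J})$, where $\widehat a,\widehat b$ are bi-free two-faced families with joint distributions $\mu$ and $\nu$ respectively (it depends only on $\mu$ and $\nu$). *)

(* Defs.v *)
From HB Require Import structures.
From mathcomp Require Import all_boot all_order all_algebra finmap.
From mathcomp Require Import reals complex.
From mathcomp.multinomials Require Import monalg.
From Stdlib Require Import FunctionalExtensionality ProofIrrelevance.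
From Stdlib Require Import ClassicalEpsilon.

Set Implicit Arguments.
Unset Strict Implicit.
Unset Printing Implicit Defensive.

Import GRing.Theory.

Local Open Scope ring_scope.

(* Everything is done over an arbitrary field C of scalars; the theorem takes
   C := R[i] with R : realType. *)

Variant side := Left | Right.

(* The left positions come first, in increasing order, followed by the right
   positions in decreasing order. *)
Definition chi_lt n (chi : 'I_n -> side) (i j : 'I_n) : bool :=
  match chi i, chi j with
  | Left, Left => (i < j)%N
  | Left, Right => true
  | Right, Left => false
  | Right, Right => (j < i)%N
  end.

Definition chi_noncrossing n (chi : 'I_n -> side) (pi : {set {set 'I_n}}) :=
  [forall V in pi, forall W in pi, (V != W) ==>
    [forall a in V, forall b in W, forall c in V, forall d in W,
       ~~ [&& chi_lt chi a b, chi_lt chi b c & chi_lt chi c d]]].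

Definition chi_interval n (chi : 'I_n -> side) (V : {set 'I_n}) :=
  [forall a in V, forall c in V, forall b,
     chi_lt chi a b && chi_lt chi b c ==> (b \in V)].

Definition partition_class :=
  forall n : nat, ('I_n -> side) -> {set {set {set 'I_n}}}.

Definition BNC : partition_class := fun n chi =>
  [set pi | partition pi [set: 'I_n] && chi_noncrossing chi pi].

Definition BI : partition_class := fun n chi =>
  [set pi | partition pi [set: 'I_n] && [forall V in pi, chi_interval chi V]].

(* enum_val lists the elements of V in increasing order. *)
Definition restr (T : Type) n (V : {set 'I_n}) (x : 'I_n -> T) : 'I_#|V| -> T :=
  fun k => x (enum_val k).

Record unital_functional (C : fieldType) (A : algType C) := UnitalFunctional {
  ufun :> {scalar A};
  ufun1 : ufun 1 = 1
}.

Definition update (T : Type) n (x : 'I_n -> T) (j : 'I_n) (u : T) : 'I_n -> T :=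
  fun i => if i == j then u else x i.

Definition multilinear (C : fieldType) (A : algType C) n
    (K : ('I_n -> A) -> C) : Prop :=
  forall (x : 'I_n -> A) (j : 'I_n) (c : C) (u v : A),
    K (update x j (c *: u + v)) = c * K (update x j u) + K (update x j v).

(* The defining property of the (l,r)-cumulants (P := BNC) and of the
   B-(l,r)-cumulants (P := BI) of (A, phi). *)
Definition is_cumulants (P : partition_class) (C : fieldType) (A : algType C)
    (phi : unital_functional A)
    (K : forall n, ('I_n -> side) -> ('I_n -> A) -> C) : Prop :=
  (forall n (chi : 'I_n -> side), (0 < n)%N -> multilinear (K n chi)) /\
  (forall n (chi : 'I_n -> side) (x : 'I_n -> A), (0 < n)%N ->
     phi (\prod_(i < n) x i) =
     \sum_(pi in P n chi) \prod_(V in pi) K #|V| (restr chi) (restr x)).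

(* The moment-cumulant formula solved for the term of the one-block partition.
   The blocks of any other partition have less than n elements, so N = n steps
   are enough; cumulantP and cumulant_uniq below show that this is the unique
   solution. *)
Fixpoint cumulant_rec (P : partition_class) (C : fieldType) (A : algType C)
    (phi : unital_functional A) (N n : nat)
    (chi : 'I_n -> side) (x : 'I_n -> A) {struct N} : C :=
  if N is N'.+1 then
    phi (\prod_(i < n) x i) -
    \sum_(pi in P n chi | pi != [set setT])
       \prod_(V in pi) cumulant_rec P phi N' (restr (V := V) chi) (restr x)
  else 0.

Definition cumulant (P : partition_class) (C : fieldType) (A : algType C)
    (phi : unital_functional A) (n : nat)
    (chi : 'I_n -> side) (x : 'I_n -> A) : C :=
  cumulant_rec P phi n chi x.

Definition kappa (C : fieldType) (A : algType C) (phi : unital_functional A) :=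
  cumulant BNC phi.

Definition Bcumulant (C : fieldType) (A : algType C)
    (phi : unital_functional A) := cumulant BI phi.

Section CumulantTheory.
Context (P : partition_class).
Arguments P : clear implicits.
Hypothesis PT : forall n chi, (0 < n)%N -> [set setT] \in P n chi.
Hypothesis Ppart : forall n chi pi, pi \in P n chi -> partition pi [set: 'I_n].

Lemma block_lt n chi pi (V : {set 'I_n}) :
  pi \in P n chi -> pi != [set setT] -> V \in pi -> (#|V| < n)%N.
Proof.
move=> piP npi Vpi; rewrite ltn_neqAle -[X in (_ <= X)%N]card_ord max_card andbT.
apply: contra npi => /eqP cV.
have VT : V = setT.
  by apply/eqP; rewrite eqEcard subsetT cardsT card_ord cV leqnn.
have /and3P[_ /trivIsetP tri n0] := Ppart piP.
apply/eqP/setP => W; rewrite inE; apply/idP/eqP => [Wpi|->]; last by rewrite -VT.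
apply: contraNeq n0 => WT; have := tri V W Vpi Wpi.
rewrite VT eq_sym => /(_ WT); rewrite -setI_eq0 setTI => /eqP <-; exact: Wpi.
Qed.

Lemma block_gt0 n chi pi (V : {set 'I_n}) :
  pi \in P n chi -> V \in pi -> (0 < #|V|)%N.
Proof.
move=> /Ppart/and3P[_ _ n0] Vpi; rewrite card_gt0.
by apply: contraNneq n0 => <-.
Qed.

Lemma P0E (chi : 'I_0 -> side) : (P 0 chi) \subset [set set0].
Proof.
apply/subsetP => pi /Ppart/and3P[_ _ n0]; rewrite inE; apply/eqP/setP => V.
rewrite inE; apply/negbTE; apply: contra n0 => Vpi.
by have -> : set0 = V by apply/setP => -[].
Qed.

Section Phi.
Context (C : fieldType) (A : algType C) (phi : unital_functional A).

Lemma cumulant_recE N n chi x : (0 < n)%N -> (n <= N)%N ->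
  cumulant_rec P phi N (n := n) chi x = cumulant P phi chi x.
Proof.
rewrite /cumulant; elim/ltn_ind: n N chi x => n IH N chi x n0 nN.
case: N nN => [|N] nN; first by move: n0; rewrite lt0n -leqn0 nN.
case: n IH chi x n0 nN => // n IH chi x _ nN /=.
congr (_ - _); apply: eq_bigr => pi /andP[piP npi]; apply: eq_bigr => V Vpi.
have Vn := block_lt piP npi Vpi; have V0 := block_gt0 piP Vpi.
by rewrite [LHS]IH // ?[RHS]IH // -ltnS; apply: leq_trans Vn _.
Qed.

Lemma cast_fam (T : Type) (K : forall n, ('I_n -> side) -> ('I_n -> T) -> C)
    n m (e : n = m) chi x chi' x' :
  (forall i, chi i = chi' (cast_ord e i)) ->
  (forall i, x i = x' (cast_ord e i)) -> K n chi x = K m chi' x'.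
Proof.
case: m / e chi' x' => chi' x' hc hx.
have -> : chi = chi' by apply: functional_extensionality => i; rewrite hc cast_ord_id.
by have -> : x = x' by apply: functional_extensionality => i; rewrite hx cast_ord_id.
Qed.

Lemma restr_setT (T : Type) (K : forall n, ('I_n -> side) -> ('I_n -> T) -> C)
    n chi x :
  K #|[set: 'I_n]| (restr chi) (restr x) = K n chi x.
Proof.
have e : #|[set: 'I_n]| = n by rewrite cardsT card_ord.
have en i : enum_val i = cast_ord e i.
  apply: val_inj; have i0 : 'I_n := cast_ord e i.
  rewrite (enum_val_nth i0) enum_setT -enumT /=.
  by rewrite nth_enum_ord //; apply: leq_trans (ltn_ord i) _; rewrite e.
by apply: (@cast_fam T K _ _ e) => i; rewrite /restr en.
Qed.

Lemma cumulant_moment n chi (x : 'I_n -> A) : (0 < n)%N ->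
  phi (\prod_(i < n) x i) =
  \sum_(pi in P n chi) \prod_(V in pi) cumulant P phi (restr chi) (restr (V := V) x).
Proof.
move=> n0.
rewrite (bigD1 [set setT]) ?PT //= big_set1.
rewrite (restr_setT (fun n => cumulant P phi (n := n))).
case: n n0 chi x => // n _ chi x.
rewrite {1}/cumulant /= [X in _ - X + _](_ : _ = \sum_(pi in P n.+1 chi | pi != [set setT])
       \prod_(V in pi) cumulant P phi (restr (V := V) chi) (restr x)) ?subrK //.
apply: eq_bigr => pi /andP[piP npi]; apply: eq_bigr => V Vpi.
by rewrite cumulant_recE ?(block_gt0 piP) // -ltnS; apply: block_lt piP npi Vpi.
Qed.

Lemma prod_update_notin n (x : 'I_n -> A) j u (s : seq 'I_n) : j \notin s ->
  \prod_(i <- s) update x j u i = \prod_(i <- s) x i.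
Proof.
move=> js; rewrite big_seq [RHS]big_seq; apply: eq_bigr => i is_.
by rewrite /update; case: eqP js => // <-; rewrite is_.
Qed.

Lemma prod_update n (x : 'I_n -> A) j c u v (s : seq 'I_n) : uniq s -> j \in s ->
  \prod_(i <- s) update x j (c *: u + v) i =
  c *: \prod_(i <- s) update x j u i + \prod_(i <- s) update x j v i.
Proof.
elim: s => // i s IH /= /andP[is_ us]; rewrite inE !big_cons.
have [ji _|ij /= js] := eqVneq j i.
  by rewrite ji !prod_update_notin // /update eqxx mulrDl scalerAl.
by rewrite IH // /update eq_sym (negbTE ij) mulrDr scalerAr.
Qed.

Lemma restr_update_notin (T : Type) n (V : {set 'I_n}) (x : 'I_n -> T) j u :
  j \notin V -> restr (V := V) (update x j u) = restr x.
Proof.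
move=> jV; apply: functional_extensionality => i; rewrite /restr /update.
by case: eqP jV => // <-; rewrite enum_valP.
Qed.

Lemma restr_update (T : Type) n (V : {set 'I_n}) (x : 'I_n -> T) (k : 'I_#|V|) u :
  restr (update x (enum_val k) u) = update (restr x) k u.
Proof.
apply: functional_extensionality => i; rewrite /restr /update.
by rewrite (inj_eq enum_val_inj).
Qed.

Lemma cumulant_multilinear n chi :
  (0 < n)%N -> multilinear (cumulant P phi (n := n) chi).
Proof.
elim/ltn_ind: n chi => n IH chi n0 x j c u v.
case: n IH chi n0 x j => // n IH chi _ x j.
have sumE y : cumulant P phi chi y = phi (\prod_(i < n.+1) y i) -
    \sum_(pi in P n.+1 chi | pi != [set setT])
       \prod_(V in pi) cumulant P phi (restr (V := V) chi) (restr y).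
  rewrite [X in _ = X - _](cumulant_moment chi) // (bigD1 [set setT]) ?PT //=.
  by rewrite big_set1 (restr_setT (fun n => cumulant P phi (n := n))) addrK.
rewrite !sumE prod_update ?index_enum_uniq ?mem_index_enum //.
rewrite linearD linearZ /= mulrBr addrACA -opprD; congr (_ - _).
rewrite mulr_sumr -big_split /=; apply: eq_bigr => pi /andP[piP npi].
have /and3P[/eqP cov /trivIsetP tri _] := Ppart piP.
have : j \in cover pi by rewrite cov inE.
case/bigcupP => V Vpi jV; rewrite !(bigD1 V Vpi) /=.
have rest w : \prod_(W in pi | W != V)
      cumulant P phi (restr (V := W) chi) (restr (update x j w)) =
    \prod_(W in pi | W != V) cumulant P phi (restr (V := W) chi) (restr x).
  apply: eq_bigr => W /andP[Wpi WV]; rewrite restr_update_notin //.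
  by have /disjointFl -> := tri _ _ Wpi Vpi WV.
rewrite !rest mulrA -mulrDl; congr (_ * _).
rewrite -(enum_rankK_in jV jV) !restr_update IH //.
  exact: block_lt piP npi Vpi.
exact: block_gt0 piP Vpi.
Qed.

Lemma cumulantP : is_cumulants P phi (cumulant P phi).
Proof.
by split=> [n chi n0|n chi x n0]; [apply: cumulant_multilinear|apply: cumulant_moment].
Qed.

Lemma cumulant_uniq K : is_cumulants P phi K ->
  forall n chi (x : 'I_n -> A), (0 < n)%N -> K n chi x = cumulant P phi chi x.
Proof.
move=> [_ KM]; elim/ltn_ind => n IH chi x n0.
have := KM n chi x n0; rewrite (cumulant_moment chi) //.
rewrite (bigD1 [set setT]) ?PT //= [X in _ = X -> _](bigD1 [set setT]) ?PT //=.
rewrite !big_set1 (restr_setT K) ?(restr_setT (fun n => cumulant P phi (n := n))).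
move=> E; apply/esym; move: E.
rewrite [X in _ + X = _](_ : _ = \sum_(pi in P n chi | pi != [set setT])
       \prod_(V in pi) K #|V| (restr chi) (restr x)); first exact: addIr.
apply: eq_bigr => pi /andP[piP npi]; apply: eq_bigr => V Vpi.
by rewrite IH ?(block_gt0 piP) ?(block_lt piP npi Vpi).
Qed.

End Phi.
End CumulantTheory.

Lemma chi_lt_irr n (chi : 'I_n -> side) i : chi_lt chi i i = false.
Proof. by rewrite /chi_lt; case: (chi i); rewrite ltnn. Qed.

Lemma partition_oneblock n : (0 < n)%N -> partition [set setT] [set: 'I_n].
Proof.
move=> n0; rewrite /partition /cover big_set1 eqxx /=; apply/andP; split.
  by apply/trivIsetP => U V; rewrite !inE => /eqP -> /eqP ->; rewrite eqxx.
by rewrite inE eq_sym -card_gt0 cardsT card_ord.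
Qed.

Lemma BNC_oneblock n (chi : 'I_n -> side) : (0 < n)%N -> [set setT] \in BNC chi.
Proof.
move=> n0; rewrite inE partition_oneblock //=.
apply/forall_inP => V; rewrite inE => /eqP ->.
by apply/forall_inP => W; rewrite inE => /eqP ->; rewrite eqxx.
Qed.

Lemma BI_oneblock n (chi : 'I_n -> side) : (0 < n)%N -> [set setT] \in BI chi.
Proof.
move=> n0; rewrite inE partition_oneblock //=.
apply/forall_inP => V; rewrite inE => /eqP ->.
by do 2![apply/forall_inP => ? _]; apply/forallP => b; rewrite inE implybT.
Qed.

Lemma BNC_partition n (chi : 'I_n -> side) pi :
  pi \in BNC chi -> partition pi [set: 'I_n].
Proof. by rewrite inE => /andP[]. Qed.

Lemma BI_partition n (chi : 'I_n -> side) pi :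
  pi \in BI chi -> partition pi [set: 'I_n].
Proof. by rewrite inE => /andP[]. Qed.

Lemma kappaP (C : fieldType) (A : algType C) (phi : unital_functional A) :
  is_cumulants BNC phi (kappa phi).
Proof. exact: cumulantP BNC_oneblock BNC_partition C A phi. Qed.

Lemma kappa_uniq (C : fieldType) (A : algType C) (phi : unital_functional A) K :
  is_cumulants BNC phi K ->
  forall n chi (x : 'I_n -> A), (0 < n)%N -> K n chi x = kappa phi chi x.
Proof. exact: cumulant_uniq BNC_oneblock BNC_partition C A phi K. Qed.

Lemma BcumulantP (C : fieldType) (A : algType C) (phi : unital_functional A) :
  is_cumulants BI phi (Bcumulant phi).
Proof. exact: cumulantP BI_oneblock BI_partition C A phi. Qed.

Lemma Bcumulant_uniq (C : fieldType) (A : algType C)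
    (phi : unital_functional A) K :
  is_cumulants BI phi K ->
  forall n chi (x : 'I_n -> A), (0 < n)%N -> K n chi x = Bcumulant phi chi x.
Proof. exact: cumulant_uniq BI_oneblock BI_partition C A phi K. Qed.

(* C<Z_k : k in K>, as the monoid algebra of the words in K. *)
Definition free_alg (C : fieldType) (K : choiceType) := {malg C[{fmonom K}]}.

HB.instance Definition _ (C : fieldType) (K : choiceType) := GRing.Lalgebra.on (@free_alg C K).

Lemma free_alg_scalerAr (C : fieldType) (K : choiceType) (c : C)
  (p q : free_alg C K) : c *: (p * q) = p * (c *: q).
Proof.
rewrite -[c *: q]mul_malgC mulrA.
suff -> : p * c%:MP = c *: p by rewrite scalerAl.
rewrite malgM_def fgmulgU malgZ_def; apply: eq_bigr => k _.
by rewrite mulm1 mulrC.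
Qed.

HB.instance Definition _ (C : fieldType) (K : choiceType) :=
  GRing.Lalgebra_isAlgebra.Build C (@free_alg C K) (@free_alg_scalerAr C K).

Definition word (C : fieldType) (K : choiceType) (w : seq K) : free_alg C K :=
  << FMonom w >>.
Arguments word C {K} w.

Definition Zvar (C : fieldType) (K : choiceType) (k : K) : free_alg C K :=
  word C [:: k].
Arguments Zvar C {K} k.

Definition word_prod (C : fieldType) (K : choiceType) (A : algType C)
  (a : K -> A) (w : {fmonom K}) : A := \prod_(k <- (w : seq K)) a k.

(* The unital homomorphism tau with tau(Z_k) = a_k: see eval_alg_monoid and
   eval_algZ. *)
Definition eval_alg (C : fieldType) (K : choiceType) (A : algType C)
  (a : K -> A) (p : free_alg C K) : A := mmap (in_alg A) (word_prod a) p.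

Section FreeAlgTheory.
Context (C : fieldType) (K : choiceType).

Lemma free_alg_sum (p : free_alg C K) :
  p = \sum_(w <- msupp p) p@_w *: word C (w : seq K).
Proof.
rewrite {1}[p]monalgE; apply: eq_bigr => w _; rewrite /word fmK.
by apply/malgP => v; rewrite mcoeffZ !mcoeffU mulrnAr mulr1.
Qed.

Lemma word_nil : word C [::] = 1 :> free_alg C K.
Proof.
rewrite /word; congr << _ >>; apply/eqP.
by rewrite -val_eqE /= fm1.
Qed.

Lemma wordM (v w : seq K) : word C (v ++ w) = word C v * word C w.
Proof.
rewrite malgM_def /word fgmulUU mulr1; congr << _ >>; apply/eqP.
by rewrite -val_eqE /= fmM.
Qed.

Lemma wordE (w : seq K) : word C w = \prod_(k <- w) Zvar C k.
Proof.
elim: w => [|k w IH]; first by rewrite big_nil word_nil.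
by rewrite -cat1s wordM IH big_cat big_seq1.
Qed.

Lemma unital_functional_eq (A : algType C) (f g : unital_functional A) :
  f =1 g -> f = g.
Proof.
case: f => [[f cf] f1]; case: g => [[g cg] g1] /= fg.
have E : f = g by apply: functional_extensionality => x; exact: fg.
case: g / E cg g1 fg => cg g1 fg.
have E : cf = cg.
  case: cf cg {f1 g1 fg} => [[m1] [s1]] [[m2] [s2]].
  by rewrite (proof_irrelevance _ m1 m2) (proof_irrelevance _ s1 s2).
case: cg / E g1 fg => g1 _; congr UnitalFunctional; exact: proof_irrelevance.
Qed.

Lemma dist_eq (f g : unital_functional (free_alg C K)) :
  (forall w, f (word C w) = g (word C w)) -> f = g.
Proof.
move=> fg; apply: unital_functional_eq => p.
rewrite [p]free_alg_sum !linear_sum; apply: eq_bigr => w _.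
by rewrite !linearZ /= fg.
Qed.

Context (A : algType C) (a : K -> A).

Lemma word_prod_mmorphism : mmorphism (@word_prod C K A a).
Proof.
by split=> [v w|]; rewrite /word_prod ?fmM ?big_cat // fm1 big_nil.
Qed.

HB.instance Definition _ :=
  monalg.isMultiplicative.Build {fmonom K} A (@word_prod C K A a)
    word_prod_mmorphism.

Lemma eval_alg_linear : linear (@eval_alg C K A a).
Proof.
move=> c p q; rewrite /eval_alg mmapD mmapZ /= mulr_algl //.
Qed.

HB.instance Definition _ :=
  GRing.isLinear.Build C (free_alg C K) A *:%R (@eval_alg C K A a)
    eval_alg_linear.

Lemma eval_alg_monoid : monoid_morphism (@eval_alg C K A a).
Proof.
split; first by rewrite /eval_alg mmap1.
have [] := @commr_mmap_is_multiplicative _ C A (in_alg A) (word_prod a) => //.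
by move=> g m m'; apply: commr_sym; rewrite /GRing.comm /= mulr_algl mulr_algr.
Qed.

HB.instance Definition _ :=
  GRing.isMonoidMorphism.Build (free_alg C K) A (@eval_alg C K A a)
    eval_alg_monoid.

Lemma eval_algZ k : eval_alg a (Zvar C k) = a k.
Proof.
rewrite /eval_alg /Zvar /word mmapU /word_prod /=.
by rewrite mulr_algl scale1r big_seq1.
Qed.

Lemma eval_alg_word w : eval_alg a (word C w) = \prod_(k <- w) a k.
Proof.
by rewrite wordE rmorph_prod; apply: eq_bigr => k _; exact: eval_algZ.
Qed.

End FreeAlgTheory.

Definition dist (C : fieldType) (I J : choiceType) :=
  unital_functional (free_alg C (I + J)%type).

Definition two_faced_family (C : fieldType) (A : algType C) (I J : choiceType) :=
  (I + J)%type -> A.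

Lemma joint_dist1 (C : fieldType) (A : algType C) (phi : unital_functional A)
    (K : choiceType) (a : K -> A) : (phi \o eval_alg a) 1 = 1.
Proof. by rewrite /= rmorph1 ufun1. Qed.

Definition joint_dist (C : fieldType) (A : algType C)
    (phi : unital_functional A) (I J : choiceType)
    (a : two_faced_family A I J) : dist C I J :=
  UnitalFunctional (joint_dist1 phi a).

(* A formal power series in non-commuting indeterminates z_k, k in K, without
   constant term is given by its coefficients: z_{w_1} ... z_{w_n} has
   coefficient f [:: w_1; ...; w_n]. *)
Record ncseries (C : fieldType) (K : choiceType) := NCSeries {
  coef :> seq K -> C;
  coef_nil : coef [::] = 0
}.

Definition face (I J : Type) (k : I + J) : side :=
  if k is inl _ then Left else Right.

(* The word w seen as a map alpha on its positions; chi_word is chi_alpha. *)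
Definition letter (K : Type) (w : seq K) : 'I_(size w) -> K := tnth (in_tuple w).

Definition chi_word (I J : Type) (w : seq (I + J)) : 'I_(size w) -> side :=
  fun i => face (letter i).

Definition cumulant_coef (P : partition_class) (C : fieldType)
    (I J : choiceType) (mu : dist C I J) (w : seq (I + J)) : C :=
  cumulant P mu (@chi_word I J w) (fun i => Zvar C (letter i)).

Lemma cumulant_coef_nil (P : partition_class) (C : fieldType)
  (I J : choiceType) (mu : dist C I J) : cumulant_coef P mu [::] = 0.
Proof. by []. Qed.

Definition R_series (C : fieldType) (I J : choiceType) (mu : dist C I J) :
  ncseries C (I + J)%type := NCSeries (cumulant_coef_nil BNC mu).

Definition eta_series (C : fieldType) (I J : choiceType) (mu : dist C I J) :
  ncseries C (I + J)%type := NCSeries (cumulant_coef_nil BI mu).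

(* The inverse of R_series (see R_seriesK and R_invK): the functional whose
   moments are given by the moment-cumulant formula. *)
Definition subword (K : Type) (w : seq K) (V : {set 'I_(size w)}) : seq K :=
  [seq letter i | i <- enum V].

Definition moment_of_series (C : fieldType) (I J : choiceType)
    (f : ncseries C (I + J)%type) (w : seq (I + J)) : C :=
  \sum_(pi in BNC (@chi_word I J w)) \prod_(V in pi) f (subword V).

Definition linear_ext (C : fieldType) (K : choiceType) (h : seq K -> C)
    (p : free_alg C K) : C :=
  \sum_(w <- msupp p) p@_w * h (w : seq K).

Lemma linear_extEw (C : fieldType) (K : choiceType) (h : seq K -> C)
    (d : {fset {fmonom K}}) (p : free_alg C K) : (msupp p `<=` d)%fset ->
  linear_ext h p = \sum_(w <- d) p@_w * h (w : seq K).
Proof.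
exact: (@mmapEw _ _ C idfun (fun w : {fmonom K} => h (w : seq K))).
Qed.

Lemma linear_ext_scalar (C : fieldType) (K : choiceType) (h : seq K -> C) :
  scalar (@linear_ext C K h).
Proof.
move=> c p q; pose d := (msupp p `|` msupp q)%fset.
have sp : (msupp p `<=` d)%fset by apply: fsubsetUl.
have sq : (msupp q `<=` d)%fset by apply: fsubsetUr.
have sc : (msupp (c *: p + q) `<=` d)%fset.
  apply: fsubset_trans (msuppD_le _ _) _; apply: fsetSU; exact: msuppZ_le.
rewrite (linear_extEw h sc) (linear_extEw h sp) (linear_extEw h sq).
rewrite mulr_sumr -big_split /=; apply: eq_bigr => w _.
by rewrite mcoeffD mcoeffZ mulrDl mulrA.
Qed.

HB.instance Definition _ (C : fieldType) (K : choiceType) (h : seq K -> C) :=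
  GRing.isLinear.Build C (free_alg C K) C *%R (@linear_ext C K h)
    (@linear_ext_scalar C K h).

Lemma linear_ext_word (C : fieldType) (K : choiceType) (h : seq K -> C) w :
  linear_ext h (word C w) = h w.
Proof.
by rewrite /linear_ext /word msuppU1 big_seq_fset1 mcoeffUU mul1r.
Qed.

Lemma R_inv1 (C : fieldType) (I J : choiceType) (f : ncseries C (I + J)%type) :
  linear_ext (moment_of_series f) 1 = 1.
Proof.
rewrite -(word_nil C) linear_ext_word /moment_of_series.
rewrite (_ : BNC _ = [set set0]) ?big_set1 ?big_set0 //.
apply/eqP; rewrite eqEsubset (P0E BNC_partition) sub1set inE /=.
apply/andP; split; last by apply/forallP => V; rewrite inE.
apply/and3P; split; last by rewrite inE.
  by apply/eqP/setP => -[].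
by apply/trivIsetP => ?; rewrite inE.
Qed.

Definition R_inv (C : fieldType) (I J : choiceType)
    (f : ncseries C (I + J)%type) : dist C I J :=
  UnitalFunctional (R_inv1 f).

Section RBijection.
Context (C : fieldType) (I J : choiceType).
Local Notation K := (I + J)%type.

Lemma dist_word (mu : dist C I J) (w : seq K) :
  mu (word C w) = mu (\prod_(i < size w) Zvar C (letter i)).
Proof.
by rewrite wordE big_tnth.
Qed.

Lemma cumulant_coef_subword (mu : dist C I J) (w : seq K) (V : {set 'I_(size w)}) :
  kappa mu (restr (V := V) (@chi_word I J w)) (restr (fun i => Zvar C (letter i)))
  = R_series mu (subword V).
Proof.
have e : #|V| = size (subword V) by rewrite size_map -cardE.
have l (i : 'I_#|V|) : letter (cast_ord e i) = letter (enum_val i) :> K.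
  rewrite {1}/letter (tnth_nth (letter (enum_val i))) /=.
  rewrite (nth_map (enum_val i)) -?cardE //.
  by rewrite -(enum_val_nth (enum_val i)).
apply: (@cast_fam _ _ (fun n => cumulant BNC mu (n := n)) _ _ e) => i.
  by rewrite /restr /chi_word l.
by rewrite /restr l.
Qed.

Lemma R_seriesK : cancel (@R_series C I J) (@R_inv C I J).
Proof.
move=> mu; apply: dist_eq => w; rewrite /= linear_ext_word.
case: w => [|k w]; last first.
  have [_ KM] := kappaP mu; rewrite dist_word (KM _ (@chi_word I J (k :: w))) //.
  apply: eq_bigr => pi _.
  by apply: eq_bigr => V _; rewrite cumulant_coef_subword.
have := R_inv1 (R_series mu).
by rewrite -(word_nil C) linear_ext_word => ->; rewrite word_nil ufun1.
Qed.

Lemma ncseries_eq (f g : ncseries C K) : f =1 g -> f = g.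
Proof.
case: f g => f f0 [g g0] /= fg.
have E : f = g by apply: functional_extensionality.
by case: g / E g0 fg => g0 _; congr NCSeries; apply: proof_irrelevance.
Qed.

Lemma subword_setT (w : seq K) : subword [set: 'I_(size w)] = w.
Proof. by rewrite /subword enum_setT -enumT; exact: (map_tnth_enum (in_tuple w)). Qed.

Lemma R_invK : cancel (@R_inv C I J) (@R_series C I J).
Proof.
move=> f; apply: ncseries_eq => w.
move: {2}(size w) (leqnn (size w)) => n; elim: n w => [|n IH] w wn.
  by move: wn; rewrite leqn0 => /nilP ->; rewrite !coef_nil.
have [->|w0] := eqVneq w [::]; first by rewrite !coef_nil.
have s0 : (0 < size w)%N by rewrite lt0n size_eq0.
have [_ KM] := kappaP (R_inv f).
have := KM _ (@chi_word I J w) (fun i => Zvar C (letter i)) s0.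
rewrite -dist_word /= linear_ext_word /moment_of_series.
under [RHS]eq_bigr do under eq_bigr do rewrite cumulant_coef_subword.
rewrite (bigD1 [set setT]) ?BNC_oneblock //=.
rewrite [X in _ = X -> _](bigD1 [set setT]) ?BNC_oneblock //= !big_set1.
rewrite !subword_setT => E; apply/esym; move: E.
rewrite [X in _ + X = _](_ : _ = \sum_(pi in BNC (@chi_word I J w) | pi != [set setT])
   \prod_(V in pi) R_series (R_inv f) (subword V)); first exact: addIr.
apply: eq_bigr => pi /andP[piP npi]; apply: eq_bigr => V Vpi.
apply/esym/IH; rewrite size_map -cardE -ltnS.
exact: leq_trans (block_lt BNC_partition piP npi Vpi) wn.
Qed.
End RBijection.

(* R^{-1} o eta *)
Definition bBP (C : fieldType) (I J : choiceType) (mu : dist C I J) : dist C I J :=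
  R_inv (eta_series mu).

Inductive gen_alg (C : fieldType) (A : algType C) (X : Type) (s : X -> A) :
    A -> Prop :=
| gen_scalar c : gen_alg s c%:A
| gen_elt k : gen_alg s (s k)
| gen_add x y : gen_alg s x -> gen_alg s y -> gen_alg s (x + y)
| gen_mul x y : gen_alg s x -> gen_alg s y -> gen_alg s (x * y).

Definition face_alg (C : fieldType) (A : algType C) (I J : choiceType)
    (a : two_faced_family A I J) (s : side) : A -> Prop :=
  match s with
  | Left => gen_alg (fun i : I => a (inl i))
  | Right => gen_alg (fun j : J => a (inr j))
  end.

(* omega m = true stands for the first family, omega m = false for the second. *)
Definition bifree (C : fieldType) (A : algType C) (phi : unital_functional A)
    (I J : choiceType) (a b : two_faced_family A I J) : Prop :=
  forall (n : nat) (chi : 'I_n -> side) (omega : 'I_n -> bool) (x : 'I_n -> A),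
    (2 <= n)%N ->
    (exists i j, omega i <> omega j) ->
    (forall m, face_alg (if omega m then a else b) (chi m) (x m)) ->
    kappa phi chi x = 0.

Definition twisted_product (C : fieldType) (A : algType C) (I J : choiceType)
    (a b : two_faced_family A I J) : two_faced_family A I J :=
  fun k => match k with
           | inl _ => a k * b k
           | inr _ => b k * a k
           end.

Definition is_twisted_conv (C : fieldType) (I J : choiceType)
    (mu nu rho : dist C I J) : Prop :=
  exists (A : algType C) (phi : unital_functional A)
         (a b : two_faced_family A I J),
    [/\ bifree phi a b, joint_dist phi a = mu, joint_dist phi b = nu &
        joint_dist phi (twisted_product a b) = rho].

(* Bi-free families with prescribed joint distributions exist, and the joint
   distribution of their twisted product depends only on mu and nu: there is
   exactly one rho with is_twisted_conv mu nu rho, and epsilon selects it. *)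
Definition twisted_conv (C : fieldType) (I J : choiceType)
    (mu nu : dist C I J) : dist C I J :=
  epsilon (inhabits mu) (is_twisted_conv mu nu).

(* Main.v *)
Require Import Defs.
From HB Require Import structures.
From mathcomp Require Import all_boot all_order all_algebra.
From mathcomp Require Import reals complex boolp.
From Stdlib Require Import FunctionalExtensionality ClassicalEpsilon.

Set Implicit Arguments.
Unset Strict Implicit.
Unset Printing Implicit Defensive.

Import GRing.Theory.

Local Open Scope ring_scope.

(** Fix a word and list its positions in the order of chi. All moments and
    cumulants of subwords become series indexed by sequences of positions, and
    the (l,r)-cumulants (resp. B-(l,r)-cumulants) are related to the moments by
    the one-sided free (resp. boolean) functional equation; in this order the
    twisted product reads a b a b ... a b on both faces.

    Let M be the moment series of the products, for a pair with free cumulant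
    series f, g. Splitting at outer blocks expresses M through the irreducible
    contributions L and N of the words a b ... a and b a ... b, which satisfy a
    fixed-point system with parameters f, g. Rewriting this system with the
    boolean cumulants f', g' of the two families gives
      L_y = f'_y(z N),   N_x = g'_x(L z),   eta_M = f'(z N),
    where f'_y (resp. g'_x) collects the words of f' (g') with last letter y
    (first letter x), this letter being removed; and, by uniqueness of fixed
    points, the same L and N solve the system that computes the free cumulants
    of the product of a pair with free cumulants f', g'. So the boolean
    cumulants of the product are the same function of (f', g') as the free
    cumulants of the product of the images under R^-1 o eta.

    For the existence of bi-free pairs, the vanishing of mixed cumulants has to
    pass from generators to products of generators: this follows from a
    description of M by the moments of one family and the free cumulants of the
    other, which is insensitive to the merging of neighbouring letters of the
    former. *)

(** * Series in non-commuting indeterminates, indexed by words *)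

(** The order of chi lives on positions and not on letters, which may repeat; hence the alphabet of
    the series is the finite type of positions of one fixed word. A series is defined on every
    sequence of positions, but only its values on sequences increasing for the order of chi carry
    meaning. This is harmless: at a given sequence the moment and cumulant series depend on each
    other only through its subsequences, which are increasing again. The functional equations are
    solved and compared degree by degree: a map that improves the agreement of two series by one
    degree has exactly one fixed point. This replaces compositional inverses and turns most
    identities into the remark that both sides solve one equation. The two convolutions of the
    theorem enter through the relation [is_twisted_conv], so the algebra applies to any bi-free
    pair; constructing one such pair is a separate task, made harder by the fact that bi-freeness
    speaks about whole face algebras, which contain units and sums besides monomials. *)

Definition ser (C : Type) (T : Type) := seq T -> C.

HB.instance Definition _ (C T : Type) := gen_eqMixin (ser C T).
HB.instance Definition _ (C T : Type) := gen_choiceMixin (ser C T).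

Section SeriesRing.
Context (C : comNzRingType) (T : Type).
Implicit Types (A B D : ser C T) (w : seq T).

Lemma serP A B : A =1 B -> A = B.
Proof. exact: functional_extensionality. Qed.

Definition ser_zero : ser C T := fun=> 0.
Definition ser_opp A : ser C T := fun w => - A w.
Definition ser_add A B : ser C T := fun w => A w + B w.

Fact ser_addA : associative ser_add.
Proof. by move=> A B D; apply: serP => w; exact: addrA. Qed.
Fact ser_addC : commutative ser_add.
Proof. by move=> A B; apply: serP => w; exact: addrC. Qed.
Fact ser_add0 : left_id ser_zero ser_add.
Proof. by move=> A; apply: serP => w; exact: add0r. Qed.
Fact ser_addN : left_inverse ser_zero ser_opp ser_add.
Proof. by move=> A; apply: serP => w; exact: addNr. Qed.

HB.instance Definition _ := GRing.isZmodule.Build (ser C T)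
  ser_addA ser_addC ser_add0 ser_addN.

Definition lder (x : T) A : ser C T := fun w => A (x :: w).
Definition rder (y : T) A : ser C T := fun w => A (rcons w y).
Definition lders (p : seq T) A : ser C T := fun w => A (p ++ w).

(** The Cauchy product (see [serM_cat]), computed by left derivatives: the cut is either before the
    first letter, or this letter moves into [A]. Inductions on the word then run by computation. *)
Fixpoint conv A B w : C :=
  if w is x :: v then A [::] * B w + conv (lder x A) B v else A [::] * B [::].

Definition ser_one : ser C T := fun w => if w is [::] then 1 else 0.

Lemma conv0l B w : conv 0 B w = 0.
Proof. by elim: w => [|x w IH] /=; rewrite mul0r // add0r. Qed.

Fact conv_addl : left_distributive conv ser_add.
Proof.
move=> A B D; apply: serP => w; rewrite /ser_add.
elim: w A B => [|x w IH] A B /=; rewrite mulrDl //.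
by rewrite [conv _ _ w]IH addrACA.
Qed.

Fact conv_addr : right_distributive conv ser_add.
Proof.
move=> A B D; apply: serP => w; rewrite /ser_add.
by elim: w A => [|x w IH] A /=; rewrite mulrDr // IH addrACA.
Qed.

Lemma convZl c A B w : conv (fun v => c * A v) B w = c * conv A B w.
Proof.
elim: w A => [|x w IH] A /=; rewrite -mulrA // mulrDr; congr (_ + _).
exact: (IH (lder x A)).
Qed.

Fact conv_assoc : associative conv.
Proof.
move=> A B D; apply: serP => w; elim: w A => [|x w IH] A /=; first exact: mulrA.
rewrite mulrDr -addrA mulrA; congr (_ + _).
rewrite IH -(convZl (A [::]) (lder x B)).
have E := conv_addl (fun v => A [::] * lder x B v) (conv (lder x A) B) D.
exact: (esym (congr1 (fun h : ser C T => h w) E)).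
Qed.

Fact conv1l : left_id ser_one conv.
Proof.
move=> A; apply: serP => -[|x w] /=; rewrite mul1r //.
by rewrite [conv _ _ _](_ : _ = 0) ?addr0 // -(conv0l A w).
Qed.

Fact conv1r : right_id ser_one conv.
Proof.
move=> A; apply: serP => w; elim: w A => [|x w IH] A /=; first by rewrite mulr1.
by rewrite mulr0 add0r IH.
Qed.

Fact ser_one_neq0 : ser_one != 0.
Proof.
apply/eqP => /(congr1 (fun h : ser C T => h [::])) /= /eqP.
by rewrite (negbTE (oner_neq0 _)).
Qed.

HB.instance Definition _ := GRing.Zmodule_isNzRing.Build (ser C T)
  conv_assoc conv1l conv1r conv_addl conv_addr ser_one_neq0.

Lemma ser0E w : (0 : ser C T) w = 0. Proof. by []. Qed.
Lemma ser1E w : (1 : ser C T) w = if w is [::] then 1 else 0. Proof. by []. Qed.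
Lemma serDE A B w : (A + B) w = A w + B w. Proof. by []. Qed.
Lemma serNE A w : (- A) w = - A w. Proof. by []. Qed.
Lemma serBE A B w : (A - B) w = A w - B w. Proof. by []. Qed.
Lemma ser_sumE (I : Type) (r : seq I) (P : pred I) (F : I -> ser C T) w :
  (\sum_(i <- r | P i) F i) w = \sum_(i <- r | P i) F i w.
Proof.
exact: (big_morph (fun A : ser C T => A w)).
Qed.

Lemma serM0 A B : (A * B) [::] = A [::] * B [::]. Proof. by []. Qed.
Lemma serMS A B x w : (A * B) (x :: w) = A [::] * B (x :: w) + (lder x A * B) w.
Proof. by []. Qed.

Lemma serM_cat A B w :
  (A * B) w = \sum_(i < (size w).+1) A (take i w) * B (drop i w).
Proof.
elim: w A => [|x w IH] A; first by rewrite big_ord_recl big_ord0 addr0 serM0.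
by rewrite serMS IH [RHS]big_ord_recl.
Qed.

Lemma lderD x A B : lder x (A + B) = lder x A + lder x B. Proof. by []. Qed.

Definition cst (c : C) : ser C T := fun w => if w is [::] then c else 0.

Lemma cst0 : cst 0 = 0. Proof. by apply: serP => -[]. Qed.
Lemma cstD c e : cst (c + e) = cst c + cst e.
Proof. by apply: serP => -[|x w] //=; rewrite !serDE /= addr0. Qed.

Lemma cstM c A w : (cst c * A) w = c * A w.
Proof.
case: w => [|x w] //; rewrite serMS /= [lder _ _](_ : _ = 0) ?mul0r ?addr0 //.
Qed.

Lemma Mcst c A w : (A * cst c) w = A w * c.
Proof.
elim: w A => [|x w IH] A //; rewrite serMS /= mulr0 add0r IH //.
Qed.

Lemma cstC c A : cst c * A = A * cst c.
Proof. by apply: serP => w; rewrite cstM Mcst mulrC. Qed.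

Lemma cst_mul c e : cst (c * e) = cst c * cst e.
Proof. by apply: serP => w; rewrite cstM; case: w => //= _ _; rewrite mulr0. Qed.

Lemma lder_cst x c : lder x (cst c) = 0. Proof. by []. Qed.
Lemma lder1 x : lder x (1 : ser C T) = 0. Proof. by []. Qed.

Lemma lderM x A B : lder x (A * B) = cst (A [::]) * lder x B + lder x A * B.
Proof. by apply: serP => w; rewrite serDE cstM. Qed.

Lemma rderM y A B : rder y (A * B) = rder y A * cst (B [::]) + A * rder y B.
Proof.
apply: serP => w; rewrite serDE Mcst /rder.
elim: w A => [|x w IH] A /=.
  by rewrite serMS serM0 addrC.
by rewrite !serMS [X in _ + X = _](IH (lder x A)) addrCA.
Qed.

(** Agreement in all degrees below [n], the closeness of the adic topology on series. *)
Definition eqn n A B := forall w, (size w < n)%N -> A w = B w.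

Lemma eqn_sym n A B : eqn n A B -> eqn n B A.
Proof. by move=> AB w wn; rewrite AB. Qed.
Lemma eqn_trans n A B D : eqn n A B -> eqn n B D -> eqn n A D.
Proof. by move=> AB BD w wn; rewrite AB // BD. Qed.
Lemma eqn_all A B : (forall n, eqn n A B) -> A = B.
Proof. by move=> AB; apply: serP => w; exact: (AB (size w).+1). Qed.
Lemma eqnW n m A B : (m <= n)%N -> eqn n A B -> eqn m A B.
Proof. by move=> mn AB w wm; apply: AB; apply: leq_trans wm mn. Qed.
Lemma eqnS n A B : eqn n.+1 A B -> eqn n A B. Proof. exact: eqnW. Qed.
Lemma eqnD n A A' B B' : eqn n A A' -> eqn n B B' -> eqn n (A + B) (A' + B').
Proof. by move=> AA BB w wn; rewrite !serDE AA // BB. Qed.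
Lemma eqnN n A A' : eqn n A A' -> eqn n (- A) (- A').
Proof. by move=> AA w wn; rewrite !serNE AA. Qed.
Lemma eqn_sum n (I : Type) (r : seq I) (P : pred I) (F G : I -> ser C T) :
  (forall i, P i -> eqn n (F i) (G i)) ->
  eqn n (\sum_(i <- r | P i) F i) (\sum_(i <- r | P i) G i).
Proof.
by move=> FG w wn; rewrite !ser_sumE; apply: eq_bigr => i Pi; apply: FG.
Qed.

Lemma eqnM n A A' B B' : eqn n A A' -> eqn n B B' -> eqn n (A * B) (A' * B').
Proof.
move=> AA BB w wn; rewrite !serM_cat; apply: eq_bigr => i _.
rewrite AA ?BB //; apply: leq_ltn_trans wn.
  by rewrite size_drop leq_subr.
by rewrite size_take; case: ifP => // /ltnW.
Qed.

(** Every cut that contributes gives a non-empty word to the left factor, so the right factor is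
    only read in lower degrees. This is how the equations gain a degree. *)
Lemma eqnMl n A A' B B' : A [::] = 0 -> A' [::] = 0 ->
  eqn n.+1 A A' -> eqn n B B' -> eqn n.+1 (A * B) (A' * B').
Proof.
move=> A0 A0' AA BB w wn; rewrite !serM_cat; apply: eq_bigr => i _.
have [->|i0] := eqVneq (i : nat) 0%N; first by rewrite take0 A0 A0' !mul0r.
rewrite AA; last first.
  by apply: leq_trans wn; rewrite ltnS size_take; case: ifP => // /ltnW.
case: w wn i i0 => [|x w] wn i i0; first by case: i i0 => -[|i] //= _ /eqP.
rewrite BB //; rewrite size_drop /=; case: i i0 => -[|i] ? //= _; rewrite subSS.
by rewrite ltnS in wn; apply: leq_ltn_trans wn; exact: leq_subr.
Qed.

Lemma eqnMr n A A' B B' : B [::] = 0 -> B' [::] = 0 ->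
  eqn n A A' -> eqn n.+1 B B' -> eqn n.+1 (A * B) (A' * B').
Proof.
move=> B0 B0' AA BB w wn; rewrite !serM_cat; apply: eq_bigr => i _.
have [->|i0] := eqVneq (i : nat) (size w); first by rewrite drop_size B0 B0' !mulr0.
have iw : (i < size w)%N by rewrite ltn_neqAle i0 -ltnS ltn_ord.
rewrite BB; last by apply: leq_trans wn; rewrite ltnS size_drop leq_subr.
by rewrite AA //; rewrite size_take iw; apply: leq_trans iw _.
Qed.

Lemma eqn_unit n A B D : D [::] = 1 -> eqn n (A * D) (B * D) -> eqn n A B.
Proof.
move=> D1 E; elim: n E => // n IH E w wn.
have {}IH := IH (eqnS E); move: (E w wn).
rewrite !serM_cat !big_ord_recr /= drop_size D1 take_size !mulr1.
rewrite (eq_bigr (fun i : 'I_(size w) => B (take i w) * D (drop i w))).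
  exact: addrI.
move=> i _; rewrite IH // size_take /=; case: ifP => iw.
  by apply: leq_trans (ltn_ord i) _.
by have := ltn_ord i; rewrite iw.
Qed.

Lemma ser_mulIr A B D : D [::] = 1 -> A * D = B * D -> A = B.
Proof. by move=> D1 E; apply: eqn_all => n; apply: (eqn_unit D1); rewrite E. Qed.

Definition contractive (G : ser C T -> ser C T) :=
  forall n A B, eqn n A B -> eqn n.+1 (G A) (G B).

Lemma contractive_uniq G A B : contractive G -> A = G A -> B = G B -> A = B.
Proof.
move=> cG AE BE; apply: eqn_all; elim=> // n IH.
by rewrite AE BE; apply: cG.
Qed.

(** Each application of a contractive map settles one more degree, so [size w + 1] iterations settle
    the coefficient of [w], whatever the starting point. *)
Definition sfix (G : ser C T -> ser C T) : ser C T :=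
  fun w => iter (size w).+1 G 0 w.

Lemma sfixE G : contractive G -> sfix G = G (sfix G).
Proof.
move=> cG.
have st m n A : eqn m (iter m G 0) (iter (m + n) G A).
  by elim: m => // m IH; rewrite addSn /=; apply: cG.
have sf m : eqn m (sfix G) (iter m G 0).
  move=> w wm; rewrite /sfix.
  have := st (size w).+1 (m - (size w).+1)%N 0; rewrite subnKC //; apply.
  exact: ltnSn.
by apply: eqn_all => -[//|m]; apply: eqn_trans (sf _) _; apply: cG; apply: eqn_sym;
  apply: sf.
Qed.

End SeriesRing.
Arguments cst {C T} c.

(** * Substitution *)

Section Substitution.
Context (C : comNzRingType) (T : finType).
Local Notation ser := (ser C T).
Implicit Types (A B D F G M H : ser) (S : T -> ser) (w : seq T).

Definition var_ser (y : T) : ser := fun w => (w == [:: y])%:R.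
Local Notation var := var_ser.

Lemma varM0 y A : (var y * A) [::] = 0.
Proof. by rewrite serM0 mul0r. Qed.

Lemma Mvar0 y A : (A * var y) [::] = 0.
Proof. by rewrite serM0 mulr0. Qed.

Lemma lder_var x y : lder x (var y) = (x == y)%:R.
Proof.
apply: serP => w; rewrite /lder /var_ser eqseq_cons; case: eqP => //= _.
by case: w.
Qed.

Lemma varMS y A x w : (var y * A) (x :: w) = (x == y)%:R * A w.
Proof.
by rewrite serMS mul0r add0r lder_var; case: eqP; rewrite ?mul1r // !mul0r.
Qed.

Lemma Mvar_rcons y A x w : (A * var y) (rcons w x) = (x == y)%:R * A w.
Proof.
elim: w A => [|v w IH] A /=.
  rewrite serMS serM0 mulr0 addr0 /var_ser eqseq_cons andbT mulrC //.
rewrite serMS IH /lder /var_ser eqseq_cons.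
by case: w {IH} => [|? ?]; rewrite /= andbF mulr0 add0r.
Qed.

Lemma var_sumS (G : T -> ser) x w : (\sum_y var y * G y) (x :: w) = G x w.
Proof.
rewrite ser_sumE (bigD1 x) //= varMS eqxx mul1r big1 ?addr0 // => y yx.
by rewrite varMS eq_sym (negbTE yx) mul0r.
Qed.

Lemma sum_var_rcons (G : T -> ser) x w :
  (\sum_y G y * var y) (rcons w x) = G x w.
Proof.
rewrite ser_sumE (bigD1 x) //= Mvar_rcons eqxx mul1r big1 ?addr0 // => y yx.
by rewrite Mvar_rcons eq_sym (negbTE yx) mul0r.
Qed.

Lemma lder_var_sum (G : T -> ser) x : lder x (\sum_y var y * G y) = G x.
Proof. by apply: serP => w; rewrite /lder var_sumS. Qed.

Lemma rder_sum_var (G : T -> ser) x : rder x (\sum_y G y * var y) = G x.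
Proof. by apply: serP => w; rewrite /rder sum_var_rcons. Qed.

Lemma var_sum0 (G : T -> ser) : (\sum_y var y * G y) [::] = 0.
Proof. by rewrite ser_sumE big1 // => y _; rewrite varM0. Qed.

Lemma sum_var0 (G : T -> ser) : (\sum_y G y * var y) [::] = 0.
Proof. by rewrite ser_sumE big1 // => y _; rewrite Mvar0. Qed.

Lemma lder_expansion F : F = cst (F [::]) + \sum_y var y * lder y F.
Proof.
by apply: serP => -[|x w]; rewrite serDE ?var_sum0 ?addr0 // var_sumS add0r.
Qed.

Lemma rder_expansion F : F = cst (F [::]) + \sum_y rder y F * var y.
Proof.
apply: serP => w; case/lastP: w => [|w x]; rewrite serDE ?sum_var0 ?addr0 //.
by rewrite sum_var_rcons; case: w => [|? ?]; rewrite /= add0r.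
Qed.

Definition proper S := forall y, S y [::] = 0.

Lemma proper_varl (G : T -> ser) : proper (fun y => var y * G y).
Proof. by move=> y; exact: varM0. Qed.

Lemma proper_varr (G : T -> ser) : proper (fun y => G y * var y).
Proof. by move=> y; exact: Mvar0. Qed.

Lemma properMr S (G : T -> ser) : proper S -> proper (fun y => S y * G y).
Proof. by move=> pS y; rewrite serM0 pS mul0r. Qed.

Lemma properMl S (G : T -> ser) : proper S -> proper (fun y => G y * S y).
Proof. by move=> pS y; rewrite serM0 pS mulr0. Qed.

(** The fuel [k] replaces a measure on [F], whose left derivatives are not smaller. When the [S y]
    have no constant term, every peeled letter costs a degree and [k] rounds settle the degrees
    below [k]. *)
Fixpoint subk k S F : ser :=
  if k is k'.+1 then cst (F [::]) + \sum_y S y * subk k' S (lder y F) else 0.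

(* Meaningful only for series S y without constant term. *)
Definition sub S F : ser := fun w => subk (size w).+1 S F w.

Section SubTheory.
Context (S : T -> ser) (pS : proper S).

Lemma subk_eqn k m F : eqn k (subk k S F) (subk (k + m) S F).
Proof.
elim: k F => [|k IH] F //; rewrite addSn /=; apply: eqnD => //.
by apply: eqn_sum => y _; apply: eqnMl.
Qed.

Lemma sub_subk k F : eqn k (sub S F) (subk k S F).
Proof.
move=> w wk; rewrite /sub -(subnKC wk); apply: subk_eqn; exact: ltnSn.
Qed.

Lemma subE F : sub S F = cst (F [::]) + \sum_y S y * sub S (lder y F).
Proof.
apply: eqn_all => n; apply: (@eqn_trans _ _ n _ (subk n.+1 S F)).
  by apply: eqnS; exact: sub_subk.
apply: eqnD => //; apply: eqn_sum => y _; apply: eqnM => //.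
by apply: eqn_sym; exact: sub_subk.
Qed.

(** Each unfolding of the recursion on left derivatives gains a degree, so it characterises
    substitution. Composite operations on series are recognised as substitutions in this way. *)
Lemma sub_uniq (Phi Psi : ser -> ser) :
  (forall F, Phi F = cst (F [::]) + \sum_y S y * Phi (lder y F)) ->
  (forall F, Psi F = cst (F [::]) + \sum_y S y * Psi (lder y F)) ->
  Phi =1 Psi.
Proof.
move=> hPhi hPsi F; apply: eqn_all => n; elim: n F => // n IH F.
rewrite hPhi hPsi; apply: eqnD => //; apply: eqn_sum => y _.
by apply: eqnMl.
Qed.

Lemma sub0E F : sub S F [::] = F [::].
Proof.
by rewrite subE serDE ser_sumE big1 ?addr0 // => y _; rewrite serM0 pS mul0r.
Qed.

Lemma sub0 : sub S 0 = 0.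
Proof.
apply: eqn_all; elim=> // n IH; rewrite subE cst0 add0r => w wn.
have H y : eqn n.+1 (S y * sub S 0) (S y * 0) by apply: eqnMl.
by rewrite ser_sumE big1 // => y _; rewrite (H y w wn) mulr0.
Qed.

Lemma sub_cst c : sub S (cst c) = cst c.
Proof.
by rewrite subE big1 ?addr0 // => y _; rewrite lder_cst sub0 mulr0.
Qed.

Lemma sub1 : sub S 1 = 1. Proof. exact: sub_cst. Qed.

Lemma subD F G : sub S (F + G) = sub S F + sub S G.
Proof.
apply: eqn_all => n; elim: n F G => // n IH F G.
rewrite [X in eqn _ X]subE [sub S F]subE [sub S G]subE serDE cstD addrACA.
apply: eqnD => //.
rewrite -big_split /=; apply: eqn_sum => y _; rewrite -mulrDr.
by apply: eqnMl => //; exact: (IH (lder y F) (lder y G)).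
Qed.

Lemma subN F : sub S (- F) = - sub S F.
Proof. by apply/eqP; rewrite -addr_eq0 -subD addNr sub0. Qed.

Lemma subB F G : sub S (F - G) = sub S F - sub S G.
Proof. by rewrite subD subN. Qed.

Lemma sub_sum (I : Type) (r : seq I) (P : pred I) (F : I -> ser) :
  sub S (\sum_(i <- r | P i) F i) = \sum_(i <- r | P i) sub S (F i).
Proof. exact: (big_morph (sub S) subD sub0). Qed.

Lemma subM F G : sub S (F * G) = sub S F * sub S G.
Proof.
apply: eqn_all => n; elim: n F G => // n IH F G.
have cM c H : eqn n (sub S (cst c * H)) (cst c * sub S H).
  by have := IH (cst c) H; rewrite sub_cst.
rewrite [X in eqn _ X _]subE [sub S F]subE mulrDl serM0 cst_mul.
rewrite {1}[sub S G]subE mulrDr -addrA; apply: eqnD => //.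
rewrite mulr_sumr mulr_suml -big_split /=; apply: eqn_sum => y _.
rewrite mulrA cstC -!mulrA -mulrDr; apply: eqnMl => //.
rewrite lderM subD; apply: eqnD; first exact: cM.
exact: IH.
Qed.

Lemma sub_var y : sub S (var y) = S y.
Proof.
rewrite subE [var y [::]]/= cst0 add0r (bigD1 y) //= lder_var eqxx sub1 mulr1.
by rewrite big1 ?addr0 // => x xy; rewrite lder_var (negbTE xy) sub0 mulr0.
Qed.

Lemma sub_rE F : sub S F = cst (F [::]) + \sum_y sub S (rder y F) * S y.
Proof.
rewrite {1}[F]rder_expansion subD sub_cst sub_sum; congr (_ + _).
by apply: eq_bigr => y _; rewrite subM sub_var.
Qed.

End SubTheory.

Lemma sub_comp S R F : proper S -> proper R ->
  sub S (sub R F) = sub (fun y => sub S (R y)) F.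
Proof.
move=> pS pR; have pSR : proper (fun y => sub S (R y)).
  by move=> y; rewrite sub0E.
apply: (sub_uniq pSR (Phi := fun F => sub S (sub R F))) => {}F; last exact: subE.
rewrite [in LHS](subE pR) subD // sub_cst // sub_sum //; congr (_ + _).
by apply: eq_bigr => y _; rewrite subM.
Qed.

(** The rule [M (s1 M) (s2 M) ... = (M s1) (M s2) ... M], applied word by word. It converts an
    equation read from the right into one read from the left. *)
Lemma sub_push S M F : proper S ->
  M * sub (fun y => S y * M) F = sub (fun y => M * S y) F * M.
Proof.
move=> pS; have pl := properMr (fun=> M) pS; have pr := properMl (fun=> M) pS.
apply: eqn_all => n; elim: n F => // n IH F.
rewrite (subE pl) (subE pr) mulrDr mulrDl cstC; apply: eqnD => //.
rewrite mulr_sumr mulr_suml; apply: eqn_sum => y _.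
rewrite -[S y * M * _]mulrA mulrA -[X in eqn _ _ X]mulrA.
by apply: eqnMl => //; exact: pr.
Qed.

Lemma sub_eqn n S S' F F' : proper S -> proper S' ->
  (forall y, eqn n (S y) (S' y)) -> eqn n F F' -> eqn n (sub S F) (sub S' F').
Proof.
move=> pS pS' SS; elim: n F F' SS => // n IH F F' SS FF.
rewrite !subE //; apply: eqnD; first by rewrite FF.
apply: eqn_sum => y _; apply: eqnMl => //; apply: IH.
  by move=> x; apply: eqnS.
by move=> w wn; apply: FF.
Qed.

Lemma eq_sub S S' F : S =1 S' -> sub S F = sub S' F.
Proof. by move=> SS; congr sub; apply: functional_extensionality. Qed.

Lemma eqn_varM n y A B : eqn n A B -> eqn n.+1 (var y * A) (var y * B).
Proof. by move=> AB; apply: eqnMl. Qed.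

Lemma eqn_Mvar n y A B : eqn n A B -> eqn n.+1 (A * var y) (B * var y).
Proof. by move=> AB; apply: eqnMr. Qed.

(** Substituting [z M] for [z] is unitriangular for the degree because [M] starts with 1: the part
    of lowest degree is unchanged. Injectivity and the inversion in [mom_surj] rest on this. *)
Lemma sub_varM_lead n M F : M [::] = 1 -> eqn n F 0 ->
  eqn n.+1 (sub (fun y => var y * M) F) F.
Proof.
move=> M1; have pM := proper_varl (fun=> M).
elim: n F => [|n IH] F F0.
  by move=> [|//] _; rewrite sub0E.
rewrite [X in eqn _ _ X]lder_expansion subE //; apply: eqnD => //.
apply: eqn_sum => y _; rewrite -mulrA; apply: eqn_varM.
have F0' : eqn n (lder y F) 0 by move=> w wn; apply: F0.
have E := IH _ F0'.
apply: (@eqn_trans _ _ n.+1 _ (M * lder y F)); first exact: eqnM.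
move=> w wn; rewrite serM_cat big_ord_recl take0 drop0 M1 mul1r big1 ?addr0 //.
move=> i _; rewrite F0' ?ser0E ?mulr0 // size_drop lift0 /=.
by case: w wn i => [|x w] wn [i ilt] //=; rewrite subSS;
  apply: leq_ltn_trans (leq_subr _ _) _.
Qed.

Lemma sub_varM_inj M F G : M [::] = 1 ->
  sub (fun y => var y * M) F = sub (fun y => var y * M) G -> F = G.
Proof.
move=> M1 E; have pM := proper_varl (fun=> M).
suff H n : eqn n (F - G) 0.
  by apply/eqP; rewrite -subr_eq0; apply/eqP/eqn_all.
elim: n => // n IH; apply: eqn_trans (eqn_sym (sub_varM_lead M1 IH)) _.
by rewrite subB // E subrr.
Qed.

End Substitution.

(** * Free and boolean cumulant series *)

Section MomentSeries.
Context (C : comNzRingType) (T : finType).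
Local Notation ser := (ser C T).
Local Notation var := (@var_ser C T).
Implicit Types (A B D F G M H f g e : ser) (S N L : T -> ser) (w : seq T).

(* The free moment-cumulant relation M(z) = 1 + f(z_1 M(z), z_2 M(z), ...). *)
Definition mom_step f M : ser := sub (fun y => var y * M) (1 + f).
Definition mom f : ser := sfix (mom_step f).

Lemma mom_step_contractive f : contractive (mom_step f).
Proof.
move=> n A B AB; apply: sub_eqn => // [||y]; try exact: proper_varl.
exact: eqn_varM.
Qed.

Lemma momE f : mom f = sub (fun y => var y * mom f) (1 + f).
Proof. exact: sfixE (mom_step_contractive f). Qed.

Lemma mom_uniq f M : M = sub (fun y => var y * M) (1 + f) -> M = mom f.
Proof.
by move=> E; apply: (contractive_uniq (@mom_step_contractive f)) E (momE f).
Qed.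

Lemma mom0 f : f [::] = 0 -> mom f [::] = 1.
Proof.
move=> f0; rewrite momE sub0E ?serDE ?f0 ?addr0 //; exact: proper_varl.
Qed.

(** The cut comes right after the last letter of the block of the first letter; what follows is an
    arbitrary [mom f]. The factor in front of it is thereby the boolean cumulant series. *)
Lemma mom_rE f : f [::] = 0 ->
  mom f = 1 + (\sum_y sub (fun y => var y * mom f) (rder y f) * var y) * mom f.
Proof.
move=> f0; rewrite {1}momE sub_rE; last exact: proper_varl.
rewrite serDE f0 addr0; congr (_ + _).
rewrite mulr_suml; apply: eq_bigr => y _; rewrite mulrA; congr (sub _ _ * _ * _).
by apply: serP => w; rewrite /rder serDE; case: w => [|? ?]; rewrite /= add0r.
Qed.

Lemma mom_lE f : f [::] = 0 ->
  mom f = 1 + (\sum_y var y * sub (fun y => mom f * var y) (lder y f)) * mom f.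
Proof.
move=> f0; rewrite {1}momE subE; last exact: proper_varl.
rewrite serDE f0 addr0; congr (_ + _).
rewrite mulr_suml; apply: eq_bigr => y _; rewrite -!mulrA; congr (_ * _).
rewrite -sub_push; last by move=> x.
by congr (_ * sub _ _); apply: serP => w; rewrite /lder serDE add0r.
Qed.

Lemma lder_mom f x : lder x (mom f) =
  mom f * sub (fun y => var y * mom f) (lder x f).
Proof.
rewrite {1}momE subE; last exact: proper_varl.
rewrite lderD lder_cst add0r; under eq_bigr do rewrite -mulrA.
rewrite lder_var_sum; congr (_ * sub _ _).
by apply: serP => w; rewrite /lder serDE add0r.
Qed.

Lemma mom_surj M : M [::] = 1 -> exists2 f, f [::] = 0 & M = mom f.
Proof.
move=> M1; have pM := proper_varl (fun=> M).
(* The equation [M = 1 + f (z M)] is solved for [f] as a perturbation of the identity: by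
   [sub_varM_lead] the bracket in degree [n] only involves [f] in lower degrees. *)
pose G f := M - 1 - (sub (fun y => var y * M) f - f).
have cG : contractive G.
  move=> n f g fg; apply: eqnD => //; apply: eqnN.
  have fg0 : eqn n (f - g) 0 by move=> w wn; rewrite serBE fg // subrr.
  have := sub_varM_lead M1 fg0; rewrite subB // => E w wn.
  move: (E w wn); rewrite !serBE => /eqP; rewrite subr_eq addrAC => /eqP ->.
  by rewrite [f w + _]addrC addrAC addrK.
have fE := sfixE cG; set f := sfix G in fE.
have E : M = sub (fun y => var y * M) (1 + f).
  rewrite subD // sub1 //; move: fE; rewrite [RHS]/G opprB addrCA => E.
  have /addrI/eqP : f + 0 = f + (M - 1 - sub (fun y => var y * M) f).
    by rewrite addr0.
  by rewrite eq_sym -addrA -opprD subr_eq0 => /eqP.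
exists f; last exact: mom_uniq.
have := congr1 (fun h : ser => h [::]) E; rewrite sub0E // M1 serDE.
by rewrite -{1}[1]addr0 => /addrI <-.
Qed.

Lemma mom_inj f g : f [::] = 0 -> mom f = mom g -> f = g.
Proof.
move=> f0 E; have M1 := mom0 f0; apply: (addrI 1).
by apply: (sub_varM_inj M1); rewrite -momE E -momE.
Qed.

(* The boolean moment-cumulant relation M = 1 + eta M. *)
Definition boolc M : ser := sfix (fun e => M - 1 - e * (M - 1)).

Lemma boolcE M : M [::] = 1 -> M = 1 + boolc M * M.
Proof.
move=> M1; have cG : contractive (fun e => M - 1 - e * (M - 1)).
  move=> n A B AB; apply: eqnD => //; apply: eqnN.
  by apply: eqnMr => //; rewrite serBE M1 subrr.
have := sfixE cG; rewrite -/(boolc M) mulrBr mulr1 opprB addrCA => E.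
have /eqP := E; rewrite -subr_eq0 opprD addrA subrr sub0r oppr_eq0 => {E}.
by rewrite -addrA -opprD subr_eq0 => /eqP.
Qed.

Lemma boolc_uniq M e : M [::] = 1 -> M = 1 + e * M -> e = boolc M.
Proof.
move=> M1 E; apply: (ser_mulIr M1); apply: (addrI 1).
by rewrite -E -boolcE.
Qed.

Lemma boolc0 M : M [::] = 1 -> boolc M [::] = 0.
Proof.
move=> M1; have /(congr1 (fun h : ser => h [::])) := boolcE M1.
by rewrite serDE serM0 M1 mulr1 -{1}[1]addr0 => /addrI.
Qed.

(** [boolc M] is [1 - M^-1], which commutes with [M]. *)
Lemma boolcEr M : M [::] = 1 -> M = 1 + M * boolc M.
Proof.
move=> M1; have E := boolcE M1.
apply: (ser_mulIr M1); rewrite mulrDl mul1r -mulrA.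
have E2 : boolc M * M = M - 1 by rewrite [in RHS]E addrAC subrr add0r.
by rewrite E2 mulrBr mulr1 addrC subrK.
Qed.

Lemma boolc_mom_r f : f [::] = 0 ->
  boolc (mom f) = \sum_y sub (fun y => var y * mom f) (rder y f) * var y.
Proof. by move=> f0; apply/esym/boolc_uniq; [exact: mom0|exact: mom_rE]. Qed.

Lemma boolc_mom_l f : f [::] = 0 ->
  boolc (mom f) = \sum_y var y * sub (fun y => mom f * var y) (lder y f).
Proof. by move=> f0; apply/esym/boolc_uniq; [exact: mom0|exact: mom_lE]. Qed.

Lemma rder_boolc_mom f y : f [::] = 0 ->
  rder y (boolc (mom f)) = sub (fun y => var y * mom f) (rder y f).
Proof. by move=> f0; rewrite boolc_mom_r // rder_sum_var. Qed.

Lemma lder_boolc_mom f x : f [::] = 0 ->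
  lder x (boolc (mom f)) = sub (fun y => mom f * var y) (lder x f).
Proof. by move=> f0; rewrite boolc_mom_l // lder_var_sum. Qed.

Lemma boolc_sub S M : proper S -> M [::] = 1 ->
  boolc (sub S M) = sub S (boolc M).
Proof.
move=> pS M1; apply/esym/boolc_uniq; first by rewrite sub0E.
by rewrite -subM // -[in RHS](sub1 pS) -subD // -boolcE.
Qed.

(** * The fixed-point system of the products of two free families *)

Section ProductSystem.
Implicit Types (U W : T -> ser).

(* The moments M of the products a_x b_x for a free of b, with free cumulant
   series f and g; L y and N x collect the irreducible (boolean cumulant)
   contributions of a_1 b_1 a_2 ... b_{n-1} a_y and of b_x a_2 b_2 ... a_n b_n. *)
Definition product_system f g M L N :=
  [/\ M = 1 + \sum_y L y * var y * (N y * M),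
      forall y, L y = sub (fun x => var x * (N x * M)) (rder y f) &
      forall x, N x = sub (fun y => M * L y * var y) (lder x g)].

Context (f g M : ser) (L N : T -> ser).
Hypotheses (f0 : f [::] = 0) (g0 : g [::] = 0) (sys : product_system f g M L N).

Lemma product_system0 : M [::] = 1.
Proof.
case: sys => -> _ _; rewrite serDE ser_sumE big1 ?addr0 // => y _.
by rewrite serM0 Mvar0 mul0r.
Qed.

Lemma product_system_sub : M = sub (fun x => var x * (N x * M)) (1 + f).
Proof.
case: sys => ME LE _; rewrite {1}ME sub_rE; last exact: proper_varl.
rewrite serDE f0 addr0; congr (_ + _); apply: eq_bigr => y _.
rewrite -mulrA LE; congr (sub _ _ * _).
by apply: serP => w; rewrite /rder serDE; case: w => [|? ?]; rewrite /= add0r.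
Qed.

(** With [N] frozen, [X = (1 + f) (z N X)] has a single solution. [M] solves it by
    [product_system_sub], and so does the right-hand side, as one sees by substituting [z N] for [z]
    in the equation of [mom f]. *)
Lemma product_moment_l : M = sub (fun x => var x * N x) (mom f).
Proof.
have pN := proper_varl N; pose G X := sub (fun x => var x * (N x * X)) (1 + f).
apply: (contractive_uniq (G := G)) product_system_sub _ => [n A B AB|].
  apply: sub_eqn => // [||y]; try exact: proper_varl.
  by apply: eqn_varM; apply: eqnM.
rewrite {1}momE sub_comp //; last exact: proper_varl.
by apply: eq_sub => x; rewrite subM // sub_var // mulrA.
Qed.

Lemma product_system_sub_r :
  M = sub (fun y => L y * var y * M) (1 + g).
Proof.
case: sys => ME LE NE; have p1 := properMr (fun=> M) (proper_varr L).
rewrite {1}ME subE // serDE g0 addr0; congr (_ + _); apply: eq_bigr => y _.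
rewrite -[_ * M * _]mulrA; congr (_ * _).
rewrite sub_push; last exact: proper_varr.
rewrite NE; congr (_ * _); rewrite (eq_sub _ (fun y => mulrA _ _ _)).
by congr sub; apply: serP => w; rewrite /lder serDE add0r.
Qed.

Lemma product_moment_r : M = sub (fun y => L y * var y) (mom g).
Proof.
have pL := proper_varr L; pose G X := sub (fun y => L y * var y * X) (1 + g).
apply: (contractive_uniq (G := G)) product_system_sub_r _ => [n A B AB|].
  apply: sub_eqn => // [||y]; try exact: properMr.
  by apply: eqnMl => //; exact: Mvar0.
rewrite {1}momE sub_comp //; last exact: proper_varl.
by apply: eq_sub => x; rewrite subM // sub_var.
Qed.

Lemma product_bool_l y : L y = sub (fun x => var x * N x) (rder y (boolc (mom f))).
Proof.
have pN := proper_varl N; case: sys => _ -> _.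
rewrite rder_boolc_mom // sub_comp //; last exact: proper_varl.
apply: eq_sub => x; rewrite subM // sub_var // -product_moment_l.
by rewrite mulrA.
Qed.

Lemma product_bool_r x : N x = sub (fun y => L y * var y) (lder x (boolc (mom g))).
Proof.
have pL := proper_varr L; case: sys => _ _ ->.
rewrite lder_boolc_mom // sub_comp //; last exact: proper_varr.
by apply: eq_sub => y; rewrite subM // sub_var // -product_moment_r mulrA.
Qed.

Lemma boolc_product : boolc M = sub (fun x => var x * N x) (boolc (mom f)).
Proof.
rewrite {1}product_moment_l boolc_sub //; first exact: proper_varl.
exact: mom0.
Qed.

End ProductSystem.

(** Substituting [z M] for [z] turns the equations of [W] and [U] into those that [L] and [N M]
    satisfy, so the solutions correspond. Under this substitution [f (z U)] becomes
    [f (z N M) = M - 1], which is the free moment-cumulant relation. The series [f (z U)] is the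
    boxed convolution of [f] and [g]. *)
Lemma product_free f g M L N U W : f [::] = 0 -> g [::] = 0 ->
  product_system f g M L N ->
  (forall y, W y = sub (fun x => var x * U x) (rder y f)) ->
  (forall x, U x = sub (fun y => W y * var y) (lder x g)) ->
  M = mom (sub (fun x => var x * U x) f).
Proof.
move=> f0 g0 sys WE UE; have [_ LE NE] := sys.
have pM := proper_varl (fun=> M); have pU := proper_varl U.
have pW := proper_varr W.
pose rho := sub (fun x => var x * M).
have rW y : rho (W y) = sub (fun x => var x * (M * rho (U x))) (rder y f).
  rewrite WE /rho sub_comp //; apply: eq_sub => x.
  by rewrite subM // sub_var // mulrA.
have rU x : M * rho (U x) = sub (fun y => M * rho (W y) * var y) (lder x g) * M.
  rewrite UE /rho sub_comp // (eq_sub (S' := fun y => rho (W y) * var y * M)).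
    rewrite sub_push; last exact: proper_varr.
    by rewrite (eq_sub _ (fun y => mulrA _ _ _)).
  by move=> y; rewrite subM // sub_var // mulrA.
(* Both pairs solve one coupled system, in which the variable beside each unknown gains the
   degree. *)
have E n : (forall x, eqn n (M * rho (U x)) (N x * M)) /\
           (forall y, eqn n (rho (W y)) (L y)).
  elim: n => // n [IHU IHW].
  have W1 y : eqn n.+1 (rho (W y)) (L y).
    rewrite rW LE; apply: sub_eqn => // [||x]; try exact: proper_varl.
    exact: eqn_varM.
  split=> // x; rewrite rU NE; apply: eqnM => //.
  apply: sub_eqn => // [||y]; try exact: proper_varr.
  by apply: eqn_Mvar; apply: eqnM => //; apply: eqnS.
apply: mom_uniq; rewrite -[1 in RHS](sub1 pU) -subD // sub_comp //.
rewrite {1}(product_system_sub f0 sys); apply: eq_sub => x.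
rewrite subM // sub_var // -mulrA; congr (_ * _); apply/esym/eqn_all => n.
by have [] := E n.
Qed.

Lemma product_bool_free f g M L N M' L' N' : f [::] = 0 -> g [::] = 0 ->
  product_system f g M L N ->
  product_system (boolc (mom f)) (boolc (mom g)) M' L' N' ->
  M' = mom (boolc M).
Proof.
move=> f0 g0 sys sys'; rewrite (boolc_product f0 sys).
(* The [L] and [N] of the first system serve as [W] and [U] for the second. *)
apply: product_free sys' _ _.
- by apply: boolc0; exact: mom0.
- by apply: boolc0; exact: mom0.
- by move=> y; apply: (product_bool_l f0 sys).
- by move=> x; apply: (product_bool_r g0 sys).
Qed.

End MomentSeries.

(** * Products of free families *)

Section AlternatingWords.
Context (C : comNzRingType) (T : finType).
Local Notation T2 := (T * bool)%type.
Local Notation ser2 := (ser C T2).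
Local Notation ser := (ser C T).
Local Notation var2 := (@var_ser C T2).
Local Notation var := (@var_ser C T).
Implicit Types (A B : ser2) (F f g M : ser) (w : seq T) (v : seq T2).

(* x_1 ... x_n |-> a_{x_1} b_{x_1} ... a_{x_n} b_{x_n}, where (x, true) stands
   for a_x and (x, false) for b_x. *)
Fixpoint dbl w : seq T2 :=
  if w is x :: w' then (x, true) :: (x, false) :: dbl w' else [::].

Lemma dbl_rcons w x : dbl (rcons w x) = rcons (rcons (dbl w) (x, true)) (x, false).
Proof. by elim: w => //= y w ->. Qed.

Definition lift (b : bool) F : ser2 :=
  fun v => if all (fun t => t.2 == b) v then F [seq t.1 | t <- v] else 0.

Definition restr_dbl A : ser := fun w => A (dbl w).

Lemma lder_lift b x F : lder (x, b) (lift b F) = lift b (lder x F).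
Proof. by apply: serP => v; rewrite /lder /lift /= eqxx. Qed.

Lemma lder_liftN b x F : lder (x, b) (lift (~~ b) F) = 0.
Proof. by apply: serP => v; rewrite /lder /lift /=; case: b. Qed.

Lemma rder_lift b x F : rder (x, b) (lift b F) = lift b (rder x F).
Proof. by apply: serP => v; rewrite /rder /lift all_rcons map_rcons /= eqxx. Qed.

Lemma rder_liftN b x F : rder (x, b) (lift (~~ b) F) = 0.
Proof. by apply: serP => v; rewrite /rder /lift all_rcons /=; case: b. Qed.

(** Restriction to doubled words is multiplicative up to the cuts that separate [a_x] from [b_x];
    the hypothesis makes those vanish. *)
Lemma restr_dblM A B :
  (forall w x v, A (rcons (dbl w) (x, true)) * B ((x, false) :: v) = 0) ->
  restr_dbl (A * B) = restr_dbl A * restr_dbl B.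
Proof.
move=> AB; apply: serP => w; elim: w A AB => [|x w IH] A AB //.
rewrite serMS {1}/restr_dbl /= serMS serMS (AB [::]) add0r; congr (_ + _).
by apply: (IH (lder (x, false) (lder (x, true) A))) => u y v; apply: (AB (x :: u)).
Qed.

(** The opposite case: only the cuts inside a pair survive, and [y] is the letter of the pair that
    is cut. *)
Lemma restr_dblM_odd A B : (forall w v, A (dbl w) * B v = 0) ->
  restr_dbl (A * B) = \sum_y restr_dbl (rder (y, true) A) *
    (var y * restr_dbl (lder (y, false) B)).
Proof.
move=> AB; apply: serP => w; rewrite ser_sumE.
elim: w A AB => [|x w IH] A AB.
  rewrite {1}/restr_dbl /= serM0 (AB [::]) big1 // => y _.
  by rewrite serM0 varM0 mulr0.
under eq_bigr do rewrite serMS varMS.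
rewrite big_split /= (bigD1 x) //= eqxx mul1r big1 ?addr0; last first.
  by move=> y yx; rewrite eq_sym (negbTE yx) mul0r mulr0.
rewrite {1}/restr_dbl /= serMS (AB [::]) add0r serMS; congr (_ + _).
by apply: (IH (lder (x, false) (lder (x, true) A))) => u v; apply: (AB (x :: u)).
Qed.

Context (f g : ser) (f0 : f [::] = 0) (g0 : g [::] = 0).

Definition free_pair : ser2 := lift true f + lift false g.
Local Notation P := free_pair.
Local Notation Mh := (mom P).
Local Notation eta := (boolc Mh).

Definition product_mom : ser := restr_dbl Mh.
Let M := product_mom.
Let L y := restr_dbl (rder (y, true) eta).
Let N x := restr_dbl (lder (x, false) eta).

Lemma free_pair0 : P [::] = 0.
Proof. by rewrite /free_pair serDE /lift /= f0 g0 addr0. Qed.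

Let Mh0 : Mh [::] = 1. Proof. exact: mom0 free_pair0. Qed.
Let eta0 : eta [::] = 0. Proof. exact: boolc0. Qed.

Lemma sub_lift_diff b x v F :
  sub (fun t => var2 t * Mh) (lift b F) ((x, ~~ b) :: v) = 0.
Proof.
rewrite subE; last exact: proper_varl.
under eq_bigr do rewrite -mulrA.
rewrite serDE var_sumS add0r -{2}[b]negbK lder_liftN sub0 ?mulr0 //.
exact: proper_varl.
Qed.

Lemma rder_eta_true y :
  rder (y, true) eta = sub (fun t => var2 t * Mh) (lift true (rder y f)).
Proof.
rewrite rder_boolc_mom; last exact: free_pair0.
congr sub; rewrite -rder_lift; have := rder_liftN true y g.
by rewrite /free_pair => E; rewrite -[RHS]addr0 -E.
Qed.

Lemma rder_eta_false y :
  rder (y, false) eta = sub (fun t => var2 t * Mh) (lift false (rder y g)).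
Proof.
rewrite rder_boolc_mom; last exact: free_pair0.
congr sub; rewrite -rder_lift; have := rder_liftN false y f.
by rewrite /free_pair => E; rewrite -[RHS]add0r -E.
Qed.

Lemma lder_eta_false x :
  lder (x, false) eta = sub (fun t => Mh * var2 t) (lift false (lder x g)).
Proof.
rewrite lder_boolc_mom; last exact: free_pair0.
congr sub; rewrite -lder_lift; have := lder_liftN false x f.
by rewrite /free_pair => E; rewrite -[RHS]add0r -E.
Qed.

(** A boolean cumulant collects the non-crossing partitions whose first and last letters share a
    block, and no block of [free_pair] mixes the two families. The same reason gives [eta_dbl]. *)
Lemma eta_ba x y v : eta (rcons ((x, false) :: v) (y, true)) = 0.
Proof.
by have := sub_lift_diff true x v (rder y f); rewrite -rder_eta_true.
Qed.

Lemma eta_dbl w : eta (dbl w) = 0.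
Proof.
case/lastP: w => [|w y] //; rewrite dbl_rcons.
case: w => [|x w] /=.
  by have := sub_lift_diff false y [::] (rder y g); rewrite -rder_eta_false.
have := sub_lift_diff false x ((x, false) :: rcons (dbl w) (y, true)) (rder y g).
by rewrite -rder_eta_false.
Qed.

Lemma lder_momN x : restr_dbl (lder (x, false) Mh) = N x * M.
Proof.
rewrite {1}(boolcE Mh0) lderD lder1 add0r lderM eta0 cst0 mul0r add0r.
rewrite restr_dblM // => w y v.
by have := eta_ba x y (dbl w); rewrite /lder /= => ->; rewrite mul0r.
Qed.

Lemma rder_momL y : restr_dbl (rder (y, true) Mh) = M * L y.
Proof.
have E : rder (y, true) Mh = Mh * rder (y, true) eta.
  rewrite {1}(boolcEr Mh0); apply: serP => v.
  have -> : rder (y, true) (1 + Mh * eta) v = rder (y, true) (Mh * eta) v.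
    by rewrite /rder serDE; case: v => [|? ?]; rewrite /= add0r.
  by rewrite rderM eta0 cst0 mulr0 add0r.
rewrite E restr_dblM // => w x v.
by have := eta_ba x y v; rewrite /rder /= => ->; rewrite mulr0.
Qed.

Lemma product_momP : product_system f g M L N.
Proof.
have pl := proper_varl (fun=> Mh); have pr := proper_varr (fun=> Mh).
split=> [|y|x].
- have E : M = 1 + restr_dbl (eta * Mh).
    apply: serP => w; rewrite /M /product_mom {1}/restr_dbl.
    have -> := congr1 (fun h : ser2 => h (dbl w)) (boolcE Mh0).
    by rewrite !serDE; case: w.
  (* Doubled words have boolean cumulant zero, so every contributing cut of [eta * Mh] falls inside
     a pair. *)
  rewrite [LHS]E restr_dblM_odd => [|w v]; last by rewrite eta_dbl mul0r.
  by congr (_ + _); apply: eq_bigr => y _; rewrite lder_momN mulrA.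
- rewrite /L rder_eta_true.
  (* [rder y f] is generalised to an arbitrary [F], so that [sub_uniq] identifies the restriction as
     a substitution. *)
  pose Phi F := restr_dbl (sub (fun t => var2 t * Mh) (lift true F)).
  apply: (sub_uniq (proper_varl _) (Phi := Phi) (Psi := sub _)) => F; last first.
    by apply: subE; exact: proper_varl.
  apply: serP => -[|x w]; first by rewrite serDE ser_sumE big1 ?addr0 => [|x _];
    rewrite /Phi /restr_dbl ?sub0E // serM0 varM0 mul0r.
  under eq_bigr do rewrite -mulrA.
  rewrite serDE add0r var_sumS /Phi {1}/restr_dbl subE //=.
  under eq_bigr do rewrite -mulrA.
  rewrite serDE var_sumS add0r lder_lift serMS (sub_lift_diff true) mulr0 add0r.
  rewrite -lder_momN -restr_dblM // => u z v.
  by rewrite (sub_lift_diff true) mulr0.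
- rewrite /N lder_eta_false.
  pose Phi F := restr_dbl (sub (fun t => Mh * var2 t) (lift false F)).
  apply: (sub_uniq (proper_varr _) (Phi := Phi) (Psi := sub _)) => F; last first.
    by apply: subE; exact: proper_varr.
  rewrite /Phi subE //; apply: serP => w.
  rewrite {1}/restr_dbl !serDE; congr (_ + _); first by case: w.
  rewrite !ser_sumE -(pair_bigA _ (fun y b => (Mh * var2 (y, b) *
    sub (fun t => Mh * var2 t) (lder (y, b) (lift false F))) (dbl w))) /=.
  apply: eq_bigr => y _; rewrite big_bool /=.
  rewrite (lder_liftN true) sub0 // mulr0 add0r lder_lift.
  rewrite -/(restr_dbl _ w) restr_dblM => [|u z v]; last first.
    by rewrite Mvar_rcons xpair_eqE andbF mul0r mul0r.
  congr (((_ : ser) * _) w); rewrite -rder_momL; apply: serP => {}w.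
  case/lastP: w => [|w z]; first by rewrite [RHS]Mvar0 /restr_dbl /= Mvar0.
  rewrite Mvar_rcons /restr_dbl dbl_rcons Mvar_rcons xpair_eqE andbT.
  by case: eqP => [->|_]; rewrite ?mul0r.
Qed.

End AlternatingWords.

(** * Merging letters of the same colour *)

Section Support.
Context (C : comNzRingType) (T : finType) (c : pred T).
Local Notation ser := (ser C T).
Local Notation var := (@var_ser C T).
Implicit Types (A B F f M : ser) (S : T -> ser).

Definition supported F := forall w, ~~ all c w -> F w = 0.

Definition trunc F : ser := fun w => if all c w then F w else 0.

Lemma supportedP F : supported F <-> trunc F = F.
Proof.
split=> [sF|<- w /negbTE cw]; last by rewrite /trunc cw.
by apply: serP => w; rewrite /trunc; case: ifP => // /negbT /sF.
Qed.

Lemma truncM A B : trunc (A * B) = trunc A * trunc B.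
Proof.
apply: serP => w; rewrite serM_cat /trunc; case: ifP => cw.
  rewrite serM_cat; apply: eq_bigr => i _.
  by move: cw; rewrite -{1}(cat_take_drop i w) all_cat => /andP[-> ->].
rewrite big1 // => i _; move: cw; rewrite -{1}(cat_take_drop i w) all_cat.
by case: (all c (take i w)) => /= [->|_]; rewrite ?mulr0 ?mul0r.
Qed.

Lemma truncD A B : trunc (A + B) = trunc A + trunc B.
Proof.
by apply: serP => w; rewrite serDE /trunc; case: ifP => // _; rewrite addr0.
Qed.

Lemma trunc_cst a : trunc (cst a) = cst a.
Proof. by apply: serP => -[|x w] //; rewrite /trunc /=; case: ifP. Qed.

Lemma trunc_sum (I : Type) (r : seq I) (P : pred I) (F : I -> ser) :
  trunc (\sum_(i <- r | P i) F i) = \sum_(i <- r | P i) trunc (F i).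
Proof.
apply: (big_morph trunc truncD); apply: serP => w.
by rewrite /trunc; case: ifP.
Qed.

Lemma trunc_var y : trunc (var y) = if c y then var y else 0.
Proof.
apply: serP => w; rewrite /trunc /var_ser; case: (eqVneq w [:: y]) => [->|wy] /=.
  by rewrite andbT; case: ifP => //; rewrite eqxx.
by case: (c y); rewrite /= ?(negbTE wy); case: ifP.
Qed.

Lemma trunc_sub S F : proper S -> trunc (sub S F) = sub (fun y => trunc (S y)) F.
Proof.
move=> pS; have pt : proper (fun y => trunc (S y)) by move=> y; exact: pS.
apply: (sub_uniq pt (Phi := fun F => trunc (sub S F)) (Psi := sub _)) => {}F.
  rewrite [in LHS]subE // truncD trunc_cst trunc_sum.
  by congr (_ + _); apply: eq_bigr => y _; rewrite truncM.
exact: subE.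
Qed.

Lemma sub_trunc S F : proper S ->
  sub (fun y => if c y then S y else 0) F = sub S (trunc F).
Proof.
move=> pS; have pc : proper (fun y => if c y then S y else 0).
  by move=> y; case: ifP.
apply: (sub_uniq pc (Phi := sub _) (Psi := fun F => sub S (trunc F))) => {}F.
  exact: subE.
rewrite [in LHS]subE //; congr (_ + _); apply: eq_bigr => y _.
have -> : lder y (trunc F) = if c y then trunc (lder y F) else 0.
  by apply: serP => w; rewrite /lder /trunc /=; case: (c y).
by case: (c y); rewrite ?sub0 ?mulr0 ?mul0r.
Qed.

(** Discarding the words with a letter outside [c] is a ring morphism, so it can be pushed through
    the functional equation down to [f]. *)
Lemma trunc_mom f : trunc (mom f) = mom (trunc f).
Proof.
apply: mom_uniq; rewrite {1}momE trunc_sub; last exact: proper_varl.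
rewrite -[1 in RHS]trunc_cst -truncD -sub_trunc; last exact: proper_varl.
by apply: eq_sub => y; rewrite truncM trunc_var; case: ifP; rewrite ?mul0r.
Qed.

Lemma supported_mom f : f [::] = 0 -> supported (mom f) <-> supported f.
Proof.
move=> f0; split=> /supportedP E; apply/supportedP; last by rewrite trunc_mom E.
by apply: (mom_inj (f := trunc f)); rewrite // -trunc_mom.
Qed.

Lemma supported_lder x F : supported F -> supported (lder x F).
Proof. by move=> sF w cw; apply: sF; rewrite /= negb_and cw orbT. Qed.

Lemma supported_rder x F : supported F -> supported (rder x F).
Proof. by move=> sF w cw; apply: sF; rewrite all_rcons negb_and cw orbT. Qed.

Lemma supported_lder0 x F : supported F -> ~~ c x -> lder x F = 0.
Proof. by move=> sF cx; apply: serP => w; apply: sF; rewrite /= negb_and cx. Qed.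

Lemma supported_rder0 x F : supported F -> ~~ c x -> rder x F = 0.
Proof.
by move=> sF cx; apply: serP => w; apply: sF; rewrite all_rcons negb_and cx.
Qed.

End Support.

(** * Moments of a sum of two free cumulant series *)

Section FreeSum.
Context (C : comNzRingType) (T : finType).
Local Notation ser := (ser C T).
Local Notation var := (@var_ser C T).
Implicit Types (A B F f fa fb M H Q : ser) (S : T -> ser).

Lemma sub_varS M F x w :
  sub (fun y => var y * M) F (x :: w) =
  (M * sub (fun y => var y * M) (lder x F)) w.
Proof.
rewrite subE; last exact: proper_varl.
under eq_bigr do rewrite -mulrA.
by rewrite serDE var_sumS add0r.
Qed.

(* For f = fa + fb, the outer blocks coming from fb form the series B; M is
   recovered from fb and from the moments M1 of fa alone, whose letters are
   separated by sequences H = 1 / (1 - B) of such outer blocks. *)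
Definition outer_system M1 fb M H B :=
  [/\ M = H * sub (fun y => var y * H) M1, H = 1 + B * H &
      B = \sum_y sub (fun y => var y * M) (rder y fb) * var y].

Lemma outer_system_uniq M1 fb M H B M' H' B' :
  outer_system M1 fb M H B -> outer_system M1 fb M' H' B' -> M = M'.
Proof.
move=> [ME HE BE] [ME' HE' BE'].
suff E n : eqn n M M' /\ eqn n H H' by apply: eqn_all => n; have [] := E n.
elim: n => // n [MM HH].
(* A round gains a degree in the order [B], [H], [M]; the gain comes from the letter at the end of
   each term of [B]. *)
have BB : eqn n.+1 B B'.
  rewrite BE BE'; apply: eqn_sum => y _; apply: eqn_Mvar.
  by apply: sub_eqn => // [||x]; rewrite ?varM0 //; try exact: proper_varl;
    apply: eqnS; apply: eqn_varM.
have HH' : eqn n.+1 H H'.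
  rewrite HE HE'; apply: eqnD => //; apply: eqnMl => //.
    by rewrite BE sum_var0.
  by rewrite BE' sum_var0.
split=> //; rewrite ME ME'; apply: eqnM => //.
apply: sub_eqn => // [||y]; try exact: proper_varl.
by apply: eqnS; apply: eqn_varM.
Qed.

(** [Q] collects the terms in which the word is empty or its first letter lies in a block of [fa].
    Then [M = Q + B M], so [M = H Q], and [Q = (1 + fa) (z H Q)] identifies [Q] with the moments of
    [fa] evaluated at [z H]. *)
Lemma outer_system_mom fa fb : fa [::] = 0 -> fb [::] = 0 ->
  exists H B, outer_system (mom fa) fb (mom (fa + fb)) H B.
Proof.
move=> fa0 fb0; set M := mom (fa + fb).
have f0 : (fa + fb) [::] = 0 by rewrite serDE fa0 fb0 addr0.
pose part f := \sum_y sub (fun y => var y * M) (rder y f) * var y.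
pose B := part fb; have B0 : B [::] = 0 by rewrite /B /part sum_var0.
have cB X : contractive (fun A => X + B * A).
  by move=> n A A' AA; apply: eqnD => //; apply: eqnMl.
pose H := sfix (fun A => 1 + B * A); have HE : H = 1 + B * H := sfixE (cB 1).
exists H, B; split=> //.
have pM := proper_varl (fun=> M); have pH := proper_varl (fun=> H).
have MQ : M = (1 + part fa * M) + B * M.
  rewrite {1}/M (mom_rE f0) -/M -addrA -mulrDl; congr (_ + _ * _).
  rewrite /B /part -big_split /=; apply: eq_bigr => y _.
  rewrite -mulrDl -subD //.
set Q := 1 + part fa * M in MQ.
have MH : M = H * Q.
  apply: (contractive_uniq (cB Q)) => //.
  by rewrite {1}HE mulrDl mul1r mulrA.
rewrite [LHS]MH; congr (_ * _).
have QE : Q = sub (fun y => var y * (H * Q)) (1 + fa).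
  rewrite -MH subD // sub1 // sub_rE // fa0 cst0 add0r; congr (_ + _).
  by rewrite mulr_suml; apply: eq_bigr => y _; rewrite mulrA.
pose G Q := sub (fun y => var y * (H * Q)) (1 + fa).
apply: (contractive_uniq (G := G)) QE _ => [n A A' AA|].
  apply: sub_eqn => // [||y]; try exact: proper_varl.
  by apply: eqn_varM; apply: eqnM.
rewrite {1}momE sub_comp //; last exact: proper_varl.
by apply: eq_sub => y; rewrite subM // sub_var // mulrA.
Qed.

End FreeSum.

(** * Pulling series back along a merging of letters *)

Section Merging.
Context (C : comNzRingType) (T1 T2 : finType) (c1 : pred T1) (c2 : pred T2).
Context (d : T2 -> seq T1).
Hypothesis d_merged : forall t, c2 t -> (d t != [::]) && all c1 (d t).
Hypothesis d_kept : forall t, ~~ c2 t -> exists2 x, ~~ c1 x & d t = [:: x].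
Local Notation ser1 := (ser C T1).
Local Notation ser2 := (ser C T2).
Local Notation var1 := (@var_ser C T1).
Local Notation var2 := (@var_ser C T2).
Local Notation flat w := (flatten (map d w)).
Implicit Types (A B F f fa fb M H : ser1).

(** The moments of merged letters are the moments of the words they stand for; their free cumulants
    obey no such formula. *)
Definition unmerge A : ser2 := fun w => A (flat w).

Lemma serM_catl A B p v : p != [::] -> all c1 p || (size p == 1)%N ->
  (forall u x y v, c1 x -> c1 y -> A (rcons u x) * B (y :: v) = 0) ->
  (A * B) (p ++ v) = A [::] * B (p ++ v) + (lders p A * B) v.
Proof.
elim: p A => // x [|y p] IH A _ cp AB; first by rewrite serMS.
move: cp; rewrite /= orbF => /and3P[cx cy cp].
rewrite serMS; congr (_ + _); rewrite IH //=; last 2 first.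
- by rewrite cy cp.
- by move=> u x' y' v' cx' cy'; apply: (AB (x :: u)).
by have := AB [::] x y (p ++ v) cx cy; rewrite /lder /= => ->; rewrite add0r.
Qed.

Lemma d_cases t : (d t != [::]) && (all c1 (d t) || (size (d t) == 1)%N).
Proof.
case: (boolP (c2 t)) => [/d_merged/andP[-> ->] //|/d_kept[x _ ->]].
by rewrite orbT.
Qed.

Lemma unmergeM A B :
  (forall u x y v, c1 x -> c1 y -> A (rcons u x) * B (y :: v) = 0) ->
  unmerge (A * B) = unmerge A * unmerge B.
Proof.
move=> AB; apply: serP => w; elim: w A AB => [|t w IH] A AB //.
have /andP[t0 tc] := d_cases t.
rewrite {1}/unmerge /= serM_catl // serMS; congr (_ + _); apply: IH.
move=> u x y v cx cy; rewrite /lders -rcons_cat; exact: AB.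
Qed.

(** [H] vanishes on words that begin or end with a [c1] letter, so between two adjacent letters of a
    merged word only its constant term 1 can stand, and each merged word is read in one go. *)
Lemma unmerge_sub H F : H [::] = 1 ->
  (forall x, c1 x -> lder x H = 0) -> (forall x, c1 x -> rder x H = 0) ->
  unmerge (sub (fun y => var1 y * H) F) =
  sub (fun t => var2 t * unmerge H) (unmerge F).
Proof.
move=> H1 Hl Hr; have pH := proper_varl (fun=> H).
have step G p v : p != [::] -> all c1 p || (size p == 1)%N ->
  sub (fun y => var1 y * H) G (p ++ v) =
  (H * sub (fun y => var1 y * H) (lders p G)) v.
  elim: p G => // x [|y p] IH G _ cp; first by rewrite sub_varS.
  move: cp; rewrite /= orbF => /and3P[cx cy cp].
  rewrite sub_varS serMS H1 mul1r Hl // mul0r addr0.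
  by rewrite (IH (lder x G)) //= cy cp.
apply: eqn_all => n; elim: n F => // n IH F.
have -> : unmerge (sub (fun y => var1 y * H) F) = cst (F [::]) +
    \sum_t var2 t * (unmerge H * unmerge (sub (fun y => var1 y * H) (lders (d t) F))).
  apply: serP => -[|t w].
    by rewrite serDE var_sum0 addr0 /unmerge /= sub0E.
  have /andP[t0 tc] := d_cases t.
  rewrite serDE var_sumS add0r {1}/unmerge /= step // -unmergeM //.
  move=> u x y v cx _; have /(congr1 (fun h : ser1 => h u)) := Hr x cx.
  by rewrite /rder => ->; rewrite mul0r.
rewrite [X in eqn _ _ X]subE; last exact: proper_varl.
apply: eqnD => //; apply: eqn_sum => t _; rewrite -mulrA.
by apply: eqn_varM; apply: eqnM => //; exact: IH.
Qed.

(** Here [M] is arbitrary, but [F] only reads kept letters, so a merged word always lies within a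
    factor [M]. *)
Lemma unmerge_sub_kept M F : supported (predC c1) F ->
  unmerge (sub (fun y => var1 y * M) F) =
  sub (fun t => var2 t * unmerge M) (unmerge F).
Proof.
move=> sF; have pM := proper_varl (fun=> M).
have s0 G : supported (predC c1) G -> forall x v, c1 x ->
    sub (fun y => var1 y * M) G (x :: v) = 0.
  move=> sG x v cx; rewrite sub_varS (supported_lder0 sG) ?sub0 ?mulr0 //=.
  by rewrite negbK.
apply: eqn_all => n; elim: n F sF => // n IH F sF.
rewrite [X in eqn _ _ X]subE; last exact: proper_varl.
have -> : unmerge (sub (fun y => var1 y * M) F) = cst (F [::]) +
    \sum_t var2 t * (unmerge M * unmerge (sub (fun y => var1 y * M) (lders (d t) F))).
  apply: serP => -[|t w].
    by rewrite serDE var_sum0 addr0 /unmerge /= sub0E.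
  rewrite serDE var_sumS add0r {1}/unmerge /=.
  case: (boolP (c2 t)) => [/d_merged|/d_kept[x cx ->]].
    case: (d t) => // x p /= /andP[cx _]; rewrite s0 //.
    have -> : lders (x :: p) F = 0.
      by apply: serP => v; apply: sF; rewrite /= cx.
    rewrite sub0 // (_ : unmerge 0 = 0) ?mulr0 //.
  rewrite /= sub_varS -unmergeM // => u y z v _ cz.
  by rewrite s0 ?mulr0 //; apply: supported_lder.
apply: eqnD => //; apply: eqn_sum => t _; rewrite -mulrA.
apply: eqn_varM; apply: eqnM => //; apply: IH => v cv.
by apply: sF; rewrite all_cat negb_and cv orbT.
Qed.

(** A non-empty word on which [B] or [H] is non-zero begins and ends with a kept letter, so no
    contributing cut splits a merged word and each equation can be pulled back. *)
Lemma unmerge_outer_system M1 fb M H B : fb [::] = 0 -> supported (predC c1) fb ->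
  outer_system M1 fb M H B ->
  outer_system (unmerge M1) (unmerge fb) (unmerge M) (unmerge H) (unmerge B).
Proof.
move=> fb0 sb [ME HE BE]; have pM := proper_varl (fun=> M).
have B0 : B [::] = 0 by rewrite BE sum_var0.
have H1 : H [::] = 1 by rewrite HE serDE serM0 B0 mul0r addr0.
have Br x : c1 x -> rder x B = 0.
  move=> cx; rewrite BE rder_sum_var (supported_rder0 sb) ?sub0 //=.
  by rewrite negbK.
have Bl x : c1 x -> lder x B = 0.
  move=> cx; apply: serP => w; rewrite /lder BE.
  have sr y : supported (predC c1) (rder y fb) by apply: supported_rder.
  case/lastP: w => [|w y].
    rewrite -[[:: x]]/(rcons [::] x) sum_var_rcons sub0E //.
    by apply: sb; rewrite /= cx.
  rewrite -rcons_cons sum_var_rcons sub_varS.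
  by rewrite (supported_lder0 (sr y)) ?sub0 ?mulr0 //= negbK.
have Hl x : c1 x -> lder x H = 0.
  by move=> cx; rewrite HE lderD lder1 add0r lderM B0 cst0 mul0r add0r Bl // mul0r.
have Hr x : c1 x -> rder x H = 0.
  move=> cx; apply: serP => w.
  have HEr : H = 1 + H * B by rewrite (boolc_uniq H1 HE); exact: boolcEr.
  rewrite HEr /rder serDE [X in _ + X](_ : _ = rder x (H * B) w) //.
  rewrite rderM B0 cst0 mulr0 add0r Br // mulr0 ser0E addr0.
  by case: w.
split.
- rewrite {1}ME unmergeM ?unmerge_sub // => u x y v cx _.
  by have /(congr1 (fun h : ser1 => h u)) := Hr x cx; rewrite /rder => ->;
    rewrite mul0r.
- rewrite [LHS](_ : _ = unmerge (1 + B * H)); last by rewrite -HE.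
  rewrite -[unmerge B * _]unmergeM => [|u x y v cx _].
    apply: serP => w; rewrite serDE /unmerge serDE; congr (_ + _).
    by case: w => //= t w; have /andP[] := d_cases t; case: (d t).
  by have /(congr1 (fun h : ser1 => h u)) := Br x cx; rewrite /rder => ->;
    rewrite mul0r.
- apply: serP => w; case/lastP: w => [|w t]; first by rewrite sum_var0 /unmerge /= B0.
  rewrite sum_var_rcons {1}/unmerge map_rcons flatten_rcons.
  case: (boolP (c2 t)) => [ct|/d_kept[x cx dt]].
    have -> : rder t (unmerge fb) = 0.
      apply: serP => v; apply: sb; rewrite map_rcons flatten_rcons all_cat.
      have := d_merged ct; case: (d t) => //= x p /andP[cx _].
      by rewrite cx /= andbF.
    rewrite sub0 ?ser0E; last exact: proper_varl.
    have := d_merged ct; case/lastP: (d t) => // p x /andP[_].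
    rewrite all_rcons -rcons_cat => /andP[cx _].
    exact: (congr1 (fun h : ser1 => h _) (Br x cx)).
  rewrite dt cats1 [in LHS]BE sum_var_rcons.
  have -> : rder t (unmerge fb) = unmerge (rder x fb).
    apply: serP => v; rewrite /rder /unmerge map_rcons flatten_rcons dt cats1 //.
  rewrite -unmerge_sub_kept //; exact: supported_rder.
Qed.

(** The pulled back moments of [fa] are the moments of some [ga] by [mom_surj]; uniqueness for the
    outer system then shows that no further cumulants arise. Merging thus keeps the two groups of
    letters free of each other. *)
Lemma unmerge_mom fa fb : fa [::] = 0 -> fb [::] = 0 ->
  supported c1 fa -> supported (predC c1) fb ->
  exists ga : ser2, [/\ ga [::] = 0, supported c2 ga &
    unmerge (mom (fa + fb)) = mom (ga + unmerge fb)].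
Proof.
move=> fa0 fb0 sa sb; have [H [B sys]] := outer_system_mom fa0 fb0.
have sys2 := unmerge_outer_system fb0 sb sys.
have [ga ga0 gaE] : exists2 ga : ser2, ga [::] = 0 & unmerge (mom fa) = mom ga.
  by apply: mom_surj; exact: mom0.
have [H' [B' sys']] := outer_system_mom (fb := unmerge fb) ga0 fb0.
exists ga; split=> //.
  apply/(supported_mom c2 ga0); rewrite -gaE => w cw.
  apply: (proj2 (supported_mom c1 fa0) sa); apply: contra cw => cw.
  apply/allP => t tw; apply: contraLR cw => /d_kept[x cx dt].
  apply/allPn; exists x => //; apply/flattenP; exists (d t); last by rewrite dt inE.
  exact: map_f.
apply: outer_system_uniq sys2 _; rewrite gaE; exact: sys'.
Qed.

End Merging.

(** * Sums over partitions *)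

Section PartitionSums.
Context (C : comNzRingType) (T : finType).
Implicit Types (S A V W : {set T}) (pi : {set {set T}}) (F : {set T} -> C).
Implicit Types (Rb : rel {set T}) (Q : pred {set {set T}}).

Definition parts Rb S : {set {set {set T}}} := [set pi | partition pi S &&
  [forall V in pi, forall W in pi, (V != W) ==> Rb V W]].

Lemma partsP Rb S pi : reflect
  (partition pi S /\ {in pi &, forall V W, V != W -> Rb V W}) (pi \in parts Rb S).
Proof.
rewrite inE; apply: (iffP andP) => -[pS H]; split=> //.
  move=> V W Vpi Wpi VW; move/forall_inP: H => /(_ V Vpi)/forall_inP/(_ W Wpi).
  by rewrite VW.
by apply/forall_inP => V Vpi; apply/forall_inP => W Wpi; apply/implyP; apply: H.
Qed.

Definition psum Rb F S : C := \sum_(pi in parts Rb S) \prod_(V in pi) F V.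

Lemma parts_set0 Rb : parts Rb set0 = [set set0].
Proof.
apply/setP => pi; rewrite [in RHS]inE; apply/partsP/eqP => [[]|->].
  by rewrite partition_set0 => /eqP.
by split; [rewrite partition_set0|move=> V W; rewrite inE].
Qed.

Lemma psum_set0 Rb F : psum Rb F set0 = 1.
Proof. by rewrite /psum parts_set0 big_set1 big_set0. Qed.

Lemma partition_one S pi V : partition pi S -> V \in pi -> S \subset V ->
  pi = [set S].
Proof.
move=> pS Vpi SV; have VS : V = S.
  by apply/eqP; rewrite eqEsubset SV (partitionS pS Vpi).
have /trivIsetP tri := partition_trivIset pS.
apply/setP => W; rewrite inE; apply/idP/eqP => [Wpi|->]; last by rewrite -VS.
apply: contraTeq Wpi => WS; apply/negP => Wpi.
have := tri V W Vpi Wpi; rewrite VS eq_sym WS => /(_ isT).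
rewrite disjoint_sym => /disjoint_setI0; rewrite (setIidPl (partitionS pS Wpi)).
by move=> W0; move: Wpi; rewrite W0 (partition0 pS).
Qed.

Lemma one_in_parts Rb S : S != set0 -> [set S] \in parts Rb S.
Proof.
move=> S0; apply/partsP; split; last first.
  by move=> V W; rewrite !inE => /eqP -> /eqP ->; rewrite eqxx.
apply/and3P; split; first by rewrite /cover big_set1.
  by apply/trivIsetP => V W; rewrite !inE => /eqP -> /eqP ->; rewrite eqxx.
by rewrite inE eq_sym.
Qed.

Lemma psum_one_block Rb F S : S != set0 ->
  \sum_(pi in parts Rb S | [exists V in pi, S \subset V]) \prod_(V in pi) F V = F S.
Proof.
move=> S0; rewrite (big_pred1 [set S]) ?big_set1 // => pi /=.
apply/andP/eqP => [[/partsP[pS _] /exists_inP[V Vpi SV]]|->].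
  exact: partition_one pS Vpi SV.
by rewrite one_in_parts //; split=> //; apply/exists_inP; exists S; rewrite ?inE.
Qed.

(** Möbius inversion by induction on the size: the one-block partition isolates [F S], and the
    blocks of all other partitions are smaller. *)
Lemma psum_inj Rb F G S : (forall V, V != set0 -> V \subset S ->
  psum Rb F V = psum Rb G V) -> S != set0 -> F S = G S.
Proof.
move: {2}#|S| (leqnn #|S|) => n; elim: n S => [|n IH] S Sn FG S0.
  by move: S0; rewrite -cards_eq0 -leqn0 Sn.
have := FG S S0 (subxx _); rewrite /psum (bigD1 [set S]) ?one_in_parts //=.
rewrite [X in _ = X -> _](bigD1 [set S]) ?one_in_parts //=.
rewrite !big_set1 => E; apply/esym; move: E.
rewrite (eq_bigr (fun pi => \prod_(V in pi) G V)); first by move/addIr.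
move=> pi /andP[/partsP[pS _] npi]; apply: eq_bigr => V Vpi.
have VS := partitionS pS Vpi; have V0 := partition_neq0 pS Vpi.
apply: IH => // [|W W0 WV]; last exact: FG W0 (subset_trans WV VS).
rewrite -ltnS; apply: leq_trans Sn; apply: proper_card.
rewrite properEneq VS andbT; apply: contra npi => /eqP VE.
by rewrite (partition_one pS Vpi) // VE.
Qed.

Definition saturated A pi := [forall V in pi, (V \subset A) || [disjoint V & A]].

(** Partitions that do not connect [A] with its complement correspond to pairs of partitions by
    [cut] and [glue]; the hypothesis on [Rb] makes any two halves compatible. [Q] carries a
    condition on the blocks outside [A]. *)
Lemma psum_split Rb F S A Q : A \subset S ->
  (forall V W, V \subset A -> W \subset S :\: A -> Rb V W && Rb W V) ->
  \sum_(pi in parts Rb S | saturated A pi && Q [set V in pi | [disjoint V & A]])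
    \prod_(V in pi) F V =
  psum Rb F A * \sum_(pi in parts Rb (S :\: A) | Q pi) \prod_(V in pi) F V.
Proof.
move=> AS RbA; rewrite /psum big_distrlr /= pair_big_dep /=.
pose cut pi := ([set V in pi | V \subset A], [set V in pi | [disjoint V & A]]).
pose glue (p : {set {set T}} * {set {set T}}) := p.1 :|: p.2.
have sub_disj V : V \subset S :\: A -> [disjoint V & A].
  by rewrite subsetD => /andP[].
have both V : V \subset A -> [disjoint V & A] -> V = set0.
  by move=> VA /disjoint_setI0; rewrite (setIidPl VA).
have in1 pi1 V : pi1 \in parts Rb A -> V \in pi1 -> (V \subset A) && (V != set0).
  move=> /partsP[p _] Vp; rewrite (partitionS p Vp); exact: partition_neq0 p Vp.
have in2 pi2 V : pi2 \in parts Rb (S :\: A) -> V \in pi2 ->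
    (V \subset S :\: A) && (V != set0).
  move=> /partsP[p _] Vp; rewrite (partitionS p Vp); exact: partition_neq0 p Vp.
have glueK pi1 pi2 : pi1 \in parts Rb A -> pi2 \in parts Rb (S :\: A) ->
    cut (pi1 :|: pi2) = (pi1, pi2).
  move=> p1 p2; congr (_, _); apply/setP => V; rewrite !inE; apply/idP/idP.
  - case/andP => /orP[//|V2] VA; have /andP[VSA /eqP[]] := in2 _ _ p2 V2.
    exact: both VA (sub_disj _ VSA).
  - by move=> V1; have /andP[-> _] := in1 _ _ p1 V1; rewrite V1.
  - case/andP => /orP[V1|//] VA; have /andP[VA' /eqP[]] := in1 _ _ p1 V1.
    exact: both VA' VA.
  - by move=> V2; have /andP[/sub_disj -> _] := in2 _ _ p2 V2; rewrite V2 orbT.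
have cutK pi : saturated A pi -> glue (cut pi) = pi.
  move=> /forall_inP sat; apply/setP => V; rewrite !inE -andb_orr.
  by case: (boolP (V \in pi)) => //= /sat.
rewrite (reindex_onto glue cut) /=; last by move=> pi /andP[_ /andP[/cutK ->]].
apply: eq_big => [[pi1 pi2]|[pi1 pi2] /=]; last first.
  case/andP => /andP[piS /andP[_ _]] /eqP cutE.
  have E1 := congr1 fst cutE; have E2 := congr1 snd cutE; rewrite /= in E1 E2.
  have dis : [disjoint pi1 & pi2].
    apply/pred0P => V /=; apply/negP => /andP[V1 V2].
    have : V \in [set V in glue (pi1, pi2) | V \subset A] by rewrite E1.
    have : V \in [set V in glue (pi1, pi2) | [disjoint V & A]] by rewrite E2.
    rewrite !inE => /andP[_ VdA] /andP[Vpi VA]; move: Vpi; rewrite -in_setU.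
    rewrite (both _ VA VdA); case/partsP: piS => /partition0.
    by rewrite /glue /= => ->.
  rewrite -bigU //=; apply: eq_bigl => V; exact: in_setU.
rewrite /glue /=; apply/andP/andP => [[/andP[]]|[p1 /andP[p2 Qp]]]; last first.
  rewrite glueK // eqxx; split=> //.
  have [_ /= ->] := glueK _ _ p1 p2; rewrite Qp andbT.
  have /partsP[P1 R1] := p1; have /partsP[P2 R2] := p2.
  apply/andP; split; last first.
    apply/forall_inP => V; rewrite !inE => /orP[V1|V2].
      by have /andP[-> _] := in1 _ _ p1 V1.
    by have /andP[/sub_disj -> _] := in2 _ _ p2 V2; rewrite orbT.
  have dis V W : V \in pi1 -> W \in pi2 -> [disjoint V & W].
    move=> V1 W2; have /andP[VA _] := in1 _ _ p1 V1.
    have /andP[/sub_disj WA _] := in2 _ _ p2 W2.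
    by rewrite disjoint_sym; apply: disjointWr VA WA.
  apply/partsP; split.
    apply/and3P; split.
    - have -> : cover (pi1 :|: pi2) = cover pi1 :|: cover pi2.
        by rewrite /cover bigcup_setU.
      by rewrite (cover_partition P1) (cover_partition P2) -{1}(setIidPr AS) setID.
    - apply/trivIsetP => V W; rewrite !inE => /orP[V1|V2] /orP[W1|W2] VW.
      + exact: (trivIsetP (partition_trivIset P1)).
      + exact: dis.
      + by rewrite disjoint_sym; apply: dis.
      + exact: (trivIsetP (partition_trivIset P2)).
    - by rewrite !inE (partition0 P1) (partition0 P2).
  move=> V W; rewrite !inE => /orP[V1|V2] /orP[W1|W2] VW.
  - exact: R1.
  - have /andP[VA _] := in1 _ _ p1 V1; have /andP[WA _] := in2 _ _ p2 W2.
    by case/andP: (RbA V W VA WA).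
  - have /andP[VA _] := in2 _ _ p2 V2; have /andP[WA _] := in1 _ _ p1 W1.
    by case/andP: (RbA W V WA VA).
  - exact: R2.
move=> piS /andP[sat Qpi] /eqP cutE; set pi := pi1 :|: pi2 in piS sat Qpi cutE *.
have [E1 E2] : pi1 = [set V in pi | V \subset A] /\
               pi2 = [set V in pi | [disjoint V & A]].
  by case: cutE.
clearbody pi; have /partsP[P R] := piS; have /trivIsetP tri := partition_trivIset P.
have part (B : {set T}) (Pr : pred {set T}) : B \subset S ->
    (forall V, V \in pi -> Pr V -> V \subset B) ->
    (forall V x, V \in pi -> x \in V -> x \in B -> Pr V) ->
    [set V in pi | Pr V] \in parts Rb B.
  move=> BS PB BP; apply/partsP; split; last first.
    by move=> V W; rewrite !inE => /andP[Vpi _] /andP[Wpi _]; apply: R.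
  apply/and3P; split.
  - apply/eqP/setP => x; apply/bigcupP/idP => [[V]|xB].
      by rewrite inE => /andP[Vpi PV]; apply: (subsetP (PB V Vpi PV)).
    have : x \in cover pi by rewrite (cover_partition P) (subsetP BS).
    by case/bigcupP => V Vpi xV; exists V; rewrite // inE Vpi (BP V x).
  - apply/trivIsetP => V W; rewrite !inE => /andP[Vpi _] /andP[Wpi _].
    exact: tri.
  - by rewrite inE (partition0 P).
have dA V x : x \in V -> x \in A -> [disjoint V & A] = false.
  by move=> xV xA; apply/negP => /disjointFr/(_ xV); rewrite xA.
split; last apply/andP; last split.
- rewrite E1; apply: part => // V x Vpi xV xA.
  by move/forall_inP: sat => /(_ V Vpi); rewrite (dA V x) ?orbF.
- rewrite E2; apply: part; first exact: subsetDl.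
    by move=> V Vpi VA; rewrite subsetD VA (partitionS P Vpi).
  move=> V x Vpi xV; rewrite inE => /andP[xA _].
  move/forall_inP: sat => /(_ V Vpi) /orP[/subsetP/(_ x xV)|//].
  by rewrite (negbTE xA).
- by rewrite E2.
Qed.

End PartitionSums.

(** * Non-crossing and interval partitions of a chain *)

Section OrderedPartitions.
Context (C : comNzRingType) (T : finType) (lt : rel T).
Hypothesis lt_asym : forall x y, lt x y -> lt y x = false.
Implicit Types (V W S : {set T}) (F : {set T} -> C) (s u p q : seq T).

Local Notation var := (@var_ser C T).

Definition nc : rel {set T} := fun V W =>
  [forall a in V, forall b in W, forall c in V, forall d in W,
     ~~ [&& lt a b, lt b c & lt c d]].

Definition intv : rel {set T} := fun V W =>
  [forall a in V, forall b in W, forall c in V, ~~ (lt a b && lt b c)].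

Lemma ncP V W : reflect
  (forall a b c d, a \in V -> b \in W -> c \in V -> d \in W ->
     lt a b -> lt b c -> lt c d -> False) (nc V W).
Proof.
apply: (iffP idP) => [H a b c d aV bW cV dW ab bc cd|H].
  move/forall_inP: H => /(_ a aV)/forall_inP/(_ b bW)/forall_inP/(_ c cV).
  by move=> /forall_inP/(_ d dW); rewrite ab bc cd.
do 4![apply/forall_inP => ? ?]; apply/negP => /and3P[]; exact: H.
Qed.

Lemma intvP V W : reflect
  (forall a b c, a \in V -> b \in W -> c \in V -> lt a b -> lt b c -> False)
  (intv V W).
Proof.
apply: (iffP idP) => [H a b c aV bW cV ab bc|H].
  move/forall_inP: H => /(_ a aV)/forall_inP/(_ b bW)/forall_inP/(_ c cV).
  by rewrite ab bc.
do 3![apply/forall_inP => ? ?]; apply/negP => /andP[]; exact: H.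
Qed.

Definition chain s := pairwise lt s.

Lemma chain_uniq s : chain s -> uniq s.
Proof.
apply: pairwise_uniq => x; case E: (lt x x) => //.
by have := lt_asym E; rewrite E.
Qed.

Lemma chain_cat s1 s2 : chain (s1 ++ s2) ->
  [/\ chain s1, chain s2 & {in s1 & s2, forall x y, lt x y}].
Proof. by rewrite /chain pairwise_cat => /and3P[/allrelP H -> ->]. Qed.

Local Notation set_of s := [set x in s].

Lemma set_of_neq0 s : s != [::] -> set_of s != set0.
Proof.
by case: s => // x s _; apply/set0Pn; exists x; rewrite !inE eqxx.
Qed.

Definition block_avoiding u p : pred {set {set T}} := fun pi =>
  [exists V in pi, (set_of u \subset V) && [disjoint V & set_of p]].

(** The state of a scan along a chain: [u] is the part of a block found so far, [p] the letters
    passed since its last member, [q] what remains to be read. *)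
Definition gsum (Rb : rel {set T}) F u p q : C :=
  \sum_(pi in parts Rb (set_of (u ++ p ++ q)) | block_avoiding u p pi)
    \prod_(V in pi) F V.

Lemma nc_gap u p q : chain (u ++ p ++ q) -> forall V W,
  V \subset set_of p -> W \subset set_of (u ++ q) -> nc V W && nc W V.
Proof.
move=> /chain_cat[_ /chain_cat[_ _ pq] up] V W /subsetP Vp /subsetP Wuq.
have case1 x y : x \in V -> y \in W -> lt x y -> y \in q.
  move=> /Vp; rewrite inE => xp /Wuq; rewrite inE mem_cat => /orP[yu|//] xy.
  by have := up y x yu; rewrite mem_cat xp lt_asym // => /(_ isT).
have case2 x y : x \in V -> y \in W -> lt y x -> y \in u.
  move=> /Vp; rewrite inE => xp /Wuq; rewrite inE mem_cat => /orP[//|yq] yx.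
  by have := pq x y xp yq; rewrite lt_asym.
have uq x y : x \in V -> x \in u -> False.
  move=> /Vp; rewrite inE => xp xu; have := up x x xu; rewrite mem_cat xp.
  by move=> /(_ isT) xx; have := lt_asym xx; rewrite xx.
apply/andP; split; [apply/ncP|apply/ncP] => a b c d aV bW cV dW ab bc cd.
  have bq := case1 _ _ aV bW ab; have bu := case2 _ _ cV bW bc.
  have aq : lt b a.
    by apply: (up b a bu); rewrite mem_cat; move/Vp: aV; rewrite inE => ->.
  by rewrite lt_asym in aq.
have cq := case1 _ _ bW cV bc; have cu := case2 _ _ dW cV cd.
have cb : lt c b.
  by apply: (up c b cu); rewrite mem_cat; move/Vp: bW; rewrite inE => ->.
by rewrite lt_asym in cb.
Qed.

Lemma setD_gap u p q : chain (u ++ p ++ q) ->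
  set_of (u ++ p ++ q) :\: set_of p = set_of (u ++ q).
Proof.
move=> /chain_uniq; rewrite cat_uniq => /and3P[_ /hasPn up].
rewrite cat_uniq => /and3P[_ /hasPn pq _].
apply/setP => x; rewrite !inE !mem_cat; case: (boolP (x \in p)) => //= xp.
have /negbTE xu : x \notin u by apply: up; rewrite mem_cat xp.
have /negbTE -> : x \notin q by apply: contraL xp => /pq.
by rewrite xu.
Qed.

Lemma gsum_split F u p q (Q : pred {set {set T}}) : chain (u ++ p ++ q) ->
  \sum_(pi in parts nc (set_of (u ++ p ++ q)) | saturated (set_of p) pi &&
      Q [set V in pi | [disjoint V & set_of p]]) \prod_(V in pi) F V =
  psum nc F (set_of p) *
    \sum_(pi in parts nc (set_of (u ++ q)) | Q pi) \prod_(V in pi) F V.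
Proof.
move=> ch; rewrite psum_split ?setD_gap //; last exact: nc_gap.
by apply/subsetP => x; rewrite !inE !mem_cat => ->; rewrite orbT.
Qed.

Lemma gsum_nil F u p : u != [::] -> chain (u ++ p) ->
  gsum nc F u p [::] = F (set_of u) * psum nc F (set_of p).
Proof.
move=> u0; rewrite -[u ++ p]cats0 -catA => ch.
rewrite -(psum_one_block nc F (set_of_neq0 u0)) mulrC.
have := gsum_split F (fun pi => [exists V in pi, set_of u \subset V]) ch.
rewrite (cats0 u) => <-; apply: eq_bigl => pi; apply: andb_id2l => piS.
have /partsP[P _] := piS.
apply/exists_inP/andP => [[V Vpi /andP[uV Vp]]|[_ /exists_inP[V]]]; last first.
  by rewrite inE => /andP[Vpi Vp] uV; exists V; rewrite ?uV.
split; last by apply/exists_inP; exists V; rewrite // inE Vpi.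
apply/forall_inP => W Wpi; case: (eqVneq W V) => [->|WV]; first by rewrite Vp orbT.
apply/orP; left; apply/subsetP => x xW; rewrite inE.
have := subsetP (partitionS P Wpi) x xW; rewrite inE mem_cat cats0.
case/orP => // xu; have /trivIsetP tri := partition_trivIset P.
have /disjointFr/(_ xW) := tri _ _ Wpi Vpi WV.
by rewrite (subsetP uV) // inE.
Qed.

(** If [y] joins the block of [u], no block can leave the gap [p], which splits off as a factor;
    otherwise [y] is added to the gap. *)
Lemma gsum_cons F u p y q : u != [::] -> chain (u ++ p ++ y :: q) ->
  gsum nc F u p (y :: q) =
  psum nc F (set_of p) * gsum nc F (rcons u y) [::] q + gsum nc F u (rcons p y) q.
Proof.
move=> u0 ch; rewrite /gsum (bigID (block_avoiding (rcons u y) p)) /=.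
have [x xu] : exists x, x \in u by case: u u0 {ch} => // x u; exists x;
  rewrite inE eqxx.
have chu := chain_cat ch; case: chu => _ chp up; case/chain_cat: chp => _ chq pq.
congr (_ + _).
  have E : u ++ y :: q = rcons u y ++ [::] ++ q by rewrite cat_rcons.
  rewrite -E -gsum_split //; apply: eq_bigl => pi; rewrite -andbA.
  apply: andb_id2l => piS; have /partsP[P R] := piS.
  have /trivIsetP tri := partition_trivIset P.
  apply/andP/andP => [[_ /exists_inP[V Vpi /andP[uV Vp]]]|[]].
    split; last first.
      by apply/exists_inP; exists V; rewrite ?inE ?Vpi ?uV //= disjoint_sym
        disjoints_subset; apply/subsetP => z; rewrite inE.
    apply/forall_inP => W Wpi; case: (eqVneq W V) => [->|WV].
      by rewrite Vp orbT.
    apply/orP; case: (boolP [disjoint W & set_of p]); first by right.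
    case/pred0Pn => c /andP[/= cW cp]; left; apply/subsetP => d dW.
    have cp' : c \in p by move: cp; rewrite inE.
    have dV : d \notin V.
      by have /disjointFr/(_ dW) -> := tri _ _ Wpi Vpi WV.
    have := subsetP (partitionS P Wpi) d dW; rewrite !inE !mem_cat.
    have memV z : z \in rcons u y -> z \in V.
      by move=> zu; apply: (subsetP uV); rewrite inE.
    case/or3P => // [du|].
      by move: dV; rewrite memV // mem_rcons inE du orbT.
    rewrite inE => /orP[/eqP dy|dq].
      by move: dV; rewrite memV // mem_rcons inE dy eqxx.
    have VW : V != W by rewrite eq_sym.
    (* A block through [c] in the gap and [d] after [y] would cross [V], which contains [x] before
       [c] and [y] between [c] and [d]. *)
    have /ncP/(_ x c y d) := R V W Vpi Wpi VW; case=> //.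
    - by apply: memV; rewrite mem_rcons inE xu orbT.
    - by apply: memV; rewrite mem_rcons inE eqxx.
    - by apply: up => //; rewrite mem_cat cp'.
    - by apply: pq => //; rewrite inE eqxx.
    - by move: chq; rewrite /chain /= => /andP[/allP/(_ d dq)].
  move=> sat /exists_inP[V]; rewrite inE => /andP[Vpi Vp] /andP[uV _].
  split; apply/exists_inP; exists V; rewrite ?Vp ?andbT //.
  apply: subset_trans uV; apply/subsetP => z.
  by rewrite !inE mem_rcons inE => ->; rewrite orbT.
rewrite cat_rcons; apply: eq_bigl => pi; rewrite -andbA.
apply: andb_id2l => piS; have /partsP[P R] := piS.
have /trivIsetP tri := partition_trivIset P.
apply/andP/exists_inP => [[/exists_inP[V Vpi /andP[uV Vp]] nuy]|[V Vpi /andP[uV Vp]]].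
  exists V => //; rewrite uV /=; apply/pred0P => z /=; apply/negP => /andP[zV].
  rewrite inE mem_rcons inE => /orP[/eqP zy|zp].
    case/negP: nuy; apply/exists_inP; exists V; rewrite ?Vp ?andbT //.
    apply/subsetP => t; rewrite inE mem_rcons inE => /orP[/eqP ->|tu].
      by rewrite -zy.
    by apply: (subsetP uV); rewrite inE.
  by have := disjointFr Vp zV; rewrite inE zp.
split.
  apply/exists_inP; exists V; rewrite ?uV //=; apply: disjointWr Vp.
  by apply/subsetP => z; rewrite !inE mem_rcons inE => ->; rewrite orbT.
apply/negP => /exists_inP[W Wpi /andP[uW _]].
have xV : x \in V by apply: (subsetP uV); rewrite inE.
have xW : x \in W by apply: (subsetP uW); rewrite inE mem_rcons inE xu orbT.
have WV : W = V.
  by apply: contraTeq xW => WV; have /disjointFl -> := tri _ _ Wpi Vpi WV.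
have yV : y \in V by rewrite -WV (subsetP uW) // inE mem_rcons inE eqxx.
by have := disjointFr Vp yV; rewrite inE mem_rcons inE eqxx.
Qed.

Lemma psum_gsum Rb F x s : psum Rb F (set_of (x :: s)) = gsum Rb F [:: x] [::] s.
Proof.
rewrite /psum /gsum; apply: eq_bigl => pi; case: (boolP (pi \in _)) => // piS.
have /partsP[P _] := piS; apply/esym/exists_inP.
have : x \in cover pi by rewrite (cover_partition P) !inE eqxx.
case/bigcupP => V Vpi xV; exists V => //; apply/andP; split.
  by apply/subsetP => z; rewrite !inE => /eqP ->.
by apply/pred0P => z; rewrite !inE andbF.
Qed.

Lemma subseq_chain (s1 s2 : seq T) : subseq s1 s2 -> chain s2 -> chain s1.
Proof. by move=> ss; apply: subseq_pairwise. Qed.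

(** Both sides follow the same recursion in [q]: closing the gap is the cut of the Cauchy product at
    this place, with [mom f p] as left value. The hypothesis on the gaps is supplied by the
    induction in [psum_nc_mom]. *)
Lemma gsum_mom F (f : ser C T) u p q : f [::] = 0 -> u != [::] ->
  chain (u ++ p ++ q) ->
  (forall v, v != [::] -> subseq v (u ++ p ++ q) -> f v = F (set_of v)) ->
  (forall v, subseq v (p ++ q) -> psum nc F (set_of v) = mom f v) ->
  gsum nc F u p q = (lders p (mom f) * sub (fun y => var y * mom f) (lders u f)) q.
Proof.
move=> f0; elim: q u p => [|y q IH] u p u0 ch fF FM.
  rewrite cats0 in ch fF FM; rewrite gsum_nil // serM0 mulrC.
  rewrite sub0E ?/lders ?cats0; last exact: proper_varl.
  by rewrite FM // fF // prefix_subseq.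
rewrite gsum_cons // serMS sub_varS /lders cats0 FM ?prefix_subseq //.
congr (_ * _ + _); last first.
  rewrite IH //; last 1 first.
  - by move=> v vs; apply: FM; rewrite -cat_rcons.
  - have -> // : lders (rcons p y) (mom f) = lder y (lders p (mom f)).
    by apply: serP => w; rewrite /lder /lders cat_rcons.
  - by rewrite cat_rcons.
  - by move=> v v0 vs; apply: fF; rewrite // -cat_rcons.
rewrite IH //=.
- have -> // : lders (rcons u y) f = lder y (lders u f).
  by apply: serP => w; rewrite /lder /lders cat_rcons.
- by case: (u).
- rewrite cat_rcons; apply: subseq_chain ch.
  by rewrite subseq_cat2l suffix_subseq.
- move=> v v0 vs; apply: fF => //; apply: subseq_trans vs _.
  by rewrite cat_rcons subseq_cat2l suffix_subseq.
- move=> v vs; apply: FM; apply: subseq_trans vs _.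
  by rewrite -cat_rcons suffix_subseq.
Qed.

Lemma psum_nc_mom F (f : ser C T) s : f [::] = 0 -> chain s ->
  (forall v, v != [::] -> subseq v s -> f v = F (set_of v)) ->
  psum nc F (set_of s) = mom f s.
Proof.
move=> f0; move: {2}(size s) (leqnn (size s)) => n.
elim: n s => [|n IH] [|x s] // sn ch fF;
  try by rewrite (_ : set_of [::] = set0) ?psum_set0 ?mom0 //;
     apply/setP => z; rewrite !inE.
rewrite psum_gsum (gsum_mom (f := f)) //; last first.
  move=> v vs; have vs' : subseq v (x :: s) by apply: subseq_trans vs (subseq_cons _ _).
  apply: IH; first exact: leq_trans (size_subseq vs) sn.
    exact: subseq_chain vs' ch.
  by move=> t t0 tv; apply: fF => //; apply: subseq_trans tv vs'.
have := congr1 (fun h : ser C T => h s) (lder_mom f x).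
by rewrite /lder => ->.
Qed.

(** Intervals leave no gap: when [y] does not join the block of [u], this block is complete. *)
Lemma gsum_intv_cons F u y q : u != [::] -> chain (u ++ y :: q) ->
  gsum intv F u [::] (y :: q) =
  F (set_of u) * psum intv F (set_of (y :: q)) + gsum intv F (rcons u y) [::] q.
Proof.
move=> u0 ch; rewrite /gsum /= (bigID (block_avoiding (rcons u y) [::])) /= addrC.
have [x xu] : exists x, x \in u by case: u u0 {ch} => // x u; exists x;
  rewrite inE eqxx.
have [_ chq uq] := chain_cat ch.
have d0 (V : {set T}) : [disjoint V & set_of [::]].
  by apply/pred0P => z; rewrite !inE andbF.
congr (_ + _); last first.
  rewrite cat_rcons; apply: eq_bigl => pi; rewrite -andbA; congr (_ && _).
  apply: andb_idl => /exists_inP[V Vpi /andP[uV _]].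
  apply/exists_inP; exists V; rewrite // d0 andbT; apply: subset_trans uV.
  by apply/subsetP => z; rewrite !inE mem_rcons inE => ->; rewrite orbT.
rewrite -(psum_one_block intv F (set_of_neq0 u0)) mulrC.
have disj : set_of (u ++ y :: q) :\: set_of (y :: q) = set_of u.
  apply/setP => z; rewrite !inE mem_cat [in X in _ = X]/=.
  case: (boolP (z \in u)) => zu /=; last by rewrite inE andNb.
  rewrite andbT; apply/negP => zq; have zq' : z \in y :: q by rewrite inE.
  by have zz := uq z z zu zq'; have := lt_asym zz; rewrite zz.
rewrite -disj -psum_split; last 2 first.
- by apply/subsetP => z; rewrite !inE mem_cat inE => ->; rewrite orbT.
- rewrite disj => V W /subsetP Vq /subsetP Wu.
  have WV z t : z \in W -> t \in V -> lt z t.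
    by move=> /Wu zW /Vq tV; rewrite inE in zW; rewrite inE in tV; apply: uq.
  apply/andP; split; apply/intvP => a b c aV bW cV ab bc.
    by have := WV _ _ bW aV; rewrite lt_asym.
  by have := WV _ _ cV bW; rewrite lt_asym.
apply: eq_bigl => pi; rewrite -andbA; apply: andb_id2l => piS.
have /partsP[P R] := piS; have /trivIsetP tri := partition_trivIset P.
have Vu V : V \in pi -> set_of u \subset V -> ~~ block_avoiding (rcons u y) [::] pi ->
    V \subset set_of u.
  move=> Vpi uV nuy; apply/subsetP => z zV; have := subsetP (partitionS P Vpi) z zV.
  have yV : y \notin V.
    apply: contra nuy => yV; apply/exists_inP; exists V; rewrite // d0 andbT.
    apply/subsetP => t; rewrite inE mem_rcons inE => /orP[/eqP -> //|tu].
    by apply: (subsetP uV); rewrite inE.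
  rewrite !inE mem_cat => /orP[//|]; rewrite inE => /orP[/eqP zy|zq].
    by rewrite zy (negbTE yV) in zV.
  have : y \in cover pi by rewrite (cover_partition P) inE mem_cat inE eqxx orbT.
  case/bigcupP => W Wpi yW.
  have VW : V != W by apply: contraNneq yV => ->.
  have /intvP/(_ x y z) := R V W Vpi Wpi VW; case=> //.
  - by apply: (subsetP uV); rewrite inE.
  - by apply: uq; rewrite // inE eqxx.
  - by move: chq; rewrite /chain /= => /andP[/allP/(_ z zq)].
rewrite disj; apply/andP/andP => [[/exists_inP[V Vpi /andP[uV _]] nuy]|].
  have Vu' := Vu V Vpi uV nuy.
  split.
    apply/forall_inP => W Wpi; case: (eqVneq W V) => [->|WV]; apply/orP.
      right; apply: disjointWl Vu' _; rewrite -disj.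
      by rewrite disjoint_sym disjoints_subset setCD subsetUr.
    left; apply/subsetP => z zW; have := subsetP (partitionS P Wpi) z zW.
    rewrite !inE mem_cat inE => /orP[zu|//].
    have /disjointFr/(_ zW) := tri _ _ Wpi Vpi WV.
    by rewrite (subsetP uV) // inE.
  apply/exists_inP; exists V => //; rewrite inE Vpi; apply: disjointWl Vu' _.
  by rewrite -disj disjoint_sym disjoints_subset setCD subsetUr.
case=> _ /exists_inP[V]; rewrite inE => /andP[Vpi Vq] uV; split.
  by apply/exists_inP; exists V; rewrite ?uV ?d0.
apply/negP => /exists_inP[W Wpi /andP[uW _]].
have xV : x \in V by apply: (subsetP uV); rewrite inE.
have xW : x \in W by apply: (subsetP uW); rewrite inE mem_rcons inE xu orbT.
have WV : W = V.
  by apply: contraTeq xW => WV; have /disjointFl -> := tri _ _ Wpi Vpi WV.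
have yV : y \in V by rewrite -WV (subsetP uW) // inE mem_rcons inE eqxx.
by have := disjointFr Vq yV; rewrite !inE eqxx.
Qed.

Definition set_ser F : ser C T := fun v => if v is [::] then 0 else F (set_of v).

Definition psum_ser Rb F : ser C T := fun v => psum Rb F (set_of v).

Lemma psum_intv_conv F s : s != [::] -> chain s ->
  psum intv F (set_of s) = (set_ser F * psum_ser intv F) s.
Proof.
case: s => // x s _ ch; rewrite psum_gsum serMS mul0r add0r.
rewrite -[lder x _]/(lders [:: x] (set_ser F)).
rewrite -cat1s in ch; have: [:: x] != [::] by [].
move: [:: x] ch => u.
elim: s u => [|y q IH] u ch u0.
  rewrite serM0 /lders cats0 /psum_ser (_ : set_of [::] = set0);
    last by apply/setP => z; rewrite !inE.
  rewrite psum_set0 mulr1 /gsum cats0 /set_ser; case: u u0 ch => // z v u0 ch.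
  rewrite -(psum_one_block intv F (set_of_neq0 u0)); apply: eq_bigl => pi.
  congr (_ && _); first by rewrite cats0.
  rewrite /block_avoiding; apply: eq_existsb => V; congr (_ && _).
  by rewrite (_ : [disjoint V & _]) ?andbT //; apply/pred0P => t; rewrite !inE andbF.
rewrite gsum_intv_cons // serMS IH; last 2 first.
- by rewrite cat_rcons.
- by case: (u).
congr (_ + _).
  by congr (_ * _); rewrite /lders cats0 /set_ser; case: (u) u0.
suff -> : lders (rcons u y) (set_ser F) = lder y (lders u (set_ser F)) by [].
by apply: serP => w; rewrite /lder /lders cat_rcons.
Qed.

(** Both recursions cut off a prefix, and the full prefix isolates the value at [s]. Only prefixes
    and the suffixes behind them occur, whence the hypothesis on infixes. *)
Lemma psum_intv_boolc F (M : ser C T) s : M [::] = 1 -> chain s -> s != [::] ->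
  (forall v, infix v s -> psum intv F (set_of v) = M v) ->
  boolc M s = F (set_of s).
Proof.
move=> M1; have e0 := boolc0 M1.
move: {2}(size s) (leqnn (size s)) => n.
elim: n s => [|n IH] s sn ch s0 FM; first by case: s sn s0 {ch FM}.
have := congr1 (fun h : ser C T => h s) (boolcE M1).
have := psum_intv_conv F s0 ch; rewrite FM ?infix_refl // => {1}->.
rewrite serDE ser1E;
  have -> : (if s is [::] then 1 else 0 : C) = 0 by case: s s0 {ch sn FM}.
rewrite add0r !serM_cat !big_ord_recr /= drop_size take_size M1 mulr1.
rewrite [psum_ser _ _ _](FM [::]) ?infix0s // M1 mulr1.
have -> : set_ser F s = F (set_of s) by case: s s0 {ch sn FM}.
rewrite (eq_bigr (fun i : 'I_(size s) => boolc M (take i s) * M (drop i s))).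
  by move=> /addrI ->.
move=> i _; rewrite /psum_ser FM;
  last by rewrite -[X in infix _ X](cat_take_drop i s) suffix_infix.
congr (_ * _); case: (eqVneq (take i s) [::]) => [->|t0]; first by rewrite e0.
have ti : infix (take i s) s by rewrite -[X in infix _ X](cat_take_drop i s)
    prefix_infix.
rewrite IH //; first by move: t0; rewrite /set_ser; case: (take i s).
- rewrite -ltnS; apply: leq_trans sn; rewrite size_take ltn_ord; exact: ltn_ord.
- by apply: subseq_chain ch; exact: take_subseq.
- by move=> v vt; apply: FM; apply: infix_trans vt ti.
Qed.

End OrderedPartitions.

(** * Cumulants of a two-faced family in the order of the chi-word *)

Section PartitionTransport.
Context (C : comNzRingType) (T0 T : finType) (e : T0 -> T).
Hypothesis e_inj : injective e.

Lemma psum_imset (R0 : rel {set T0}) (R : rel {set T}) (F : {set T} -> C)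
    (S : {set T0}) :
  (forall V W, R0 V W = R (e @: V) (e @: W)) ->
  \sum_(pi in parts R0 S) \prod_(V in pi) F (e @: V) = psum R F (e @: S).
Proof.
move=> RE; have ie := imset_inj e_inj.
pose im (pi : {set {set T0}}) := [set e @: V | V : {set T0} in pi].
rewrite /psum; have -> : parts R (e @: S) = [set im pi | pi in parts R0 S].
  apply/setP => pi; apply/idP/imsetP => [/partsP[P H]|[rho /partsP[P H] ->]].
    have imK V : V \in pi -> e @: (e @^-1: V) = V.
      move=> Vpi; apply/setP => y; apply/imsetP/idP => [[x]|yV].
        by rewrite inE => xV ->.
      have /imsetP[x xS yx] := subsetP (partitionS P Vpi) y yV.
      by exists x; rewrite // inE -yx.
    have piE : pi = im [set e @^-1: V | V : {set T} in pi].
      apply/setP => V; apply/idP/imsetP => [Vpi|[W /imsetP[V' V'pi ->] ->]].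
        by exists (e @^-1: V); rewrite ?imK //; apply: imset_f.
      by rewrite imK.
    exists [set e @^-1: V | V : {set T} in pi] => //.
    apply/partsP; split; first by rewrite -(imset_partition _ _ e_inj) -/(im _) -piE.
    move=> V W /imsetP[V' V'pi ->] /imsetP[W' W'pi ->] VW; rewrite RE !imK //.
    by apply: H => //; apply: contraNneq VW => ->.
  apply/partsP; split; first by rewrite (imset_partition _ _ e_inj).
  move=> V W /imsetP[V' V'pi ->] /imsetP[W' W'pi ->] VW; rewrite -RE.
  by apply: H => //; apply: contraNneq VW => ->.
rewrite big_imset /=; last by move=> pi rho _ _; apply: (imset_inj ie).
by apply: eq_bigr => pi _; rewrite big_imset //= => V W _ _; apply: ie.
Qed.

End PartitionTransport.

Section CumulantsOfSequences.
Context (P : partition_class).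
Context (C : fieldType) (A : algType C) (phi : unital_functional A).

(** With sequences as arguments, equalities between cumulants indexed by different ordinals become
    equalities of sequences. *)
Definition cum (s : seq (side * A)) : C :=
  cumulant P phi (fun i : 'I_(size s) => (tnth (in_tuple s) i).1)
                 (fun i => (tnth (in_tuple s) i).2).

Lemma cum_nth n (chi : 'I_n -> side) (x : 'I_n -> A) s (e : n = size s) d :
  (forall i : 'I_n, nth d s i = (chi i, x i)) -> cumulant P phi chi x = cum s.
Proof.
move=> nthE; apply: (@cast_fam _ _ (fun n => cumulant P phi (n := n)) _ _ e) => i.
  by rewrite (tnth_nth d) /= nthE.
by rewrite (tnth_nth d) /= nthE.
Qed.

Lemma cum_enum n (chi : 'I_n -> side) (x : 'I_n -> A) :
  cumulant P phi chi x = cum [seq (chi i, x i) | i <- enum 'I_n].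
Proof.
case: n chi x => [|n] chi x.
  by apply: (cum_nth _ (d := (Left, 0))) => [|[]//]; rewrite size_map size_enum_ord.
apply: (cum_nth _ (d := (chi ord0, x ord0))) => [|i].
  by rewrite size_map size_enum_ord.
by rewrite (nth_map ord0) ?size_enum_ord // nth_ord_enum.
Qed.

Lemma cum_restr n (V : {set 'I_n}) (chi : 'I_n -> side) (x : 'I_n -> A) :
  cumulant P phi (restr (V := V) chi) (restr x) =
  cum [seq (chi i, x i) | i <- enum V].
Proof.
case: n V chi x => [|n] V chi x.
  have V0 : V = set0 by apply/setP => -[].
  rewrite {V}V0; apply: (cum_nth _ (d := (Left, 0))) => [|i].
    by rewrite size_map -cardE.
  by have := enum_val i => -[].
apply: (cum_nth _ (d := (chi ord0, x ord0))) => [|i]; first by rewrite size_map -cardE.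
rewrite (nth_map ord0) -?cardE ?ltn_ord //.
by rewrite /restr (enum_val_nth ord0).
Qed.

End CumulantsOfSequences.

Lemma BNC_parts n (chi : 'I_n -> side) : BNC chi = parts (nc (chi_lt chi)) setT.
Proof. by []. Qed.

(** A block fails to be an interval exactly when another block has an element between two of its
    own, so the condition is one on pairs of blocks. *)
Lemma BI_parts n (chi : 'I_n -> side) : BI chi = parts (intv (chi_lt chi)) setT.
Proof.
apply/setP => pi; rewrite inE; apply/andP/partsP => -[P H]; split=> //.
  move=> V W Vpi Wpi VW; apply/intvP => a b c aV bW cV ab bc.
  move/forall_inP: H => /(_ V Vpi)/forall_inP/(_ a aV)/forall_inP/(_ c cV).
  move=> /forallP/(_ b); rewrite ab bc /= => bV.
  have /trivIsetP/(_ V W Vpi Wpi VW)/disjointFr/(_ bV) := partition_trivIset P.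
  by rewrite bW.
apply/forall_inP => V Vpi; do 2![apply/forall_inP => ? ?].
apply/forallP => b; apply/implyP => /andP[ab bc].
have : b \in cover pi by rewrite (cover_partition P).
case/bigcupP => W Wpi bW; case: (eqVneq V W) => [->//|VW].
have /intvP H' := H V W Vpi Wpi VW; by case: (H' _ _ _ _ bW _ ab bc).
Qed.

(** * Finite systems with an order of multiplication and an order of chi *)

Section System.
Context (T : finType) (pos : T -> nat) (sd : T -> side).
Hypothesis pos_inj : injective pos.
Implicit Types (S V : {set T}).

Definition tlt (s t : T) : bool :=
  match sd s, sd t with
  | Left, Left => (pos s < pos t)%N
  | Left, Right => true
  | Right, Left => false
  | Right, Right => (pos t < pos s)%N
  end.

Lemma tlt_asym s t : tlt s t -> tlt t s = false.
Proof.
rewrite /tlt; case: (sd s); case: (sd t) => // st; apply/negbTE;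
by rewrite -leqNgt ltnW.
Qed.

Lemma tlt_trans : transitive tlt.
Proof.
rewrite /tlt => t s r; case: (sd s); case: (sd t); case: (sd r) => //.
  exact: ltn_trans.
by move=> ts rt; apply: ltn_trans rt ts.
Qed.

Lemma tlt_total s t : s != t -> tlt s t || tlt t s.
Proof.
have pi : s != t -> ((pos s < pos t) || (pos t < pos s))%N.
  by rewrite -neq_ltn (inj_eq pos_inj).
by rewrite /tlt; case: (sd s); case: (sd t) => // /pi //; rewrite orbC.
Qed.

Definition timeseq S : seq T := sort (relpre pos leq) (enum S).

Lemma timeseq_uniq S s : sorted (relpre pos ltn) s -> s =i S -> s = timeseq S.
Proof.
move=> ss sS; apply: (irr_sorted_eq (leT := relpre pos ltn)) => //.
- by move=> a b c /=; apply: ltn_trans.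
- by move=> a /=; rewrite ltnn.
- rewrite -sorted_map ltn_sorted_uniq_leq map_inj_uniq // sort_uniq enum_uniq /=.
  by rewrite sorted_map; apply: sort_sorted => a b /=; apply: leq_total.
- by move=> t; rewrite sS mem_sort mem_enum.
Qed.

Lemma mem_timeseq S : timeseq S =i S.
Proof. by move=> t; rewrite mem_sort mem_enum. Qed.

Lemma timeseq_sorted S : sorted (relpre pos ltn) (timeseq S).
Proof.
rewrite -sorted_map ltn_sorted_uniq_leq map_inj_uniq // sort_uniq enum_uniq /=.
by rewrite sorted_map; apply: sort_sorted => a b /=; apply: leq_total.
Qed.

Lemma timeseq0 : timeseq set0 = [::].
Proof. by rewrite /timeseq enum_set0. Qed.

(** Moments multiply along [timeseq], whereas series are evaluated along [chiseq]. *)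
Definition chiseq S : seq T := sort (fun s t => (s == t) || tlt s t) (enum S).

Lemma mem_chiseq S : chiseq S =i S.
Proof. by move=> t; rewrite mem_sort mem_enum. Qed.

Lemma set_chiseq S : [set t in chiseq S] = S.
Proof. by apply/setP => t; rewrite inE mem_chiseq. Qed.

Lemma chain_sorted s : chain tlt s = sorted tlt s.
Proof. by rewrite sorted_pairwise //; exact: tlt_trans. Qed.

Lemma chiseq_chain S : chain tlt (chiseq S).
Proof.
set le := fun s t => (s == t) || tlt s t.
have le_trans : transitive le.
  move=> t s r /orP[/eqP -> //|st] /orP[/eqP <-|tr]; first by rewrite /le st orbT.
  by rewrite /le (tlt_trans st tr) orbT.
have : sorted le (chiseq S).
  apply: sort_sorted => s t; rewrite /le; case: eqVneq => //= st.
  by rewrite tlt_total.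
rewrite sorted_pairwise // /chain => pw.
have uq : uniq (chiseq S) by rewrite sort_uniq enum_uniq.
elim: (chiseq S) uq pw => //= x s IH /andP[xs us] /andP[xa sa].
rewrite IH // andbT; apply/allP => y ys; have := allP xa y ys.
by rewrite /le; case: eqVneq => // xy; rewrite xy ys in xs.
Qed.

Lemma chain_chiseq s : chain tlt s -> s = chiseq [set t in s].
Proof.
move=> cs; apply: (irr_sorted_eq (leT := tlt)).
- exact: tlt_trans.
- by move=> t; case E: (tlt t t) => //; have := tlt_asym E; rewrite E.
- by rewrite -chain_sorted.
- by rewrite -chain_sorted; exact: chiseq_chain.
- by move=> t; rewrite mem_chiseq inE.
Qed.

Section Moments.
Context (C : fieldType) (A : algType C) (phi : unital_functional A) (x : T -> A).

Definition letters (s : seq T) : seq (side * A) := [seq (sd t, x t) | t <- s].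

Definition kap (P : partition_class) V : C := cum P phi (letters (timeseq V)).

Definition moment S : C := phi (\prod_(t <- timeseq S) x t).

Lemma moment0 : moment set0 = 1.
Proof. by rewrite /moment timeseq0 big_nil ufun1. Qed.

(** [R] is abstract so that [nc] and [intv] share the proof; the second hypothesis says that it is
    determined by the order. The ordinals in the definition of cumulants are matched with [S] by
    enumerating it in time order, and this enumeration restricts to blocks. *)
Lemma moment_class (P : partition_class) (R : forall T : finType, rel T -> rel {set
    T}) S :
  (forall n (chi : 'I_n -> side), P n chi = parts (R _ (chi_lt chi)) setT) ->
  (forall (T0 : finType) (e : T0 -> T) (lt0 : rel T0), injective e ->
    (forall s t, lt0 s t = tlt (e s) (e t)) ->
    forall V W : {set T0}, R _ lt0 V W = R _ tlt (e @: V) (e @: W)) ->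
  moment S = psum (R _ tlt) (kap P) S.
Proof.
move=> PE RE; case: (eqVneq S set0) => [->|S0]; first by rewrite moment0 psum_set0.
have Ppart n chi pi : pi \in P n chi -> partition pi [set: 'I_n].
  by rewrite PE => /partsP[].
have PT n chi : (0 < n)%N -> [set setT] \in P n chi.
  by move=> n0; rewrite PE one_in_parts // -card_gt0 cardsT card_ord.
pose n := size (timeseq S); pose e : 'I_n -> T := tnth (in_tuple (timeseq S)).
have uq : uniq (timeseq S) by rewrite sort_uniq enum_uniq.
have e_inj : injective e by apply/tuple_uniqP.
have eS : e @: setT = S.
  apply/setP => t; rewrite -[in RHS]mem_timeseq; apply/imsetP/idP => [[i _ ->]|].
    exact: mem_tnth.
  by move=> /(@tnthP _ _ (in_tuple (timeseq S)))[i ->]; exists i.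
have n0 : (0 < n)%N by rewrite /n size_sort -cardE card_gt0.
have e_pos i j : (pos (e i) < pos (e j))%N = (i < j)%N.
  have homo (k l : 'I_n) : (k < l)%N -> (pos (e k) < pos (e l))%N.
    rewrite /e !(tnth_nth (e k)) /= => kl.
    have tr : transitive (relpre pos ltn) by move=> ? ? ?; apply: ltn_trans.
    by apply: (sorted_ltn_nth tr _ (timeseq_sorted S)); rewrite ?inE ?ltn_ord.
  case: (ltngtP i j) => [/homo|/homo ji|/val_inj ->]; rewrite ?ltnn //.
  by apply/negbTE; rewrite -leqNgt ltnW.
rewrite /moment big_tnth -/n (cumulant_moment PT Ppart phi (sd \o e)) // PE -[in RHS]eS.
rewrite -(psum_imset e_inj (R0 := R _ (chi_lt (sd \o e)))); last first.
  by apply: RE => // i j; rewrite /tlt /chi_lt /= !e_pos.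
apply: eq_bigr => pi _; apply: eq_bigr => V _; rewrite cum_restr /kap /letters.
rewrite -(@timeseq_uniq (e @: V) [seq e i | i <- enum V]) -?map_comp //.
  rewrite sorted_map (eq_sorted (e' := relpre val ltn)); last by move=> i j /=;
    rewrite e_pos.
  rewrite -sorted_map; apply: (subseq_sorted ltn_trans (s2 := map val (enum 'I_n))).
    by apply: map_subseq; rewrite [X in subseq _ X]enumT; exact: filter_subseq.
  by rewrite val_enum_ord iota_ltn_sorted.
by move=> t; apply/mapP/imsetP => -[k]; rewrite ?mem_enum => kV ->; exists k;
  rewrite ?mem_enum.
Qed.

Lemma moment_nc S : moment S = psum (nc tlt) (kap BNC) S.
Proof.
apply: (moment_class (R := nc)) => [n chi|T0 e lt0 e_inj lt_e V W].
  exact: BNC_parts.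
apply/ncP/ncP => H.
  move=> ? ? ? ? /imsetP[a aV ->] /imsetP[b bW ->] /imsetP[c cV ->] /imsetP[d dW ->].
  by rewrite -!lt_e; apply: H.
by move=> a b c d aV bW cV dW; rewrite !lt_e; apply: H; apply: imset_f.
Qed.

Lemma moment_intv S : moment S = psum (intv tlt) (kap BI) S.
Proof.
apply: (moment_class (R := intv)) => [n chi|T0 e lt0 e_inj lt_e V W].
  exact: BI_parts.
apply/intvP/intvP => H.
  move=> ? ? ? /imsetP[a aV ->] /imsetP[b bW ->] /imsetP[c cV ->].
  by rewrite -!lt_e; apply: H.
by move=> a b c aV bW cV; rewrite !lt_e; apply: H; apply: imset_f.
Qed.

End Moments.
End System.

(** * The twisted product *)

Local Notation set_of s := [set x in s].

Section SystemSeries.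
Context (T : finType) (pos : T -> nat) (sd : T -> side).
Hypothesis pos_inj : injective pos.
Context (C : fieldType) (A : algType C) (phi : unital_functional A) (x : T -> A).
Local Notation chn := (chain (tlt pos sd)).
Local Notation kap := (kap pos sd phi x).
Local Notation moment := (moment pos phi x).

Lemma moment_mom (f : ser C T) s : f [::] = 0 -> chn s ->
  (forall v, v != [::] -> chn v -> subseq v s -> f v = kap BNC (set_of v)) ->
  moment (set_of s) = mom f s.
Proof.
move=> f0 cs fk; rewrite (moment_nc sd pos_inj).
apply: psum_nc_mom => //; first exact: tlt_asym.
by move=> v v0 vs; apply: fk; rewrite // /chain; apply: subseq_pairwise vs cs.
Qed.

Lemma boolc_kap (M : ser C T) s : M [::] = 1 -> chn s -> s != [::] ->
  (forall v, chn v -> moment (set_of v) = M v) -> boolc M s = kap BI (set_of s).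
Proof.
move=> M1 cs s0 MM; apply: (psum_intv_boolc (lt := tlt pos sd)) => //.
  exact: tlt_asym.
move=> v vs; rewrite -(moment_intv sd pos_inj) MM //.
by apply: subseq_pairwise cs; apply: infixW.
Qed.

Lemma kap_mom (h : ser C T) s : h [::] = 0 -> chn s -> s != [::] ->
  (forall v, chn v -> moment (set_of v) = mom h v) -> kap BNC (set_of s) = h s.
Proof.
move=> h0 cs s0 hM; rewrite [in RHS](chain_chiseq pos_inj cs).
(* Reading each set in the order of chi turns [h] into a function of blocks, to which [psum_inj]
   applies. *)
pose G V := h (chiseq pos sd V); rewrite -/(G (set_of s)).
apply: (psum_inj (Rb := nc (tlt pos sd))); last exact: set_of_neq0.
move=> V V0 _; rewrite -(moment_nc sd pos_inj).
have cV := chiseq_chain sd pos_inj V.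
rewrite -[V in LHS](set_chiseq pos sd) hM // -[V in RHS](set_chiseq pos sd).
apply/esym; apply: psum_nc_mom => //; first exact: tlt_asym.
move=> v v0 vs; rewrite /G -(chain_chiseq pos_inj) //.
by apply: subseq_pairwise vs cV.
Qed.

End SystemSeries.

Lemma moment_ext (T : finType) (pos : T -> nat) (sd : T -> side) (C : fieldType)
    (A A' : algType C) (phi : unital_functional A) (phi' : unital_functional A')
    (x : T -> A) (x' : T -> A') S : injective pos ->
  (forall V, kap pos sd phi x BNC V = kap pos sd phi' x' BNC V) ->
  moment pos phi x S = moment pos phi' x' S.
Proof.
move=> pos_inj kk; rewrite !(moment_nc sd pos_inj); apply: eq_bigr => pi _.
by apply: eq_bigr => V _.
Qed.

Lemma timeseq_ord n : timeseq (val : 'I_n -> nat) setT = enum 'I_n.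
Proof.
apply/esym/timeseq_uniq => [|| t]; first exact: val_inj.
  by rewrite -sorted_map val_enum_ord iota_ltn_sorted.
by rewrite mem_enum !inE.
Qed.

Lemma pairwise_flatten (T1 T2 : eqType) (r1 : rel T1) (r2 : rel T2)
    (g : T1 -> seq T2) s :
  {in s, forall t, pairwise r2 (g t)} ->
  (forall t u a b, r1 t u -> a \in g t -> b \in g u -> r2 a b) ->
  pairwise r1 s -> pairwise r2 (flatten (map g s)).
Proof.
move=> gs gr; elim: s gs => //= t s IH gs /andP[ts ss]; rewrite pairwise_cat.
rewrite gs ?mem_head // IH // ?andbT; last by move=> u us; apply: gs;
  rewrite inE us orbT.
apply/allrelP => a b aE /flattenP[l /mapP[u us ->] bE].
exact: gr (allP ts u us) aE bE.
Qed.

Section WordCumulants.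
Context (P : partition_class) (C : fieldType) (I J : choiceType).
Local Notation K := (I + J)%type.
Implicit Types (mu : dist C I J) (w : seq K).

Lemma cum_word mu w :
  cum P mu [seq (face k, Zvar C k) | k <- w] = cumulant_coef P mu w.
Proof.
case: w => [|k0 w]; first by rewrite /cumulant_coef; apply/esym;
  apply: (cum_nth _ _ _ (d := (Left, 0))) => [|[]//].
apply/esym; apply: (cum_nth _ _ _ (d := (face k0, Zvar C k0))) => [|i].
  by rewrite size_map.
by rewrite (nth_map k0) // /chi_word /letter (tnth_nth k0).
Qed.

Lemma cumulant_hom (A B : algType C) (phi : unital_functional A)
    (psi : unital_functional B) (tau : A -> B) n (chi : 'I_n -> side) x :
  (forall (m : nat) (y : 'I_m -> A),
     phi (\prod_(i < m) y i) = psi (\prod_(i < m) tau (y i))) ->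
  cumulant P phi chi x = cumulant P psi chi (fun i => tau (x i)).
Proof.
move=> H; suff rec N m (chi' : 'I_m -> side) y :
    cumulant_rec P phi N chi' y = cumulant_rec P psi N chi' (fun i => tau (y i)).
  exact: rec.
elim: N m chi' y => //= N IH m chi' y.
rewrite H; congr (_ - _); apply: eq_bigr => pi _; apply: eq_bigr => V _.
exact: IH.
Qed.

Lemma cum_joint (A : algType C) (phi : unital_functional A)
    (a : two_faced_family A I J) w :
  cum P phi [seq (face k, a k) | k <- w] = cumulant_coef P (joint_dist phi a) w.
Proof.
rewrite -cum_word [in RHS]/cum (cumulant_hom (phi := joint_dist phi a) (psi := phi)
  (tau := eval_alg a)); last first.
  by move=> m y; rewrite /= rmorph_prod.
case: w => [|k0 w].
  by apply/esym; apply: (cum_nth _ _ _ (d := (Left, 0))) => [|[]//].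
apply/esym; apply: (cum_nth _ _ _ (d := (face k0, a k0))) => [|i].
  by rewrite !size_map.
have iw : (i < size (k0 :: w))%N by rewrite -(size_map (fun k => (face k, Zvar C k))).
rewrite (nth_map k0) // !(tnth_nth (face k0, Zvar C k0)) /= -map_cons.
by rewrite (nth_map k0) // eval_algZ.
Qed.

End WordCumulants.

Lemma cumulant_coef_bBP (C : fieldType) (I J : choiceType) (mu : dist C I J) w :
  cumulant_coef BNC (bBP mu) w = cumulant_coef BI mu w.
Proof. exact: (congr1 (fun f : ncseries C _ => f w) (R_invK (eta_series mu))). Qed.

Section WordSystem.
Context (C : fieldType) (I J : choiceType) (w : seq (I + J)%type).
Local Notation K := (I + J)%type.
Local Notation T := 'I_(size w).
Local Notation pos := (val : T -> nat).
Local Notation sd := (fun t : T => face (letter t)).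
Implicit Types (mu nu : dist C I J).
Local Notation chn := (chain (tlt pos sd)).

Let pos_inj : injective pos := val_inj.

Definition subw (V : {set T}) : seq K := [seq letter t | t <- timeseq pos V].

Lemma subw_setT : subw setT = w.
Proof. by rewrite /subw timeseq_ord; exact: (map_tnth_enum (in_tuple w)). Qed.

Definition wmom mu V := moment pos mu (fun t => Zvar C (letter t)) V.
Definition wkap P mu V := kap pos sd mu (fun t => Zvar C (letter t)) P V.

Lemma wmomE mu V : wmom mu V = mu (word C (subw V)).
Proof. by rewrite /wmom /moment wordE big_map. Qed.

Lemma wkapE P mu V : wkap P mu V = cumulant_coef P mu (subw V).
Proof. by rewrite -cum_word /wkap /kap /letters /subw -map_comp. Qed.

Lemma wkap_bBP mu V : wkap BNC (bBP mu) V = wkap BI mu V.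
Proof. by rewrite !wkapE cumulant_coef_bBP. Qed.

(** Times of the factors [a] ([true]) and [b] ([false]): [a] comes before [b] on the left and after
    it on the right. Right positions being read backwards, [a] precedes [b] for chi on both faces,
    as [tlt2] records. *)
Definition pos2 (t : T * bool) : nat :=
  ((t.1 : nat).*2 + (if sd t.1 is Left then ~~ t.2 else t.2))%N.
Definition sd2 (t : T * bool) : side := sd t.1.

Lemma pos2_inj : injective pos2.
Proof.
move=> [t c] [t' c']; rewrite /pos2 /= => E.
have half_b (b : bool) m : (m.*2 + b)./2 = m by rewrite addnC half_bit_double.
have tt : t = t'.
  apply: val_inj => /=; move: (congr1 half E).
  by case: (face _); case: (face _); rewrite !half_b.
case: t' / tt E => /addnI; case: (face _); case: c; case: c' => //.
Qed.

Lemma tlt2 t c t' c' : tlt pos2 sd2 (t, c) (t', c') =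
  if t == t' then c && ~~ c' else tlt pos sd t t'.
Proof.
have lt2 (b b' : bool) (m m' : nat) : m != m' ->
    (m.*2 + b < m'.*2 + b')%N = (m < m')%N.
  move=> mm; case: (ltngtP m m') mm => // mm _.
    apply: (@leq_trans m.*2.+2); last by rewrite -doubleS;
      apply: leq_trans (leq_addr _ _); rewrite leq_double.
    by case: b; rewrite ?addn1 ?addn0.
  apply/negbTE; rewrite -leqNgt; apply: (@leq_trans m'.*2.+2).
    by case: b'; rewrite ?addn1 ?addn0 // ltnW.
  by rewrite -doubleS; apply: leq_trans (leq_addr _ _); rewrite leq_double.
rewrite /tlt /sd2 /pos2 /=; case: (eqVneq t t') => [<-|tt].
  by case: (face _); rewrite ltn_add2l; case: c; case: c'.
have tt' : (t : nat) != t' by [].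
by case: (face _); case: (face _); rewrite ?lt2 // eq_sym.
Qed.

Lemma dbl_chain s : chn s -> chain (tlt pos2 sd2) (dbl s).
Proof.
elim: s => //= t s IH /andP[ts /IH {}IH]; rewrite IH andbT tlt2 eqxx /= -all_predI.
elim: s ts {IH} => //= u s IH /andP[tu /IH ->]; rewrite !tlt2.
case: (eqVneq t u) tu => [->|_ ->] //.
by move=> uu; have := tlt_asym uu; rewrite uu.
Qed.

Definition pair2 (t : T) : seq (T * bool) :=
  if sd t is Left then [:: (t, true); (t, false)] else [:: (t, false); (t, true)].

Lemma mem_dbl (s : seq T) (t : T) c : ((t, c) \in dbl s) = (t \in s).
Proof.
elim: s => //= u s IH; rewrite !inE IH !xpair_eqE.
by case: (t == u); case: (c).
Qed.

Lemma timeseq_dbl (s : seq T) : timeseq pos2 (set_of (dbl s)) =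
  flatten [seq pair2 t | t <- timeseq pos (set_of s)].
Proof.
apply/esym/timeseq_uniq => [||[t c]]; first exact: pos2_inj.
  apply: pairwise_sorted; apply: (pairwise_flatten (r1 := relpre pos ltn)).
  - move=> t _; rewrite /pair2 /pos2.
    by case E: (face (letter t)); rewrite /= E ltn_add2l.
  - move=> t u [t' c] [u' c'] tu.
    rewrite /pair2 => tt uu; have -> : t' = t.
      by move: tt; case: (face _); rewrite !inE !xpair_eqE => /orP[] /andP[/eqP].
    have -> : u' = u.
      by move: uu; case: (face _); rewrite !inE !xpair_eqE => /orP[] /andP[/eqP].
    rewrite /pos2 /=; apply: (@leq_trans (t : nat).+1.*2); last first.
      by apply: leq_trans (leq_addr _ _); rewrite leq_double.
    rewrite doubleS ltnS -addn1 leq_add2l.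
    by case: (face _); case: c {tt}.
  - by rewrite -sorted_pairwise ?timeseq_sorted // => ? ? ?; apply: ltn_trans.
rewrite inE mem_dbl; apply/flattenP/idP => [[l /mapP[u]]|ts].
  rewrite mem_timeseq inE => us ->; rewrite /pair2.
  by case: (face _); rewrite !inE !xpair_eqE => /orP[] /andP[/eqP ->].
exists (pair2 t); first by apply: map_f; rewrite mem_timeseq inE.
by rewrite /pair2; case: (face _); rewrite !inE !xpair_eqE eqxx; case: c.
Qed.

Section Twisted.
Context (A : algType C) (phi : unital_functional A) (a b : two_faced_family A I J).
Hypothesis ab : bifree phi a b.
Let mu := joint_dist phi a.
Let nu := joint_dist phi b.
Let rho := joint_dist phi (twisted_product a b).
Let x2 (t : T * bool) : A := if t.2 then a (letter t.1) else b (letter t.1).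

Lemma moment_dbl (s : seq T) :
  moment pos2 phi x2 (set_of (dbl s)) = wmom rho (set_of s).
Proof.
rewrite wmomE /moment timeseq_dbl big_flatten big_map /= eval_alg_word /subw big_map.
congr (phi _); apply: eq_bigr => t _; rewrite /pair2 /twisted_product.
by case E: (letter t) => [i|j] /=; rewrite !big_cons big_nil mulr1 /x2 /= E.
Qed.

Lemma kap_mono (u : seq (T * bool)) c : all (fun t => t.2 == c) u ->
  kap pos2 sd2 phi x2 BNC (set_of u) =
  wkap BNC (if c then mu else nu) (set_of [seq t.1 | t <- u]).
Proof.
move=> uc;
  rewrite wkapE (_ : (if c then mu else nu) = joint_dist phi (if c then a else b)).
  rewrite -cum_joint /kap /letters.
  have -> : timeseq pos2 (set_of u) =
      [seq (t, c) | t <- timeseq pos (set_of [seq t.1 | t <- u])].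
    apply/esym/timeseq_uniq => [||[t c']]; first exact: pos2_inj.
      rewrite sorted_map; apply: sub_sorted (timeseq_sorted pos_inj _) => t t' /= tt.
      apply: (@leq_trans (t : nat).+1.*2); last first.
        by apply: leq_trans (leq_addr _ _); rewrite leq_double.
      rewrite doubleS ltnS -addn1 leq_add2l.
      by case: (face _); case: (c).
    apply/mapP/idP => [[t']|].
      rewrite mem_timeseq inE => /mapP[[t1 c1] tu ->] [-> ->].
      by rewrite inE; have /eqP /= <- := allP uc _ tu.
    rewrite inE => tu; exists t; last by have /eqP /= -> := allP uc _ tu.
    by rewrite mem_timeseq inE; apply/mapP; exists (t, c').
  rewrite /subw -!map_comp; congr cum; apply: eq_map => t /=.
  by rewrite /x2 /sd2 /=; case: (c).
by case: (c).
Qed.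

Lemma kap_mixed (u : seq (T * bool)) t t' : (t, true) \in u -> (t', false) \in u ->
  kap pos2 sd2 phi x2 BNC (set_of u) = 0.
Proof.
move=> tu tu'; rewrite /kap /cum.
have tm z : z \in u -> z \in timeseq pos2 (set_of u) by rewrite mem_timeseq inE.
set l := timeseq pos2 _ in tm *.
have sz : size (letters sd2 x2 l) = size l by rewrite size_map.
pose om (i : 'I_(size (letters sd2 x2 l))) := (nth (t, true) l i).2.
have nthE (i : 'I_(size (letters sd2 x2 l))) :
    tnth (in_tuple (letters sd2 x2 l)) i =
    (sd2 (nth (t, true) l i), x2 (nth (t, true) l i)).
  rewrite (tnth_nth (sd2 (t, true), x2 (t, true))) /= (nth_map (t, true)) //.
  by rewrite -sz.
have pickl z : z \in u -> exists i, nth (t, true) l (i : 'I_(size (letters sd2 x2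
    l))) = z.
  move=> /tm zl; have zi : (index z l < size (letters sd2 x2 l))%N.
    by rewrite sz index_mem.
  by exists (Ordinal zi); rewrite /= nth_index.
have [i iE] := pickl _ tu; have [j jE] := pickl _ tu'.
apply: (ab (omega := om)).
- have ij : i != j by apply: contra_eqN iE => /eqP ->; rewrite jE xpair_eqE andbF.
  have := ltn_ord i; have := ltn_ord j; move: ij; rewrite -val_eqE /= neq_ltn.
  by case/orP => ij jn in_; [apply: leq_trans jn|apply: leq_trans in_]; rewrite ltnS;
    exact: leq_ltn_trans (leq0n _) ij.
- by exists i, j; rewrite /om iE jE.
- move=> m; rewrite nthE /om /sd2 /x2 /=; case: (nth _ _ _) => z c /=.
  by case E: (letter z) => [k|k]; case: c => /=; apply: gen_elt.
Qed.

(** Bi-freeness makes [free_pair f g] the cumulant series of the doubled system: a subsequence of a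
    single family has the cumulants of that family, and a mixed one has cumulant zero. *)
Lemma twisted_moment (f g : ser C T) s : f [::] = 0 -> g [::] = 0 -> chn s ->
  (forall v, v != [::] -> chn v -> f v = wkap BNC mu (set_of v)) ->
  (forall v, v != [::] -> chn v -> g v = wkap BNC nu (set_of v)) ->
  wmom rho (set_of s) = product_mom f g s.
Proof.
move=> f0 g0 cs fE gE; rewrite -moment_dbl.
apply: (moment_mom (sd := sd2) pos2_inj) => [||v v0 cv vs]; first exact: free_pair0.
  exact: dbl_chain.
have mono c : all (fun t => t.2 == c) v -> chn [seq t.1 | t <- v].
  move=> vc; rewrite /chain pairwise_map; move: cv.
  apply: (sub_in_pairwise (P := [pred t | t.2 == c])) => // -[t c1] [t' c2].
  rewrite !inE /= => /eqP -> /eqP ->; rewrite tlt2.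
  by case: eqP => // _; rewrite andbN.
have fst0 : [seq t.1 | t <- v] != [::] by case: (v) v0.
have excl c : all (fun t => t.2 == c) v -> all (fun t => t.2 == ~~ c) v = false.
  by case: (v) v0 => //= t v' _ /andP[/eqP -> _]; case: c.
rewrite /free_pair serDE /lift.
case: (boolP (all _ v)) => [vt|/allPn[[t' c'] tv' /= ct']].
  by rewrite (excl true vt) addr0 (kap_mono vt) fE // (mono _ vt).
rewrite add0r; case: (boolP (all _ v)) => [vf|/allPn[[t c] tv /= ct]].
  by rewrite (kap_mono vf) gE // (mono _ vf).
by rewrite (@kap_mixed v t t') //; [case: c ct tv|case: c' ct' tv'].
Qed.

End Twisted.

Lemma twisted_conv_moment mu nu rho (f g : ser C T) s :
  is_twisted_conv mu nu rho -> f [::] = 0 -> g [::] = 0 -> chn s ->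
  (forall v, v != [::] -> chn v -> f v = wkap BNC mu (set_of v)) ->
  (forall v, v != [::] -> chn v -> g v = wkap BNC nu (set_of v)) ->
  wmom rho (set_of s) = product_mom f g s.
Proof.
move=> [A [phi [a [b [ab <- <- <-]]]]]; exact: twisted_moment.
Qed.

Lemma bBP_twisted_word mu nu rho rho' : is_twisted_conv mu nu rho ->
  is_twisted_conv (bBP mu) (bBP nu) rho' ->
  bBP rho (word C w) = rho' (word C w).
Proof.
(* [w] is recovered from the set of all its positions, which is then listed as a chain [s] for the
   order of chi. *)
move=> tw tw'; rewrite -subw_setT -!wmomE -(set_chiseq pos sd setT).
have := chiseq_chain sd pos_inj [set: T]; move: (chiseq _ _ _) => s cs.
pose cser mu : ser C T := set_ser (wkap BNC mu).
have cserE la v : v != [::] -> chn v -> cser la v = wkap BNC la (set_of v).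
  by case: v.
have bE la v : v != [::] -> chn v ->
    boolc (mom (cser la)) v = wkap BNC (bBP la) (set_of v).
  move=> v0 cv; rewrite wkap_bBP; apply: (boolc_kap pos_inj) => //.
    exact: mom0.
  by move=> u cu; apply: (moment_mom (sd := sd) pos_inj) => // z z0 cz _; apply: cserE.
have e0 la : boolc (mom (cser la)) [::] = 0 by apply: boolc0; apply: mom0.
have sys := product_momP (erefl : cser mu [::] = 0) (erefl : cser nu [::] = 0).
have sys' := product_momP (e0 mu) (e0 nu).
rewrite (twisted_conv_moment tw' (e0 mu) (e0 nu) cs (bE mu) (bE nu)).
rewrite (product_bool_free _ _ sys sys') //.
have M1 := product_system0 sys.
(* It remains to recognise the boolean cumulant series of the product as the free cumulants of
   [bBP rho], that is, as the boolean cumulants of [rho]. *)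
apply: (moment_mom (sd := sd) pos_inj) => // [|v v0 cv _]; first exact: boolc0.
rewrite -/(wkap BNC (bBP rho) (set_of v)) wkap_bBP; apply: (boolc_kap pos_inj) => //.
by move=> u cu; apply: (twisted_conv_moment tw) => // z z0 cz; apply: cserE.
Qed.

End WordSystem.

Theorem bBP_twisted (C : fieldType) (I J : choiceType) (mu nu rho rho' : dist C I J) :
  is_twisted_conv mu nu rho -> is_twisted_conv (bBP mu) (bBP nu) rho' ->
  bBP rho = rho'.
Proof. by move=> tw tw'; apply: dist_eq => w; apply: bBP_twisted_word tw tw'. Qed.

(** * Existence of bi-free families *)

Lemma supported_unmerge (C : comNzRingType) (T1 T2 : finType) (c1 : pred T1)
    (c2 : pred T2) (d : T2 -> seq T1) (F : ser C T1) : supported c1 F ->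
  (forall t, ~~ c2 t -> ~~ all c1 (d t)) -> supported c2 (unmerge d F).
Proof.
move=> sF dc w /allPn[t tw /dc/allPn[x xd cx]]; apply: sF; apply/allPn.
by exists x => //; apply/flattenP; exists (d t); rewrite // map_f.
Qed.

(** * Cumulants with a unit among the entries *)

Section UnitEntry.
Context (T : finType) (pos : T -> nat) (sd : T -> side) (pos_inj : injective pos).
Context (C : fieldType) (A : algType C) (phi : unital_functional A) (x : T -> A).
Context (j : T) (xj : x j = 1).
Implicit Types V W : {set T}.
Local Notation kap := (kap pos sd phi x BNC).
Local Notation moment := (moment pos phi x).

Lemma moment_unit V : moment V = moment (V :\ j).
Proof.
rewrite /moment (_ : timeseq pos (V :\ j) = [seq t <- timeseq pos V | t != j]).
  rewrite big_filter; congr (phi _); rewrite [RHS]big_mkcond; apply: eq_bigr => t _.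
  by case: eqP => //= ->.
apply/esym/timeseq_uniq => // [|t].
  by apply: sorted_filter (timeseq_sorted pos_inj V) => ? ? ?; apply: ltn_trans.
by rewrite mem_filter mem_timeseq !inE.
Qed.

(** Deleting the unit does not change the moment. The partitions with the singleton block of [j]
    already account for the moment of [V :\ j], and by induction every other partition except the
    one-block one contains a vanishing factor. *)
Lemma kap_unit V : j \in V -> (2 <= #|V|)%N -> kap V = 0.
Proof.
move: {2}#|V| (leqnn #|V|) => n; elim: n V => [|n IH] V Vn jV V2.
  by move: V2; rewrite leqNgt ltnS (leq_trans Vn).
pose R := nc (tlt pos sd).
have jj : tlt pos sd j j = false.
  by case E: (tlt _ _ j j) => //; have := tlt_asym E; rewrite E.
have V0 : V != set0 by apply/set0Pn; exists j.
have V1 : ~~ (V \subset [set j]).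
  by apply: contraL V2 => /subset_leq_card; rewrite cards1 -ltnNge ltnS.
have : moment V = moment (V :\ j) := moment_unit V.
rewrite [in LHS](moment_nc sd pos_inj) -/R /psum (bigID (saturated [set j])) /=.
have -> : \sum_(pi in parts R V | saturated [set j] pi) \prod_(W in pi) kap W =
    moment (V :\ j).
  rewrite (eq_bigl (fun pi => (pi \in parts R V) && (saturated [set j] pi &&
    predT [set W in pi | [disjoint W & [set j]]]))) => [|pi]; last by rewrite andbT.
  rewrite psum_split ?sub1set // => [|W W' /subsetP Wj _].
    have -> : psum R kap [set j] = moment [set j] by rewrite (moment_nc sd).
    rewrite moment_unit (_ : [set j] :\ j = set0) ?moment0 ?mul1r; last first.
      by apply/setP => t; rewrite !inE andNb.
    rewrite (moment_nc sd) //; apply: eq_bigl => pi; exact: andbT.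
  have jW t : t \in W -> t = j by move/Wj; rewrite inE => /eqP.
  apply/andP; split; apply/ncP => a b c d.
    by move=> /jW -> _ /jW -> _ ab /tlt_asym; rewrite ab.
  by move=> _ /jW -> _ /jW -> _ bc /tlt_asym; rewrite bc.
rewrite (bigD1 [set V]) /=; last first.
  rewrite one_in_parts //=; apply/forall_inP => /(_ V); rewrite inE eqxx.
  move=> /(_ isT); rewrite (negbTE V1) /= => /disjointFr/(_ jV).
  by rewrite inE eqxx.
rewrite big_set1 big1 ?addr0 => [|pi /andP[/andP[piV nsat] npi]].
  by rewrite -{2}[moment _]addr0 => /addrI.
have /partsP[P _] := piV.
have : j \in cover pi by rewrite (cover_partition P).
case/bigcupP => W Wpi jW; rewrite (bigD1 W) //= IH ?mul0r //.
- rewrite -ltnS; apply: leq_trans Vn; apply: proper_card.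
  rewrite properEneq (partitionS P Wpi) andbT; apply: contra npi => /eqP WV.
  by rewrite (partition_one P Wpi) // WV.
- rewrite ltnNge; apply: contra nsat => W1.
  have WE : W = [set j].
    by apply/esym/eqP; rewrite eqEcard sub1set jW cards1.
  apply/forall_inP => W' W'pi; case: (eqVneq W' W) => [->|WW'].
    by rewrite WE subxx.
  have /trivIsetP/(_ W' W W'pi Wpi WW') := partition_trivIset P.
  by rewrite WE => ->; rewrite orbT.
Qed.

End UnitEntry.

(** * Reduction from generated algebras to monomials *)

Section Multilinear.
Context (C : fieldType) (A : algType C).

Inductive span (D : A -> Prop) : A -> Prop :=
| span_zero : span D 0
| span_step c d u : D d -> span D u -> span D (c *: d + u).

Lemma span_add D u v : span D u -> span D v -> span D (u + v).
Proof.
elim=> [|c d {}u Dd _ IH] Dv; first by rewrite add0r.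
by rewrite -addrA; apply: span_step => //; apply: IH.
Qed.

Lemma span_elt (D : A -> Prop) c d : D d -> span D (c *: d).
Proof. by move=> Dd; rewrite -[_ *: _]addr0; apply: span_step => //;
  exact: span_zero. Qed.

Lemma span_mul (D : A -> Prop) u v : (forall d e, D d -> D e -> D (d * e)) ->
  span D u -> span D v -> span D (u * v).
Proof.
move=> DM Du Dv; elim: Du => [|c d {}u Dd _ IH]; first by rewrite mul0r;
  exact: span_zero.
rewrite mulrDl; apply: span_add IH; elim: Dv => [|c' d' v' Dd' _ IH'].
  by rewrite mulr0; exact: span_zero.
rewrite mulrDr; apply: span_add IH'; rewrite -scalerAl -scalerAr scalerA.
by apply: span_elt; apply: DM.
Qed.

Lemma multilinear_span n (F : ('I_n -> A) -> C) (D : 'I_n -> A -> Prop) :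
  multilinear F -> (forall x, (forall i, D i (x i)) -> F x = 0) ->
  forall x, (forall i, span (D i) (x i)) -> F x = 0.
Proof.
move=> mF FD.
(* [l] lists the entries that are only known to lie in a span; they are replaced by elements of [D]
   one at a time. *)
suff gen (l : seq 'I_n) x : (forall i, i \in l -> span (D i) (x i)) ->
    (forall i, i \notin l -> D i (x i)) -> F x = 0.
  by move=> x xD; apply: (gen (enum 'I_n)) => // i; rewrite mem_enum.
elim: l x => [|j l IH] x xl xD; first by apply: FD => i; apply: xD.
have Fu u : span (D j) u -> F (update x j u) = 0.
  elim=> [|c d {}u Dd _ Fu].
    have := mF x j 1 0 0; rewrite scaler0 addr0 mul1r => E.
    by apply: (addrI (F (update x j 0))); rewrite -E addr0.
  rewrite mF Fu addr0; apply/eqP; rewrite mulf_eq0; apply/orP; right; apply/eqP.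
  case: (boolP (j \in l)) => jl.
    apply: IH => i il; rewrite /update; case: eqP => [->|ij].
    - by rewrite -[d]scale1r; apply: span_elt.
    - by apply: xl; rewrite inE il orbT.
    - by [].
    - by apply: xD; rewrite inE negb_or il andbT; apply/eqP.
  apply: IH => i il; rewrite /update; case: eqP => [ij|ij] //.
  - by rewrite ij in il; rewrite il in jl.
  - by apply: xl; rewrite inE il orbT.
  - by rewrite ij.
  - by apply: xD; rewrite inE negb_or il andbT; apply/eqP.
rewrite -(Fu (x j)); last by apply: xl; rewrite mem_head.
by congr F; apply: functional_extensionality => i; rewrite /update; case: eqP => // ->.
Qed.

Lemma gen_alg_span (X : Type) (s : X -> A) (D : A -> Prop) y : D 1 ->
  (forall k, D (s k)) -> (forall d e, D d -> D e -> D (d * e)) ->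
  gen_alg s y -> span D y.
Proof.
move=> D1 Ds DM; elim=> [c|k|u v _ IHu _ IHv|u v _ IHu _ IHv].
- exact: span_elt.
- by rewrite -[s k]scale1r; apply: span_elt.
- exact: span_add.
- exact: span_mul.
Qed.

End Multilinear.

Lemma pairwise_rev (T : Type) (r : rel T) s :
  pairwise r (rev s) = pairwise (fun x y => r y x) s.
Proof.
by elim: s => //= x s IH; rewrite rev_cons pairwise_rcons all_rev IH.
Qed.

(** * A bi-free pair with prescribed distributions *)

Section FreePair.
Context (C : fieldType) (I J : choiceType).
Local Notation K := (I + J)%type.
Local Notation K2 := ((I + I) + (J + J))%type.
Context (mu nu : dist C I J).

(** [K2] groups both copies of [I] on the left and both copies of [J] on the right, so that a copy
    keeps the face of its letter. *)
Definition first_copy (k : K) : K2 :=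
  match k with inl i => inl (inl i) | inr j => inr (inl j) end.
Definition second_copy (k : K) : K2 :=
  match k with inl i => inl (inr i) | inr j => inr (inr j) end.
Definition in_first (k : K2) : bool :=
  match k with inl (inl _) | inr (inl _) => true | _ => false end.
Definition underlying (k : K2) : K :=
  match k with
  | inl (inl i) | inl (inr i) => inl i
  | inr (inl j) | inr (inr j) => inr j
  end.

(** The prescribed cumulants: those of [mu] and [nu] on the two copies and no mixed ones. The empty
    word passes the first test, with value 0. *)
Definition free_coef (w : seq K2) : C :=
  if all in_first w then R_series mu (map underlying w) else
  if all (predC in_first) w then R_series nu (map underlying w) else 0.

Lemma free_coef_nil : free_coef [::] = 0. Proof. by []. Qed.

Definition free_dist : dist C (I + I)%type (J + J)%type :=
  R_inv (NCSeries free_coef_nil).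

Local Notation Phi := free_dist.
Local Notation A := (free_alg C K2).
Definition first_family : two_faced_family A I J := fun k => Zvar C (first_copy k).
Definition second_family : two_faced_family A I J := fun k => Zvar C (second_copy k).

Lemma cumulant_coef_free w : cumulant_coef BNC Phi w = free_coef w.
Proof.
exact: (congr1 (fun f : ncseries C _ => f w) (R_invK (NCSeries free_coef_nil))).
Qed.

Lemma joint_dist_copy (in_ : K -> K2) (la : dist C I J) :
  (forall k, face (in_ k) = face k) ->
  (forall w, free_coef (map in_ w) = R_series la w) ->
  joint_dist Phi (fun k => Zvar C (in_ k)) = la.
Proof.
move=> fE FE; apply: dist_eq => w; rewrite -(subw_setT w) -!wmomE.
have mE S : wmom (joint_dist Phi (fun k => Zvar C (in_ k))) S =
    moment (val : 'I_(size w) -> nat) Phi (fun t => Zvar C (in_ (letter t))) S.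
  rewrite wmomE /moment /= eval_alg_word /subw big_map //.
rewrite mE; apply: (moment_ext (sd := fun t => face (letter t))); first exact: val_inj.
move=> V; rewrite -/(wkap BNC la V) wkapE /kap /letters.
rewrite -[RHS]FE -cumulant_coef_free -cum_word /subw -!map_comp; congr cum.
by apply: eq_map => t /=; rewrite fE.
Qed.

Lemma joint_first : joint_dist Phi first_family = mu.
Proof.
apply: joint_dist_copy => [[]|w] //; rewrite /free_coef all_map -map_comp.
rewrite (_ : all _ w); last by apply/allP => -[].
by rewrite (eq_map (g := id)) ?map_id // => -[].
Qed.

Lemma joint_second : joint_dist Phi second_family = nu.
Proof.
apply: joint_dist_copy => [[]|w] //; case: w => [|k w] //.
rewrite /free_coef !all_map -map_comp.
rewrite (_ : all (preim _ (predC _)) _); last by apply/allP => -[].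
rewrite (eq_map (g := id)) ?map_id; last by move=> -[].
by case: k.
Qed.

(** * Mixed cumulants of non-empty monomials *)

Section Monomials.
Context (n : nat) (chi : 'I_n -> side) (omega : 'I_n -> bool).
Context (l : 'I_n -> seq K2).
Hypothesis l0 : forall t, l t != [::].
Hypothesis lP : forall t k, k \in l t -> in_first k = omega t /\ face k = chi t.
Local Notation T := 'I_n.
Let m := \max_t size (l t).
Local Notation T1 := (T * 'I_m)%type.
Local Notation ser1 := (ser C T1).
Local Notation ser := (ser C T).
Implicit Types (t : T) (p q : T1).

Let sizel t : (size (l t) <= m)%N. Proof. exact: leq_bigmax. Qed.

(** Lexicographic time on pairs of an entry and a place in it. Entries are padded to the common
    length [m]; the padding consists of the positions that are not [valid]. *)
Let pos1 (p : T1) : nat := (p.1 * m + p.2)%N.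
Let sd1 (p : T1) : side := chi p.1.
Context (k0 : K2).
Let key (p : T1) : K2 := nth k0 (l p.1) p.2.
Let x1 (p : T1) : A := Zvar C (key p).
Let x t : A := \prod_(k <- l t) Zvar C k.
Let color (p : T1) := omega p.1.

Lemma pos1_lt p q : (p.1 < q.1)%N -> (pos1 p < pos1 q)%N.
Proof.
move=> pq; rewrite /pos1; apply: (@leq_trans (p.1.+1 * m)).
  by rewrite mulSn addnC -addSn leq_add2r.
by apply: leq_trans (leq_addr _ _); rewrite leq_mul2r pq orbT.
Qed.

Lemma pos1_inj : injective pos1.
Proof.
move=> [t i] [u j] E; have tu : t = u.
  apply: val_inj; case: (ltngtP t u) => // tu.
    by have := @pos1_lt (t, i) (u, j) tu; rewrite E ltnn.
  by have := @pos1_lt (u, j) (t, i) tu; rewrite E ltnn.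
by move: E; rewrite tu /pos1 /= => /addnI/val_inj ->.
Qed.

Definition slots t : seq T1 := 
  [seq (t, i) | i <- [seq i : 'I_m <- enum 'I_m | (i < size (l t))%N]].

Lemma mem_slots t p : (p \in slots t) = (p.1 == t) && (p.2 < size (l t))%N.
Proof.
apply/mapP/andP => [[k]|[/eqP pt pl]].
  by rewrite mem_filter => /andP[il _] ->; rewrite eqxx.
exists p.2; first by rewrite mem_filter pl mem_enum.
by rewrite -pt; case: (p).
Qed.

Lemma slots_neq0 t : slots t != [::].
Proof.
have sl : (0 < size (l t))%N by rewrite lt0n size_eq0.
have m0 : (0 < m)%N := leq_trans sl (sizel t).
suff : (t, Ordinal m0) \in slots t by case: (slots t).
by rewrite mem_slots eqxx.
Qed.

Lemma slots_sorted t : pairwise (relpre pos1 ltn) (slots t).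
Proof.
rewrite pairwise_map; apply: pairwise_filter.
apply: (sub_pairwise (r := relpre val ltn)) => [i j ij|]; first by rewrite /= ltn_add2l.
by rewrite -pairwise_map val_enum_ord -sorted_pairwise ?iota_ltn_sorted //;
  exact: ltn_trans.
Qed.

(* Entries on the right are read backwards in the order of chi. *)
Definition expand t : seq T1 := if chi t is Left then slots t else rev (slots t).

Lemma mem_expand t p : (p \in expand t) = (p \in slots t).
Proof. by rewrite /expand; case: (chi t) => //; rewrite mem_rev. Qed.

Lemma expand_neq0 t : expand t != [::].
Proof.
rewrite /expand; case: (chi t); rewrite ?slots_neq0 //.
by rewrite -size_eq0 size_rev size_eq0 slots_neq0.
Qed.

Lemma expand_chain s : chain (tlt val chi) s ->
  chain (tlt pos1 sd1) (flatten (map expand s)).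
Proof.
apply: pairwise_flatten => [t _|t u p q].
  rewrite /expand; case E: (chi t).
    have : all (fun p => p.1 == t) (slots t).
      by apply/allP => p; rewrite mem_slots => /andP[].
    move=> ts;
      apply: (sub_in_pairwise (P := [pred p : T1 | p.1 == t]) _ ts (slots_sorted t)) => p q.
    by rewrite !inE => /eqP pt /eqP qt /=; rewrite /tlt /sd1 pt qt E.
  rewrite pairwise_rev.
  have : all (fun p => p.1 == t) (slots t).
    by apply/allP => p; rewrite mem_slots => /andP[].
  move=> ts;
    apply: (sub_in_pairwise (P := [pred p : T1 | p.1 == t]) _ ts (slots_sorted t)) => p q.
  by rewrite !inE => /eqP pt /eqP qt /=; rewrite /tlt /sd1 pt qt E.
rewrite !mem_expand !mem_slots => tu /andP[/eqP pt _] /andP[/eqP qu _].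
move: tu; rewrite /tlt /sd1 pt qu.
by case: (chi t); case: (chi u) => // tu; apply: pos1_lt; rewrite pt qu.
Qed.

Lemma timeseq_expand (s : seq T) :
  timeseq pos1 (set_of (flatten (map expand s))) =
  flatten (map slots (timeseq (val : T -> nat) (set_of s))).
Proof.
apply/esym/timeseq_uniq => [||p]; first exact: pos1_inj.
  apply/pairwise_sorted; apply: (pairwise_flatten (r1 := relpre val ltn)).
  - by move=> t _; exact: slots_sorted.
  - move=> t u p q tu; rewrite !mem_slots => /andP[/eqP pt _] /andP[/eqP qu _].
    by apply: pos1_lt; rewrite pt qu.
  - rewrite -sorted_pairwise ?timeseq_sorted //; first exact: val_inj.
    by move=> ? ? ?; apply: ltn_trans.
rewrite inE; apply/flattenP/flattenP => -[_ /mapP[t ts ->] pt].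
  exists (expand t); last by rewrite mem_expand.
  by apply: map_f; move: ts; rewrite mem_timeseq inE.
exists (slots t); last by rewrite -mem_expand.
by apply: map_f; rewrite mem_timeseq inE.
Qed.

Lemma moment_expand (s : seq T) :
  moment pos1 Phi x1 (set_of (flatten (map expand s))) =
  moment (val : T -> nat) Phi x (set_of s).
Proof.
rewrite /moment timeseq_expand big_flatten big_map; congr (Phi _).
apply: eq_bigr => t _; rewrite /slots big_map big_filter /x1 /key /= /x (big_nth k0).
rewrite -(big_map val (fun i => i < size (l t))%N (fun i => Zvar C (nth k0 (l t) i))).
by rewrite val_enum_ord [RHS](big_nat_widen _ _ m) // /index_iota subn0.
Qed.

Definition valid p := (p.2 < size (l p.1))%N.

Lemma valid_key p : valid p -> in_first (key p) = color p /\ face (key p) = sd1 p.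
Proof. by move=> vp; apply: lP; apply: mem_nth. Qed.

Lemma kap_valid (u : seq T1) : all valid u ->
  kap pos1 sd1 Phi x1 BNC (set_of u) = free_coef (map key (timeseq pos1 (set_of u))).
Proof.
move=> uv; rewrite -cumulant_coef_free -cum_word /kap /letters -map_comp; congr cum.
apply/eq_in_map => p; rewrite mem_timeseq inE => pu /=.
by have [_ ->] := valid_key (allP uv p pu).
Qed.

Let k1 : ser1 := set_ser (kap pos1 sd1 Phi x1 BNC).
Let fa := trunc color k1.
Let fb := trunc (predC color) k1.

(** Mixed cumulants of the letters vanish by construction. Validity matters: at a padding position
    [key] returns the default [k0], whose family may differ from the colour of the position. *)
Lemma free_coef_colors (u : seq T1) : u != [::] -> all valid u ->
  (fa + fb) u = kap pos1 sd1 Phi x1 BNC (set_of u).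
Proof.
move=> u0 uv; have k1u : k1 u = kap pos1 sd1 Phi x1 BNC (set_of u).
  by rewrite /k1 /set_ser; case: (u) u0.
rewrite serDE /fa /fb /trunc -k1u.
case: (boolP (all color u)) => [ca|/allPn[p pu cp]].
  have -> : all (predC color) u = false; last by rewrite addr0.
  by case: (u) u0 ca => //= p v _ /andP[-> _].
case: (boolP (all _ u)) => [cb|/allPn[q qu /negbNE cq]]; first by rewrite add0r.
have inT r : r \in u -> key r \in map key (timeseq pos1 (set_of u)).
  by move=> ru; apply: map_f; rewrite mem_timeseq inE.
rewrite addr0 k1u kap_valid // /free_coef.
case: (boolP (all in_first _)) => [/allP/(_ _ (inT p pu))|_].
  by have [-> _] := valid_key (allP uv p pu); rewrite (negbTE cp).
case: (boolP (all _ _)) => // /allP/(_ _ (inT q qu)) /=.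
by have [-> _] := valid_key (allP uv q qu); rewrite cq.
Qed.

(* The letters of the entries from the first family are merged in a first step,
   those of the entries from the second family in a second one. *)
Let merge1 p : seq T1 := if color p then expand p.1 else [:: p].
Let merge2 t : seq T1 := if omega t then take 1 (expand t) else expand t.

Lemma all_color_expand t c : all (fun p => color p == c) (expand t) = (omega t == c).
Proof.
apply/allP/idP => [ac|/eqP tc p].
  have := expand_neq0 t; case E: (expand t) => [|p e] // _.
  have pt : p \in expand t by rewrite E mem_head.
  have := ac p pt; move: pt; rewrite mem_expand mem_slots /color.
  by case/andP => /eqP ->.
by rewrite mem_expand mem_slots /color => /andP[/eqP -> _]; rewrite tc.
Qed.

(** In [merge2] a single position represents an entry of the first family, and [merge1] expands it
    to the whole entry; the positions of the second family pass through [merge1] unchanged. *)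
Lemma flatten_merge s : flatten (map merge1 (flatten (map merge2 s))) =
  flatten (map expand s).
Proof.
elim: s => //= t s IH; rewrite map_cat flatten_cat IH; congr (_ ++ _).
rewrite /merge2; case ot: (omega t).
  case E: (expand t) (expand_neq0 t) => [|p e] // _.
  have : p \in slots t by rewrite -mem_expand E mem_head.
  rewrite mem_slots => /andP[/eqP pt _].
  by rewrite /= take0 /= cats0 /merge1 /color pt ot E.
have := all_color_expand t false; rewrite ot eqxx.
by elim: (expand t) => //= p e IHe /andP[/eqP cp /IHe {2}<-]; rewrite /merge1 cp.
Qed.

Lemma merge1_merged p : color p -> (merge1 p != [::]) && all color (merge1 p).
Proof.
move=> cp; rewrite /merge1 cp expand_neq0 /=.
have := all_color_expand p.1 true; rewrite -[omega _]/(color p) cp.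
by rewrite (eq_all (a2 := color)) // => q /=; rewrite eqb_id.
Qed.

Lemma merge1_kept p : ~~ color p -> exists2 q, ~~ color q & merge1 p = [:: q].
Proof. by move=> cp; exists p; rewrite // /merge1 (negbTE cp). Qed.

Lemma merge2_merged t : predC omega t ->
  (merge2 t != [::]) && all (predC color) (merge2 t).
Proof.
move=> /= /negbTE ot; rewrite /merge2 ot expand_neq0 /=.
have := all_color_expand t false; rewrite ot eqxx.
by rewrite (eq_all (a2 := predC color)) // => q /=; rewrite eqbF_neg.
Qed.

Lemma merge2_kept t : ~~ predC omega t ->
  exists2 q, ~~ predC color q & merge2 t = [:: q].
Proof.
move=> /= /negbNE ot; rewrite /merge2 ot.
have := all_color_expand t true; rewrite ot eqxx.
case: (expand t) (expand_neq0 t) => [|p e] // _ /= /andP[/eqP cp _].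
by exists p; rewrite ?take0 // negbK cp.
Qed.

Lemma mem_merge2 t s : t \in s ->
  exists2 p, p \in flatten (map merge2 s) & color p = omega t.
Proof.
move=> ts; have [p pm] : exists p, p \in merge2 t.
  rewrite /merge2; have := expand_neq0 t; case: (omega t);
    case: (expand t) => //= p e _.
    by exists p; rewrite take0 mem_head.
  by exists p; rewrite mem_head.
exists p; first by apply/flattenP; exists (merge2 t); rewrite // map_f.
have : p \in slots t.
  rewrite -mem_expand; move: pm; rewrite /merge2; case: (omega t) => // pm.
  exact: mem_take pm.
by rewrite mem_slots /color => /andP[/eqP ->].
Qed.

Lemma kap_monomials i j : omega i -> ~~ omega j ->
  kap (val : T -> nat) chi Phi x BNC setT = 0.
Proof.
move=> oi oj; have pos_inj : injective (val : T -> nat) := val_inj.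
have tr c : supported c (trunc c k1) by move=> u /negbTE cu; rewrite /trunc cu.
have [ga [ga0 sga E1]] := unmerge_mom merge1_merged merge1_kept
  (erefl : fa [::] = 0) (erefl : fb [::] = 0) (tr color) (tr (predC color)).
have sfb : supported (predC color) (unmerge merge1 fb).
  apply: (supported_unmerge (tr _)) => p /= /negbNE cp.
  by have := merge1_merged cp; case: (merge1 p) => //= q e /andP[->].
have sga' : supported (predC (predC color)) ga.
  by move=> u cu; apply: sga; apply: contra cu; apply: sub_all => p /= ->.
(* The roles are exchanged: the second family is merged now, and [ga] is the part that is kept. *)
have [gb [gb0 sgb E2]] := unmerge_mom merge2_merged merge2_kept
  (erefl : unmerge merge1 fb [::] = 0) ga0 sfb sga'.
pose h := gb + unmerge merge2 ga.
have hM s : chain (tlt val chi) s -> moment (val : T -> nat) Phi x (set_of s) = mom h s.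
  move=> cs; rewrite -E2 addrC -E1 /unmerge flatten_merge -moment_expand.
  apply: (moment_mom (sd := sd1) pos1_inj) => [||v v0 _ vs].
  - exact: addr0.
  - exact: expand_chain.
  apply: free_coef_colors => //; apply/allP => p pv.
  have /flattenP[_ /mapP[t _ ->]] := mem_subseq vs pv.
  by rewrite mem_expand mem_slots /valid => /andP[/eqP ->].
rewrite -(set_chiseq (val : T -> nat) chi setT).
have cs := chiseq_chain chi pos_inj setT.
have ms t : t \in chiseq (val : T -> nat) chi setT by rewrite mem_chiseq inE.
rewrite (kap_mom pos_inj _ cs _ hM); last 2 first.
- by rewrite /h serDE gb0 /unmerge ga0 addr0.
- by have := ms i; case: (chiseq _ _ _).
(* [gb] vanishes because the entry [i] belongs to the first family, and [unmerge merge2 ga] because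
   the entry [j] contributes a letter of the second. *)
rewrite /h serDE sgb ?add0r; last by apply/allPn; exists i; rewrite //= negbK.
apply: sga; have [p pf pj] := mem_merge2 (ms j).
by apply/allPn; exists p; rewrite // pj.
Qed.

End Monomials.

Lemma kappa_kap n (chi : 'I_n -> side) (x : 'I_n -> A) :
  kappa Phi chi x = kap (val : 'I_n -> nat) chi Phi x BNC setT.
Proof. by rewrite /kap timeseq_ord /kappa cum_enum. Qed.

Lemma bifree_copies : bifree Phi first_family second_family.
Proof.
move=> n chi omega x n2 [i0 [j0 ij0]] xf; have n0 : (0 < n)%N := ltnW n2.
pose Q i (y : A) (l : seq K2) :=
  (forall k, k \in l -> in_first k = omega i /\ face k = chi i) /\
  y = \prod_(k <- l) Zvar C k.
pose D i y := exists l, Q i y l.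
apply: (multilinear_span (D := D) ((kappaP Phi).1 _ chi n0)) => [y yD|i].
  have [l lE] := choice (fun i l => Q i (y i) l) yD.
  rewrite kappa_kap.
  (* An empty monomial is a unit entry, treated by [kap_unit] since [n] is at least 2; the merging
     argument concerns non-empty words. *)
  case: (boolP [exists i, l i == [::]]) => [/existsP[i /eqP li]|].
    apply: (@kap_unit _ _ _ val_inj _ _ _ _ i) => //.
      by rewrite (lE i).2 li big_nil.
    by rewrite cardsT card_ord.
  rewrite negb_exists => /forallP l0.
  have [k0 _] : exists k0, k0 \in l i0.
    by case: (l i0) (l0 i0) => // k ? _; exists k; rewrite mem_head.
  have -> : y = fun i => \prod_(k <- l i) Zvar C k.
    by apply: functional_extensionality => i; apply: (lE i).2.
  have lP i := (lE i).1.
  case oi: (omega i0) ij0; case oj: (omega j0) => // _.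
    by apply: (kap_monomials (j := j0) l0 lP k0 oi); rewrite oj.
  by apply: (kap_monomials (j := i0) l0 lP k0 oj); rewrite oi.
have D1 : D i 1 by exists [::]; split; rewrite ?big_nil.
have DM d e : D i d -> D i e -> D i (d * e).
  move=> [l [lP ->]] [l' [lP' ->]]; exists (l ++ l'); split; last by rewrite big_cat.
  by move=> k; rewrite mem_cat => /orP[/lP|/lP'].
have gen X (s : X -> A) k : (forall z, s z = Zvar C (k z)) ->
    (forall z, in_first (k z) = omega i /\ face (k z) = chi i) ->
  gen_alg s (x i) -> span (D i) (x i).
  move=> sk kP; apply: gen_alg_span => // z; exists [:: k z]; split.
    by move=> k'; rewrite inE => /eqP ->.
  by rewrite big_seq1 sk.
move: (xf i); case oi: (omega i); case ci: (chi i) => /=.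
- by apply: (gen _ _ (fun z => inl (inl z))); rewrite // oi ci.
- by apply: (gen _ _ (fun z => inr (inl z))); rewrite // oi ci.
- by apply: (gen _ _ (fun z => inl (inr z))); rewrite // oi ci.
- by apply: (gen _ _ (fun z => inr (inr z))); rewrite // oi ci.
Qed.

Lemma twisted_conv_exists : exists rho, is_twisted_conv mu nu rho.
Proof.
exists (joint_dist Phi (twisted_product first_family second_family)).
exists A, Phi, first_family, second_family.
by split; [exact: bifree_copies|exact: joint_first|exact: joint_second|].
Qed.

End FreePair.

Lemma twisted_convP (C : fieldType) (I J : choiceType) (mu nu : dist C I J) :
  is_twisted_conv mu nu (twisted_conv mu nu).
Proof.
exact: (epsilon_spec (inhabits mu) (is_twisted_conv mu nu) (twisted_conv_exists mu nu)).
Qed.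

Theorem corollary7p9 (R : realType) (I J : choiceType) (mu nu : dist R[i] I J) :
  bBP (twisted_conv mu nu) = twisted_conv (bBP mu) (bBP nu).
Proof. exact: bBP_twisted (twisted_convP mu nu) (twisted_convP _ _). Qed.
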